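(* (1) The product $\sharp$ on $G\widehat{\mathcal K}$, $[(r_1,s_1)]\sharp[(r_2,s_2)]:=[(r_1\sharp r_2,s_1\sharp s_2)]$, is well defined, and $G\widehat{\mathcal K}$ is a topological commutative group. (2) $G\widehat{\mathcal K}$ is a non-trivial group; in fact it is infinite.
   Context: $\widehat B_n$ is the profinite completion of the Artin braid group $B_n$. Profinite tangles are finite composable sequences of fundamental profinite tangles: caps $a^\epsilon_{k,l}$ (cap joining bottom positions $k+1,k+2$ among $k+l$ vertical strands, with orientation data $\epsilon$ including a cap symbol $\frown_{\uparrow\downarrow}$ or $\frown_{\downarrow\uparrow}$), oriented profinite braids $b^\epsilon_n=(b,\epsilon)$ with $b\in\widehat B_n$, and cups $c^\epsilon_{k,l}$ (cup symbol $\smile_{\uparrow\downarrow}$ or $\smile_{\downarrow\uparrow}$ at top positions $k+1,k+2$); composability means the target orientation word of each term equals the source of the next. A profinite knot is a profinite tangle with empty source and target whose skeleton graph (strands, caps, cups and braid permutations) is connected. Isotopy is the equivalence generated by the profinite Turaev moves (T1)–(T6): trivial braid invariance, braid composition, independent tangles commute, braid–tangle sliding, cap–cup cancellation, and the first Reidemeister move $(\sigma_{k+1}^c,\epsilon')\cdot c^\epsilon_{k,l}=c^{\bar\epsilon}_{k,l}$, $a^\epsilon_{k,l}\cdot(\sigma^c_{k+1},\epsilon')=a^{\bar\epsilon}_{k,l}$ for $c\in\widehat{\mathbb Z}$. $\widehat{\mathcal K}$ denotes the set of isotopy classes of profinite knots; it is a topological commutative associative monoid under the connected sum $K_1\sharp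 K_2:=\alpha_m\cdots\alpha_2\cdot\beta_{n-1}\cdots\beta_1$ (for $K_1=\alpha_m\cdots\alpha_1$, $K_2=\beta_n\cdots\beta_1$ with first terms the cup $c^{\smile_{\downarrow\uparrow}}_{0,0}$ and last terms the cap $a^{\frown_{\downarrow\uparrow}}_{0,0}$), with unit the oriented circle $a^{\frown_{\downarrow\uparrow}}_{0,0}c^{\smile_{\downarrow\uparrow}}_{0,0}$ and topology induced by the profinite topologies of the $\widehat B_n$. $G\widehat{\mathcal K}$ is the quotient of $\widehat{\mathcal K}^2$ by $(r,s)\approx(r',s')$ iff $r\sharp s'\sharp t=r'\sharp s\sharp t$ in $\widehat{\mathcal K}$ for some profinite knot $t$, with the quotient topology; the class of $(r,s)$ is written $r/s$. *)

(* Defs.v *)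
From HB Require Import structures.
From Stdlib Require Import Relations.
From Stdlib Require List.
From mathcomp Require Import fingroup perm all_boot ssralg ssrint.
From mathcomp Require Import all_classical.
From mathcomp Require Import topology.

Set Implicit Arguments.
Unset Strict Implicit.
Unset Printing Implicit Defensive.

Local Open Scope classical_set_scope.
Local Open Scope quotient_scope.
Local Open Scope group_scope.

Definition equiv_of (T : Type) (R : T -> T -> Prop) (E : equivalence T R) :
  equiv_rel T.
Proof.
refine (EquivRel (fun x y => `[< R x y >]) _ _ _); case: E => refl trans sym.
- by move=> x; apply/asboolP/refl.
- by move=> x y; apply/asboolP/asboolP; exact: sym.
- by move=> y x z /asboolP xy /asboolP yz; apply/asboolP/(trans _ y).
Defined.

Definition gcoset (G : groupType) (N : set G) (g : G) : set G :=
  [set h | N (g^-1 * h)].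

Definition is_fin_normal (G : groupType) (N : set G) : Prop :=
  [/\ N 1, forall x y, N x -> N y -> N (x / y),
      forall x y, N x -> N (x ^ y) & finite_set (range (gcoset N))].

Definition fin_normal (G : groupType) : Type := {N : set G | is_fin_normal N}.

(* The inverse limit of the finite quotients G / N: for N included in M, the
   transition map sends a coset of N to the coset of M that contains it. *)
Definition is_prolim (G : groupType) (x : fin_normal G -> set G) : Prop :=
  (forall N, exists g, x N = gcoset (sval N) g) /\
  (forall N M, sval N `<=` sval M -> x N `<=` x M).

Definition pro (G : groupType) : Type :=
  {x : fin_normal G -> set G | is_prolim x}.

HB.instance Definition _ (G : groupType) := gen_eqMixin (pro G).
HB.instance Definition _ (G : groupType) := gen_choiceMixin (pro G).

(* The subspace topology of the product of the discrete spaces of cosets. *)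
Definition pro_val (G : groupType) (x : pro G) :
  prod_topology (fun _ : fin_normal G => discrete_topology (set G)) := sval x.
HB.instance Definition _ (G : groupType) :=
  Topological.copy (pro G) (initial_topology (@pro_val G)).

Section ProGroup.
Variable G : groupType.
Implicit Types (N : fin_normal G) (x y : pro G).

Lemma gcoset_eq N g h : gcoset (sval N) g h -> gcoset (sval N) g = gcoset (sval N) h.
Proof.
case: N => N [N1 ND NJ fN] /= gh.
have NV a : N a -> N a^-1 by move=> Na; rewrite -(mul1g a^-1); apply: ND.
have NM a b : N a -> N b -> N (a * b).
  by move=> Na Nb; rewrite -(invgK b); apply: ND => //; apply: NV.
rewrite predeqE => k; split; rewrite /gcoset /= => Nk.
- have -> : h^-1 * k = (g^-1 * h)^-1 * (g^-1 * k).
    by rewrite invMg invgK -!mulgA mulKVg.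
  by apply: NM => //; apply: NV.
- have -> : g^-1 * k = (g^-1 * h) * (h^-1 * k) by rewrite -!mulgA mulKVg.
  exact: NM.
Qed.

Fact pro_in_subproof (g : G) :
  is_prolim (fun N : fin_normal G => gcoset (sval N) g).
Proof. by split=> [N|N M NM h]; [exists g | exact: NM]. Qed.

Definition pro_in (g : G) : pro G := exist _ _ (pro_in_subproof g).

Fact pro_mul_subproof x y : is_prolim (fun N : fin_normal G =>
  [set g * h | g in sval x N & h in sval y N]).
Proof.
case: x y => [x [xc xi]] [y [yc yi]]; split=> /= [N|N M NM _ [g xg [h yh <-]]].
  have [g0 xg] := xc N; have [h0 yh] := yc N.
  exists (g0 * h0); rewrite xg yh; case: N {xg yh} => N [N1 ND NJ fN] /=.
  have NV a : N a -> N a^-1 by move=> Na; rewrite -(mul1g a^-1); apply: ND.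
  have NM a b : N a -> N b -> N (a * b).
    by move=> Na Nb; rewrite -(invgK b); apply: ND => //; apply: NV.
  rewrite predeqE => k; split.
    move=> [g Ng [h Nh <-]]; rewrite /gcoset /=.
    have -> : (g0 * h0)^-1 * (g * h) = (g0^-1 * g) ^ h0 * (h0^-1 * h).
      by rewrite invMg /conjg -!mulgA mulKVg.
    by apply: NM => //; apply: NJ.
  rewrite /gcoset /= => Nk; exists g0; first by rewrite /= mulVg.
  by exists (g0^-1 * k); rewrite ?mulKVg //= mulgA -invMg.
by exists g; [exact: xi xg | exists h => //; exact: yi yh].
Qed.

Definition pro_mul x y : pro G := exist _ _ (pro_mul_subproof x y).

End ProGroup.

(* The value at x of the continuous extension of pro_in \o f, that is, the limit
   in the completion of H of f g as g in G tends to x. *)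
Definition pro_ext (G H : groupType) (f : G -> H) (x : pro G) : pro H :=
  xget (pro_in 1) [set y | forall N, exists M,
    forall g, sval x M g -> sval y N (f g)].

(* The letter (i, s) stands for the generator sigma_(i+1) when s = true and for
   its inverse when s = false. *)
Definition braid_word (n : nat) : Type := seq ('I_n.-1 * bool).
HB.instance Definition _ n := Choice.on (braid_word n).

Inductive braid_rel (n : nat) : braid_word n -> braid_word n -> Prop :=
| BraidCancel i s : braid_rel [:: (i, s); (i, ~~ s)] [::]
| BraidFar (i j : 'I_n.-1) : (i.+1 < j)%N ->
    braid_rel [:: (i, true); (j, true)] [:: (j, true); (i, true)]
| BraidNext (i j : 'I_n.-1) : j = i.+1 :> nat ->
    braid_rel [:: (i, true); (j, true); (i, true)]
              [:: (j, true); (i, true); (j, true)].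

Inductive braid_step (n : nat) : braid_word n -> braid_word n -> Prop :=
| BraidStep a b x y : braid_rel x y -> braid_step (a ++ x ++ b) (a ++ y ++ b).

Definition braid_eqv (n : nat) : relation (braid_word n) :=
  clos_refl_sym_trans _ (@braid_step n).

Definition braid_equiv (n : nat) : equiv_rel (braid_word n) :=
  equiv_of (clos_rst_is_equiv _ (@braid_step n)).

Definition braid (n : nat) : Type := {eq_quot (braid_equiv n)}.
HB.instance Definition _ n := Choice.on (braid n).
HB.instance Definition _ n := EqQuotient.on (braid n).

Section BraidGroup.
Variable n : nat.
Implicit Types (u v w : braid_word n).

Definition braid_pi w : braid n := \pi_(braid n) w.

Lemma braid_piP u v : braid_pi u = braid_pi v <-> braid_eqv u v.
Proof.
by split=> [/eqP|uv]; [|apply/eqP]; rewrite /braid_pi piE /=; [move/asboolP|apply/asboolP].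
Qed.

Lemma braid_reprK w : braid_eqv (repr (braid_pi w)) w.
Proof. by apply/braid_piP; rewrite /braid_pi reprK. Qed.

Lemma braid_eqv_cat u u' v v' :
  braid_eqv u u' -> braid_eqv v v' -> braid_eqv (u ++ v) (u' ++ v').
Proof.
move=> uu' vv'; apply: (rst_trans _ _ _ (u' ++ v)).
- elim: uu' => [_ _ [a b x y xy]|x|x y _ IH|x y z _ IH1 _ IH2].
  + by rewrite -!catA; apply: rst_step; exact: BraidStep.
  + exact: rst_refl.
  + exact: rst_sym.
  + exact: rst_trans IH1 IH2.
- elim: vv' => [_ _ [a b x y xy]|x|x y _ IH|x y z _ IH1 _ IH2].
  + by rewrite !(catA u'); apply: rst_step; exact: BraidStep.
  + exact: rst_refl.
  + exact: rst_sym.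
  + exact: rst_trans IH1 IH2.
Qed.

Definition braid_wordV w : braid_word n := rev [seq (x.1, ~~ x.2) | x <- w].

Lemma braid_wordVK : involutive braid_wordV.
Proof.
move=> w; rewrite /braid_wordV map_rev revK -map_comp -[RHS]map_id.
by apply: eq_map => -[i s] /=; rewrite negbK.
Qed.

Lemma braid_wordVl w : braid_eqv (braid_wordV w ++ w) [::].
Proof.
elim: w => [|[i s] w IH]; first exact: rst_refl.
rewrite /braid_wordV /= rev_cons -cats1 -catA /=.
apply: rst_trans IH; apply: rst_step.
have := BraidStep (braid_wordV w) w (BraidCancel i (~~ s)).
by rewrite negbK.
Qed.

Definition braid_one := braid_pi [::].
Definition braid_mul (x y : braid n) := braid_pi (repr x ++ repr y).
Definition braid_inv (x : braid n) := braid_pi (braid_wordV (repr x)).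

Lemma braid_invl x w : braid_eqv (w ++ repr x) [::] ->
  braid_mul (braid_pi w) x = braid_one.
Proof.
move=> wx; apply/braid_piP; apply: rst_trans wx.
by apply: braid_eqv_cat; [exact: braid_reprK | exact: rst_refl].
Qed.

Lemma braid_mulA : associative braid_mul.
Proof.
move=> x y z; apply/braid_piP.
apply: (rst_trans _ _ _ (repr x ++ repr y ++ repr z)).
  by apply: braid_eqv_cat; [exact: rst_refl | exact: braid_reprK].
rewrite catA; apply: rst_sym.
by apply: braid_eqv_cat; [exact: braid_reprK | exact: rst_refl].
Qed.

Lemma braid_mul1 : left_id braid_one braid_mul.
Proof.
move=> x; rewrite -[RHS]reprK; apply/braid_piP.
by apply: (@braid_eqv_cat _ [::] _ (repr x));
  [exact: braid_reprK | exact: rst_refl].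
Qed.

Lemma braid_mulr1 : right_id braid_one braid_mul.
Proof.
move=> x; rewrite -[RHS]reprK -[X in \pi X]cats0; apply/braid_piP.
by apply: braid_eqv_cat; [exact: rst_refl | exact: braid_reprK].
Qed.

Lemma braid_mulV : left_inverse braid_one braid_inv braid_mul.
Proof. by move=> x; apply/braid_invl/braid_wordVl. Qed.

Lemma braid_mulrV : right_inverse braid_one braid_inv braid_mul.
Proof.
move=> x; apply/braid_piP; apply: (rst_trans _ _ _ (repr x ++ braid_wordV (repr x))).
  by apply: braid_eqv_cat; [exact: rst_refl | exact: braid_reprK].
by rewrite -{1}(braid_wordVK (repr x)); exact: braid_wordVl.
Qed.

HB.instance Definition _ := isGroup.Build (braid n)
  braid_mulA braid_mul1 braid_mulr1 braid_mulV braid_mulrV.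

(* Equal to 1 when i.+1 >= n; every use below has i.+1 < n. *)
Definition sigma (i : nat) : braid n :=
  if insub i is Some j then braid_pi [:: (j, true)] else 1.

Definition sigma_sgn (s : bool) (i : nat) : braid n :=
  if s then sigma i else (sigma i)^-1.

(* The homomorphism sending sigma_(i+1) to f i, when f satisfies the braid
   relations. *)
Definition braid_hom (H : groupType) (f : 'I_n.-1 -> H) (b : braid n) : H :=
  \prod_(x <- repr b) (if x.2 then f x.1 else (f x.1)^-1).

Fact strand_lo_subproof (i : 'I_n.-1) : (i < n)%N.
Proof. exact: leq_trans (ltn_ord i) (leq_pred n). Qed.
Fact strand_hi_subproof (i : 'I_n.-1) : (i.+1 < n)%N.
Proof. by case: n i => [[]|m i] //; rewrite ltnS. Qed.

(* A product b2 * b1 is b2 stacked on top of b1, and 's * t' in 'S_n is 's'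
   followed by 't', so that this is a homomorphism; braid_perm b j is the bottom
   position of the strand of b whose top position is j. *)
Definition braid_perm : braid n -> 'S_n := braid_hom (fun i =>
  tperm (Ordinal (strand_lo_subproof i)) (Ordinal (strand_hi_subproof i))).

(* The locally constant extension of braid_perm. *)
Definition pro_perm (b : pro (braid n)) : 'S_n :=
  xget 1 [set s | exists N, forall g, sval b N g -> braid_perm g = s].

End BraidGroup.

(* p (resp. q) trivial strands are added on the left (resp. right) of b. *)
Definition braid_shift (p n q : nat) : braid n -> braid (p + (n + q)) :=
  braid_hom (fun i : 'I_n.-1 => sigma _ (p + i)).

(* The top position, counted from 0, of the strand with bottom position k; the
   last letter of a word is at the bottom. *)
Definition strand_top (n : nat) (w : braid_word n) (k : nat) : nat :=
  foldr (fun (x : 'I_n.-1 * bool) (k : nat) =>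
    if k == x.1 then k.+1 else if k == x.1.+1 then k.-1 else k) k w.

(* What the crossing (i, s) becomes when the strand with bottom position k is
   replaced by m parallel strands. *)
Definition cable_letter (n m : nat) (s : bool) (i k : nat) : braid n :=
  if (i.+1 < k)%N then sigma_sgn n s i
  else if (k < i)%N then sigma_sgn n s (i.-1 + m)
  else if k == i then \prod_(j < m) sigma_sgn n s (i + j)
  else \prod_(j < m) sigma_sgn n s (i + rev_ord j).

Fixpoint cable_word (n n' m : nat) (w : braid_word n) (k : nat) : braid n' :=
  if w is x :: w' then
    cable_letter n' m x.2 x.1 (strand_top w' k) * cable_word n' m w' k
  else 1.

(* ev_{p+1,m}: the strand at bottom position p + 1 is replaced by the trivial
   braid with m strands. This is not a homomorphism; pro_ext (cable p m q) is
   its extension to the completion. *)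
Definition cable (p m q : nat) (b : braid (p + (1 + q))) :
  braid (p + (m + q)) := cable_word _ m (repr b) p.

(* The additive group of integers, seen as a groupType. *)
Definition zgroup : Type := int.
HB.instance Definition _ := Choice.on zgroup.
HB.instance Definition _ := isGroup.Build zgroup
  (@GRing.addrA int) (@GRing.add0r int) (@GRing.addr0 int)
  (@GRing.addNr int) (@GRing.addrN int).

Definition Zhat : Type := pro zgroup.

Definition expgz (G : groupType) (x : G) (z : zgroup) : G :=
  match (z : int) with Posz k => x ^+ k | Negz k => x ^- k.+1 end.

Definition pro_pow (G : groupType) (x : G) (c : Zhat) : pro G :=
  pro_ext (expgz x) c.

(* An orientation word is a sequence of booleans, true for an upward arrow and
   false for a downward one. 'Cap u o v' is a_{k,l}^eps with k = size u,
   l = size v, whose cap has orientations o and ~~ o on its left and right feet;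
   likewise for 'Cup u o v' and c_{k,l}^eps. *)
Inductive fund : Type :=
| Cap (u : seq bool) (o : bool) (v : seq bool)
| Braid (n : nat) (b : pro (braid n)) (eps : n.-tuple bool)
| Cup (u : seq bool) (o : bool) (v : seq bool).

Definition fsource (g : fund) : seq bool :=
  match g with
  | Cap u o v => u ++ [:: o; ~~ o] ++ v
  | Braid n b eps => eps
  | Cup u o v => u ++ v
  end.

Definition ftarget (g : fund) : seq bool :=
  match g with
  | Cap u o v => u ++ v
  | Braid n b eps => [seq tnth eps (pro_perm b j) | j : 'I_n]
  | Cup u o v => u ++ [:: o; ~~ o] ++ v
  end.

(* The sequence [:: g1; ...; gn] stands for gn ... g2 . g1, from bottom to top;
   the tangle T2 . T1 is T1 ++ T2. *)
Definition fseq : Type := seq fund.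

Definition source (T : fseq) : seq bool :=
  if T is g :: _ then fsource g else [::].
Definition target (T : fseq) : seq bool :=
  if T is g :: T' then ftarget (last g T') else [::].

Definition is_tangle (T : fseq) : bool :=
  ~~ nilp T && sorted (fun g h => ftarget g == fsource h) T.

Definition word3 (u w v : seq bool) :
  (size u + (size w + size v)).-tuple bool :=
  cat_tuple (in_tuple u) (cat_tuple (in_tuple w) (in_tuple v)).

(* e^u (x) g (x) e^v, trivial strands being added on both sides. *)
Definition fpad (u : seq bool) (g : fund) (v : seq bool) : fund :=
  match g with
  | Cap u' o v' => Cap (u ++ u') o (v' ++ v)
  | Braid n b eps => Braid (pro_ext (@braid_shift (size u) n (size v)) b)
      (cat_tuple (in_tuple u) (cat_tuple eps (in_tuple v)))
  | Cup u' o v' => Cup (u ++ u') o (v' ++ v)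
  end.

Definition pad (u : seq bool) (T : fseq) (v : seq bool) : fseq :=
  [seq fpad u g v | g <- T].

Definition triv (w : seq bool) : fund :=
  Braid (pro_in (1 : braid (size w))) (in_tuple w).

Inductive turaev : fseq -> fseq -> Prop :=
| T1top T : is_tangle T -> turaev (T ++ [:: triv (target T)]) T
| T1bottom T : is_tangle T -> turaev (triv (source T) :: T) T
| T2 n (b1 b2 : pro (braid n)) (eps1 eps2 : n.-tuple bool) :
    ftarget (Braid b1 eps1) = eps2 ->
    turaev [:: Braid b1 eps1; Braid b2 eps2] [:: Braid (pro_mul b2 b1) eps1]
| T3 S T : is_tangle S -> is_tangle T ->
    turaev (pad [::] S (source T) ++ pad (target S) T [::])
           (pad (source S) T [::] ++ pad [::] S (target T))
| T4 T u o v u' v' (b : pro (braid (size u + (1 + size v))))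
    (i j : 'I_(size u + (1 + size v))) :
    is_tangle T ->
    i = size u :> nat -> j = size u' :> nat -> pro_perm b j = i ->
    ftarget (Braid b (word3 u [:: o] v)) = u' ++ [:: o] ++ v' ->
    turaev
      (pad u T v ++
        [:: Braid (pro_ext (@cable (size u) (size (target T)) (size v)) b)
                  (word3 u (target T) v)])
      (Braid (pro_ext (@cable (size u) (size (source T)) (size v)) b)
             (word3 u (source T) v)
        :: pad u' T v')
| T5 u o v u' o' v' :
    size u' = (size u).+1 \/ size u = (size u').+1 ->
    ftarget (Cup u o v) = fsource (Cap u' o' v') ->
    turaev [:: Cup u o v; Cap u' o' v'] [:: triv (u ++ v)]
(* The last symbol o' is forced by the orientations: it is o or ~~ o according
   to the parity of c. *)
| T6cup u o v o' (c : Zhat) :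
    let b := Braid (pro_pow (sigma _ (size u)) c) (word3 u [:: o; ~~ o] v) in
    ftarget b = ftarget (Cup u o' v) ->
    turaev [:: Cup u o v; b] [:: Cup u o' v]
| T6cap u o v o' (c : Zhat) :
    let b := Braid (pro_pow (sigma _ (size u)) c) (word3 u [:: o'; ~~ o'] v) in
    ftarget b = fsource (Cap u o v) ->
    turaev [:: b; Cap u o v] [:: Cap u o' v].

Inductive tangle_step : fseq -> fseq -> Prop :=
| TangleStep A B L R : turaev L R ->
    is_tangle (A ++ L ++ B) -> is_tangle (A ++ R ++ B) ->
    tangle_step (A ++ L ++ B) (A ++ R ++ B).

Definition isotopic : relation fseq := clos_refl_sym_trans _ tangle_step.

(* arc g x y: the vertices x and y are joined by an edge of the skeleton of g,
   where (0, j) (resp. (1, j)) is the bottom (resp. top) vertex of g at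
   position j, counted from 0. *)
Inductive arc : fund -> nat * nat -> nat * nat -> Prop :=
| ArcBraid n (b : pro (braid n)) eps (j : 'I_n) :
    arc (Braid b eps) (0%N, nat_of_ord (pro_perm b j)) (1%N, nat_of_ord j)
| ArcCap u o v : arc (Cap u o v) (0%N, size u) (0%N, (size u).+1)
| ArcCapL u o v j : (j < size u)%N -> arc (Cap u o v) (0%N, j) (1%N, j)
| ArcCapR u o v j : (size u <= j < size u + size v)%N ->
    arc (Cap u o v) (0%N, j.+2) (1%N, j)
| ArcCup u o v : arc (Cup u o v) (1%N, size u) (1%N, (size u).+1)
| ArcCupL u o v j : (j < size u)%N -> arc (Cup u o v) (0%N, j) (1%N, j)
| ArcCupR u o v j : (size u <= j < size u + size v)%N ->
    arc (Cup u o v) (0%N, j) (1%N, j.+2).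

(* The top vertices of each term are the bottom vertices of the next one. *)
Definition skel_vertex (T : fseq) (x : nat * nat) : Prop :=
  exists A g B, T = A ++ g :: B /\
    (x.1 = size A /\ (x.2 < size (fsource g))%N \/
     x.1 = (size A).+1 /\ (x.2 < size (ftarget g))%N).

Inductive skel_edge (T : fseq) : nat * nat -> nat * nat -> Prop :=
| SkelEdge A g B x y : T = A ++ g :: B -> arc g x y ->
    skel_edge T ((size A + x.1)%N, x.2) ((size A + y.1)%N, y.2).

Definition skel_connected (T : fseq) : Prop :=
  (exists x, skel_vertex T x) /\
  forall x y, skel_vertex T x -> skel_vertex T y ->
    clos_refl_sym_trans _ (skel_edge T) x y.

Definition is_knot (T : fseq) : Prop :=
  [/\ is_tangle T, source T = [::], target T = [::] & skel_connected T].

(* The topology of the disjoint union, over all shapes of sequences, of the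
   products of the corresponding profinite braid groups, defined by boxes. *)
Inductive fund_near (V : forall n, pro (braid n) -> set (pro (braid n))) :
  fund -> fund -> Prop :=
| NearCap u o v : fund_near V (Cap u o v) (Cap u o v)
| NearBraid n (b b' : pro (braid n)) eps : V n b b' ->
    fund_near V (Braid b eps) (Braid b' eps)
| NearCup u o v : fund_near V (Cup u o v) (Cup u o v).

Definition fseq_open : set (set fseq) := [set U | forall T, U T ->
  exists V : forall n, pro (braid n) -> set (pro (braid n)),
    (forall n (b : pro (braid n)), nbhs b (V n b)) /\
    forall T', List.Forall2 (fund_near V) T T' -> U T'].

Lemma fseq_openT : fseq_open setT.
Proof. by move=> T _; exists (fun=> fun=> setT); split=> // n b; exact: filterT. Qed.

Lemma fseq_openI : setI_closed fseq_open.
Proof.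
move=> U U' oU oU' T [/oU[V [nV UV]] /oU'[V' [nV' UV']]].
exists (fun n b => V n b `&` V' n b); split=> [n b|T' TT']; first exact: filterI.
have near W : (forall n b b', (V n b `&` V' n b) b' -> W n b b') ->
    List.Forall2 (fund_near W) T T'.
  move=> sW; elim: TT' => [|g g' S S' gg' _ IH]; constructor=> //.
  by case: gg' => [u o v|n b b' eps /sW|u o v]; constructor.
by split; [apply: UV | apply: UV']; apply: near => n b b' [].
Qed.

Lemma fseq_open_bigU (I : Type) (f : I -> set fseq) :
  (forall i, fseq_open (f i)) -> fseq_open (\bigcup_i f i).
Proof.
move=> of_ T [i _ /of_[V [nV UV]]]; exists V; split=> // T' /UV fT'.
by exists i.
Qed.

HB.instance Definition _ := gen_eqMixin fseq.
HB.instance Definition _ := gen_choiceMixin fseq.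
HB.instance Definition _ :=
  isOpenTopological.Build fseq fseq_openT fseq_openI fseq_open_bigU.

Definition knot : Type := set_type [set T : fseq | is_knot T].
HB.instance Definition _ := Topological.on knot.

Definition knot_seq (K : knot) : fseq := set_val K.

Lemma knot_isotopic_equivalence :
  equivalence knot (fun K L => isotopic (knot_seq K) (knot_seq L)).
Proof.
split=> [K|K L M|K L]; [exact: rst_refl | exact: rst_trans | exact: rst_sym].
Qed.

Definition Khat : Type :=
  quotient_topology {eq_quot (equiv_of knot_isotopic_equivalence)}.
HB.instance Definition _ := Topological.on Khat.
HB.instance Definition _ := Quotient.on Khat.

Definition knot_class (K : knot) : Khat := \pi_Khat K.

(* K1 # K2, for representatives alpha = cup, alpha', cap of K1 and
   beta = cup, beta', cap of K2 (from bottom to top). *)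
Definition is_connected_sum (K1 K2 K : Khat) : Prop :=
  exists (alpha beta gamma : knot) (A B : fseq),
    [/\ K1 = knot_class alpha, K2 = knot_class beta & K = knot_class gamma] /\
    [/\ knot_seq alpha = Cup [::] false [::] :: rcons A (Cap [::] false [::]),
        knot_seq beta = Cup [::] false [::] :: rcons B (Cap [::] false [::]) &
        knot_seq gamma =
          Cup [::] false [::] :: rcons (B ++ A) (Cap [::] false [::])].

(* The default value K1 plays no role: the connected sum exists and is unique. *)
Definition sharp (K1 K2 : Khat) : Khat := xget K1 (is_connected_sum K1 K2).

Definition sharp2 (p q : Khat * Khat) : Khat * Khat :=
  (sharp p.1 q.1, sharp p.2 q.2).

Definition frac_eq (p q : Khat * Khat) : Prop :=
  exists t : Khat, sharp (sharp p.1 q.2) t = sharp (sharp q.1 p.2) t.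

(* The quotient by the equivalence relation generated by frac_eq, which is frac_eq
   itself because the connected sum is associative and commutative. *)
Definition GKhat : Type :=
  quotient_topology {eq_quot (equiv_of (clos_rst_is_equiv _ frac_eq))}.
HB.instance Definition _ := Topological.on GKhat.
HB.instance Definition _ := Quotient.on GKhat.

Definition frac (p : Khat * Khat) : GKhat := \pi_GKhat p.

Definition topological_commutative_group (T : topologicalType)
    (mul : T -> T -> T) : Prop :=
  [/\ associative mul, commutative mul,
      continuous (fun p : T * T => mul p.1 p.2) &
      exists (one : T) (inv : T -> T),
        [/\ left_id one mul, left_inverse one inv mul & continuous inv]].

(* Main.v *)
(* Colour the strands by a finite commutative ring R, a crossing replacing a by
   2 b - a. On braids with n strands this is an action on the finite set R^n, so it
   extends to profinite braids, and the number of colourings is invariant under the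
   Turaev moves. Over F_2 it is 2 to the number of components, so a sequence isotopic
   to a knot is a knot; over F_3 it is, up to normalization, multiplicative for the
   connected sum, and the sums of n trefoils have pairwise distinct values, even
   after cancellation: the group of fractions is infinite.

   The connected sum does not depend on the choices because a long knot inserted in
   a strand of a knot can be slid along it, through every cap, cup and profinite
   braid, so that up to isotopy neither the place of the insertion nor the choice of
   the sequence representing the knot matters.

   For the topology, sequences form a locally profinite sigma-compact space, and the
   moves, parametrized by sequences and profinite groups, form sigma-compact
   relations. For such relations, a saturated open subset of a product contains a
   saturated open box around each of its points. This makes continuity descend to
   the product of two quotients, although a product of quotient maps need not be a
   quotient map. *)
Require Import Defs.
From mathcomp Require Import all_boot all_classical topology.
From HB Require Import structures.
From Stdlib Require Import Relations Eqdep_dec.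
From Stdlib Require List.
From mathcomp Require Import fingroup perm ssralg ssrint zmodp finalg.
From mathcomp Require Import finmap ring zify generic_quotient.

Set Implicit Arguments.
Unset Strict Implicit.
Unset Printing Implicit Defensive.

Import GRing.Theory.

Local Open Scope classical_set_scope.
Local Open Scope quotient_scope.
Local Open Scope group_scope.

(** * Profinite completions *)

(** A profinite braid is handled through its approximations. An identity between extended maps is
    checked at one group element close enough to the profinite one for all the quantities involved
    at once ([pro_near]). Cabling forces this to be done for maps that are not homomorphisms: it is
    only a cocycle over the positions of the strands, so its continuity comes from finite quotients
    built by hand.

    Colourings are counted through operators rather than numbers, because [T4] moves a tangle across
    a braid and needs local information: how a bundle of coloured strands acts on a strand that
    crosses it. Only an alternating sum and a parity enter. Over F_2 the same calculus computes
    orientation words.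

    Two obstacles shape the geometric part. Tangles are nonempty sequences, so trivial tangles must
    be carried along before anything can cancel. And a summand that slides through a cap comes out
    turned by half a turn; caps of the two orientations give opposite half-turns, and [T6cup] and
    [T6cap] reconcile them. *)

Section FinNormal.
Variable G : groupType.
Implicit Types (N M : fin_normal G) (g h a b : G) (x y : pro G).

Lemma gcoset_refl N g : gcoset (sval N) g g.
Proof. by rewrite /gcoset /= mulVg; case: N => N []. Qed.

Lemma gcosetP N g h :
  gcoset (sval N) g h <-> gcoset (sval N) g = gcoset (sval N) h.
Proof. by split=> [|->]; [exact: gcoset_eq | exact: gcoset_refl]. Qed.

(** The fibre of [f 1] is a normal subgroup because translations on both sides preserve equality of
    values, and its index is finite because the range is. Asking this instead of multiplicativity
    allows functions that record positions and cosets. *)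
Lemma fin_normal_kernel (T : Type) (f : G -> T) :
  finite_set (range f) ->
  (forall a b g, f a = f b -> f (g * a) = f (g * b)) ->
  (forall a b g, f a = f b -> f (a * g) = f (b * g)) ->
  exists N : fin_normal G, forall g h, gcoset (sval N) g h <-> f g = f h.
Proof.
move=> fin fl fr.
have E g h : f (g^-1 * h) = f 1 <-> f g = f h.
  split=> [/(fl _ _ g)|/(fl _ _ g^-1)]; first by rewrite mulKVg mulg1.
  by rewrite mulVg.
have EV a : f a = f 1 -> f a^-1 = f 1.
  by move=> fa; have := fl _ _ a^-1 fa; rewrite mulVg mulg1.
suff nN : is_fin_normal [set g | f g = f 1].
  by exists (exist _ _ nN) => g h; rewrite /gcoset /= E.
split=> //=.
- by move=> x y fx /EV fy; rewrite (fr _ 1) // mul1g.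
- move=> x y fx; rewrite conjgE; apply/E; rewrite (fr _ 1) ?mul1g //.
- set psi := fun t => [set h : G | t = f h].
  have -> : range (gcoset [set g | f g = f 1]) = psi @` range f.
    rewrite predeqE => A; split=> [[g _ <-]|[_ [g _ <-] <-]].
      exists (f g); first by exists g.
      by rewrite predeqE => h; rewrite /gcoset /psi /= E.
    by exists g => //; rewrite predeqE => h; rewrite /gcoset /psi /= E.
  exact: finite_image.
Qed.

Lemma fin_gcoset N : finite_set (range (gcoset (sval N))).
Proof. by case: N => N []. Qed.

Lemma gcoset_mulr N a b g :
  gcoset (sval N) a b -> gcoset (sval N) (a * g) (b * g).
Proof.
case: N => N [N1 ND NJ fN]; rewrite /gcoset /= => xy; have := NJ _ g xy.
by rewrite conjgE invMg !mulgA.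
Qed.

Lemma gcoset_mull N a b g :
  gcoset (sval N) a b -> gcoset (sval N) (g * a) (g * b).
Proof. by rewrite /gcoset /= invMg -!mulgA mulKg. Qed.

Lemma fin_normalI N M :
  exists L : fin_normal G, forall g h, gcoset (sval L) g h <->
    gcoset (sval N) g h /\ gcoset (sval M) g h.
Proof.
have [|||L HL] := @fin_normal_kernel (set G * set G)%type
  (fun g : G => (gcoset (sval N) g, gcoset (sval M) g)).
- apply: (@sub_finite_set _ _ (range (gcoset (sval N)) `*` range (gcoset (sval M)))).
    by move=> _ [g _ <-]; split; exists g.
  by apply: finite_setX; exact: fin_gcoset.
- by move=> x y g [/gcosetP xy /gcosetP xy']; congr pair; apply/gcosetP; exact: gcoset_mull.
- by move=> x y g [/gcosetP xy /gcosetP xy']; congr pair; apply/gcosetP; exact: gcoset_mulr.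
exists L => g h; rewrite HL; split=> [[/gcosetP ? /gcosetP ?]|[/gcosetP -> /gcosetP ->]] //.
Qed.

Lemma fin_normalT : exists N : fin_normal G, forall g h, gcoset (sval N) g h.
Proof.
have [|//|//|N HN] := @fin_normal_kernel _ (fun=> tt); last first.
  by exists N => g h; apply/HN.
by apply: (sub_finite_set (B := [set tt])) => [[] //|]; exact: finite_set1.
Qed.

Lemma pro_coset x N g : sval x N g <-> sval x N = gcoset (sval N) g.
Proof.
case: x => x [xc xi] /=; have [h ->] := xc N; split=> [/gcosetP //|->].
exact: gcoset_refl.
Qed.

Lemma pro_coset2 x N g h : sval x N g -> sval x N h <-> gcoset (sval N) g h.
Proof. by move=> /pro_coset ->. Qed.

(** Two cosets of one subgroup that meet are equal. *)
Lemma pro_eq x y : (forall N, exists g, sval x N g /\ sval y N g) -> x = y.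
Proof.
move=> xy; have : sval x = sval y.
  apply: functional_extensionality_dep => N.
  by have [g [/pro_coset -> /pro_coset ->]] := xy N.
case: x y {xy} => x px [y py] /= xy; subst y; congr exist; exact: Prop_irrelevance.
Qed.

Lemma pro_mem x N : exists g, sval x N g.
Proof.
by case: (x) => y [yc _] /=; have [g ->] := yc N; exists g; exact: gcoset_refl.
Qed.

(* The trace on G of the neighbourhoods of x. *)
Definition pro_near x (P : G -> Prop) : Prop :=
  exists N : fin_normal G, forall g, sval x N g -> P g.

Lemma pro_near_sub x N M : (forall g h, gcoset (sval M) g h -> gcoset (sval N) g h) ->
  sval x M `<=` sval x N.
Proof.
move=> MN; case: x => x [xc xi]; apply: xi => g Mg.
by have := MN 1 g; rewrite /gcoset /= invg1 mul1g; apply.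
Qed.

Lemma pro_nearI x P Q : pro_near x P -> pro_near x Q ->
  pro_near x (fun g => P g /\ Q g).
Proof.
move=> [N HN] [M HM]; have [L HL] := fin_normalI N M.
exists L => g xg; split; [apply: HN|apply: HM]; move: xg; apply: pro_near_sub => ? ? /HL [].
  by [].
by [].
Qed.

Lemma pro_nearW x (P Q : G -> Prop) : (forall g, P g -> Q g) ->
  pro_near x P -> pro_near x Q.
Proof. by move=> PQ [N HN]; exists N => g /HN /PQ. Qed.

Lemma pro_near_ex x P : pro_near x P -> exists g, P g.
Proof. by move=> [N HN]; have [g /HN] := pro_mem x N; exists g. Qed.

Lemma pro_near_mem x N : pro_near x (sval x N).
Proof. by exists N. Qed.

Lemma pro_near_in g (P : G -> Prop) : pro_near (pro_in g) P -> P g.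
Proof. by move=> [N]; apply; exact: gcoset_refl. Qed.

(* Functions on G that extend to locally constant functions on pro G. *)
Definition loc_const (T : Type) (f : G -> T) : Prop :=
  exists N : fin_normal G, forall g h, gcoset (sval N) g h -> f g = f h.

Lemma loc_const_near (T : Type) (f : G -> T) x : loc_const f ->
  exists t, pro_near x (fun g => f g = t).
Proof.
move=> [N HN]; have [g xg] := pro_mem x N.
by exists (f g), N => h; rewrite (pro_coset2 _ xg) => /HN.
Qed.

Lemma pro_near_uniq (T : Type) (f : G -> T) x t t' :
  pro_near x (fun g => f g = t) -> pro_near x (fun g => f g = t') -> t = t'.
Proof. by move=> H /(pro_nearI H) /pro_near_ex [g [<-]]. Qed.

End FinNormal.

Section Ucont.
Implicit Types (G H K : groupType).

(** Uniform continuity for the profinite topologies: modulo each [N] the value depends only on a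
    finite quotient of [G]. Homomorphisms have it for free; cabling has to be shown to have it. *)
Definition ucont G H (f : G -> H) : Prop :=
  forall N : fin_normal H, loc_const (fun g => gcoset (sval N) (f g)).

(** For each [N] the values [f g] eventually lie in a single coset. These cosets form a compatible
    family, which is the limit, so the default value in [pro_ext] is never taken. *)
Lemma pro_extP G H (f : G -> H) x : ucont f ->
  forall N, pro_near x (fun g => sval (pro_ext f x) N (f g)).
Proof.
move=> uf; rewrite /pro_ext; case: xgetP => [y _ //|nex] N; exfalso.
pose y (N : fin_normal H) := [set h | pro_near x (fun g => gcoset (sval N) (f g) h)].
have yE M g : sval x (sval (cid (uf M))) g -> y M = gcoset (sval M) (f g).
  case: cid => L /= HL xg; rewrite predeqE => h; split=> [[L' HL']|].
    have /pro_near_ex [k [/(pro_coset2 _ xg) /HL -> //]] : pro_near x (fun k =>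
      sval x L k /\ gcoset (sval M) (f k) h).
    by apply: pro_nearI; [exact: pro_near_mem|exists L'].
  by move=> gh; exists L => k /(pro_coset2 _ xg) /HL <-.
have yP : is_prolim y.
  split=> [M|M M' MM' h [L HL]].
    have [g /yE ->] := pro_mem x (sval (cid (uf M))).
    by exists (f g).
  by exists L => g /HL; exact: MM'.
apply: (nex (exist _ _ yP)) => M.
have [L HL] := uf M; exists L => g xg /=.
have [k xk] := pro_mem x (sval (cid (uf M))).
have [k' [xk' xk2]] : exists k', sval x L k' /\ sval x (sval (cid (uf M))) k'.
  by apply: pro_near_ex; apply: pro_nearI; exact: pro_near_mem.
rewrite (yE _ _ xk2); apply/gcosetP; apply: HL.
by rewrite -(pro_coset2 g xk').
Qed.

Lemma pro_ext_uniq G H (f : G -> H) x y : ucont f ->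
  (forall N, pro_near x (fun g => sval y N (f g))) -> pro_ext f x = y.
Proof.
move=> uf Hy; apply: pro_eq => N.
have /pro_near_ex [g Hg] := pro_nearI (pro_extP x uf N) (Hy N).
by exists (f g).
Qed.

Lemma pro_ext_in G H (f : G -> H) g : ucont f ->
  pro_ext f (pro_in g) = pro_in (f g).
Proof.
move=> uf; apply: pro_ext_uniq => // N; have [M HM] := uf N.
by exists M => h /HM /= ->; exact: gcoset_refl.
Qed.

Lemma ucont_comp G H K (f : G -> H) (k : H -> K) :
  ucont f -> ucont k -> ucont (k \o f).
Proof.
move=> uf uk N; have [M HM] := uk N; have [L HL] := uf M.
by exists L => g h /HL /gcosetP /HM.
Qed.

Lemma pro_near_ext G H (f : G -> H) x (P : H -> Prop) : ucont f ->
  pro_near (pro_ext f x) P -> pro_near x (fun g => P (f g)).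
Proof.
move=> uf [N HN]; have := pro_extP x uf N; apply: pro_nearW => g; exact: HN.
Qed.

Lemma pro_ext_comp G H K (f : G -> H) (k : H -> K) x :
  ucont f -> ucont k -> pro_ext k (pro_ext f x) = pro_ext (k \o f) x.
Proof.
move=> uf uk; symmetry; apply: pro_ext_uniq; first exact: ucont_comp.
by move=> N; apply: (@pro_near_ext _ _ _ _ (fun h => _ (k h))) => //; exact: pro_extP.
Qed.

Lemma ucont_id G : ucont (@id G).
Proof. by move=> N; exists N => g h; exact: gcoset_eq. Qed.

Lemma pro_ext_id G (x : pro G) : pro_ext id x = x.
Proof. by apply: pro_ext_uniq; [exact: ucont_id|move=> N; exact: pro_near_mem]. Qed.

Lemma pro_mulP G (x y : pro G) N g h : sval x N g -> sval y N h ->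
  sval (pro_mul x y) N (g * h).
Proof. by move=> xg yh; exists g => //; exists h. Qed.

Lemma pro_near_mul G (x y : pro G) (P : G -> Prop) :
  pro_near (pro_mul x y) P ->
  pro_near x (fun g => pro_near y (fun h => P (g * h))).
Proof. by move=> [N HN]; exists N => g xg; exists N => h yh; apply: HN; exact: pro_mulP. Qed.

Lemma hom1 G H (f : G -> H) : {morph f : x y / x * y} -> f 1 = 1.
Proof. by move=> fM; apply: (mulgI (f 1)); rewrite -fM !mulg1. Qed.

Lemma homV G H (f : G -> H) : {morph f : x y / x * y} -> {morph f : x / x^-1}.
Proof. by move=> fM x; apply: (mulgI (f x)); rewrite -fM !mulgV (hom1 fM). Qed.

Lemma ucont_hom G H (f : G -> H) : {morph f : x y / x * y} -> ucont f.
Proof.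
move=> fM N; have [|||M HM] := @fin_normal_kernel G _ (fun g => gcoset (sval N) (f g)).
- apply: (@sub_finite_set _ _ (range (gcoset (sval N)))); last exact: fin_gcoset.
  by move=> _ [g _ <-]; exists (f g).
- by move=> x y g /gcosetP xy; apply/gcosetP; rewrite !fM; exact: gcoset_mull.
- by move=> x y g /gcosetP xy; apply/gcosetP; rewrite !fM; exact: gcoset_mulr.
by exists M => g h /HM.
Qed.

Lemma pro_near_ext2 G H (f k : G -> H) x : (forall g, f g = k g) ->
  pro_ext f x = pro_ext k x.
Proof. by move=> fk; congr pro_ext; apply/funext. Qed.

End Ucont.

Section ProTopology.
Variable G : groupType.
Implicit Types (N M : fin_normal G) (x y : pro G).

Definition pro_ball x N : set (pro G) := [set y | sval y N = sval x N].

Lemma pro_ball_open x N : open (pro_ball x N).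
Proof.
rewrite openE => y yN; rewrite /interior.
have -> : pro_ball x N = (@pro_val G) @^-1` [set f | f N = sval x N] by [].
apply: (@initial_continuous _ _ (@pro_val G)).
have /cvg_sup/(_ N) : nbhs (pro_val y) --> pro_val y by exact: cvg_id.
apply.
exists [set f | f N = sval x N]; split=> //.
by exists [set sval x N] => //; exact: discrete_open.
Qed.

Lemma pro_ball_sub x N M : (forall g h, gcoset (sval M) g h -> gcoset (sval N) g h) ->
  pro_ball x M `<=` pro_ball x N.
Proof.
move=> MN y yM; have [g xg] := pro_mem x M.
have yg : sval y M g by rewrite yM.
have := pro_near_sub MN xg; have := pro_near_sub MN yg.
by rewrite /pro_ball /= => /pro_coset -> /pro_coset ->.
Qed.

(** Finite-index normal subgroups are stable under intersection, so the balls around [x] form a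
    filter; it converges in each coordinate, hence for the product topology. *)
Lemma pro_nbhsP x (U : set (pro G)) :
  nbhs x U <-> exists N, pro_ball x N `<=` U.
Proof.
split; last first.
  move=> [N NU]; apply: filterS NU _; apply: open_nbhs_nbhs.
  by split; [exact: pro_ball_open|].
rewrite nbhsE => -[_ [[B Bo <-] /= Bx] BU].
pose F : set_system (pro G) := filter_from setT (pro_ball x).
have FF : Filter F.
  apply: filter_from_filter; first by have [N _] := fin_normalT G; exists N.
  move=> N M _ _; have [L HL] := fin_normalI N M; exists L => // y yL.
  by split; apply: pro_ball_sub yL => g h /HL [].
have cv : ((@pro_val G) @ F) --> pro_val x.
  apply/cvg_sup => N A; rewrite nbhsE => -[_ [[C Co <-] /= Cx] CA].
  by exists N => // y yN; apply: CA; rewrite /= /pro_val yN.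
have [N _ HN] : F (@pro_val G @^-1` B) by apply: cv; apply: open_nbhs_nbhs.
by exists N; apply: subset_trans BU.
Qed.

(** An ultrafilter selects one of the finitely many cosets of each [N]. The selection is compatible
    because two members of the ultrafilter meet, so it is a point of the inverse limit. *)
Lemma pro_compact : compact [set: pro G].
Proof.
rewrite compact_ultra => F UF _.
have ex N : exists g, F [set y : pro G | sval y N = gcoset (sval N) g].
  apply: contrapT => nex.
  have /finite_fsetP [S SE] := fin_gcoset N.
  have FC (C : set G) : C \in S -> F [set y : pro G | sval y N <> C].
    move=> CS; have : [set` S] C by [].
    rewrite -SE => -[g _ <-].
    have [|//] := in_ultra_setVsetC [set y : pro G | sval y N = gcoset (sval N) g] UF.
    by move=> Fg; case: nex; exists g.
  have FI : F (\bigcap_(C in [set` S]) [set y : pro G | sval y N <> C]).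
    exact: filter_bigI.
  have [y Hy] := filter_ex FI.
  have [g yg] := pro_mem y N.
  have : sval y N \in S.
    have : [set` S] (sval y N) by rewrite -SE; exists g => //; symmetry; apply/pro_coset.
    by [].
  by move=> /Hy /=.
pose c N := sval (cid (ex N)).
have cP N : F [set y : pro G | sval y N = gcoset (sval N) (c N)].
  by rewrite /c; case: cid.
have xP : is_prolim (fun N => gcoset (sval N) (c N)).
  split=> [N|N M NM]; first by exists (c N).
  have [y [<- <-]] := filter_ex (filterI (cP N) (cP M)).
  by have [_] := svalP y; apply.
exists (exist _ _ xP); split=> // U /pro_nbhsP [N HN].
by apply: filterS (cP N) => y yN; apply: HN.
Qed.

Lemma pro_nearE x (P : G -> Prop) :
  pro_near x P <-> exists N, forall y, pro_ball x N y -> pro_near y P.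
Proof.
split=> [[N HN]|[N]]; last by apply.
by exists N => y yN; exists N => g; rewrite yN; exact: HN.
Qed.

Lemma pro_near_open (P : G -> Prop) : open [set x | pro_near x P].
Proof.
by rewrite openE => x /pro_nearE [N HN]; apply/pro_nbhsP; exists N.
Qed.

End ProTopology.

Lemma pro_ext_continuous (G H : groupType) (f : G -> H) :
  ucont f -> continuous (pro_ext f).
Proof.
move=> uf x U /pro_nbhsP [N HN]; apply/pro_nbhsP.
have [M HM] := pro_extP x uf N; exists M => y yM; apply: HN.
have /pro_near_ex [g [yg xg]] : pro_near y (fun g =>
    sval (pro_ext f y) N (f g) /\ sval (pro_ext f x) N (f g)).
  by apply: pro_nearI; [exact: pro_extP | exists M => g; rewrite yM; exact: HM].
by move: yg xg; rewrite /pro_ball /= => /pro_coset -> /pro_coset ->.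
Qed.

Lemma pro_mul_ball (G : groupType) (x y x' y' : pro G) N :
  pro_ball x N x' -> pro_ball y N y' -> pro_ball (pro_mul x y) N (pro_mul x' y').
Proof. by rewrite /pro_ball /= => -> ->. Qed.

Lemma pro_mul_continuous (G : groupType) :
  continuous (fun p : pro G * pro G => pro_mul p.1 p.2).
Proof.
move=> [x y] U /pro_nbhsP [N HN]; exists (pro_ball x N, pro_ball y N) => /=.
  by split; apply/pro_nbhsP; exists N.
by move=> [x' y'] [/= x'N y'N]; apply: HN; exact: pro_mul_ball.
Qed.

(** * Braids *)

Section BraidHom.
Variable n : nat.
Implicit Types (u v w : braid_word n) (H : groupType).

Lemma braid_eqv_ind (T : Type) (F : braid_word n -> T) :
  (forall a b x y, braid_rel x y -> F (a ++ x ++ b) = F (a ++ y ++ b)) ->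
  forall u v, braid_eqv u v -> F u = F v.
Proof. by move=> HF u v; elim=> [_ _ [a b x y /HF]|x|x y _ ->|x y z _ -> _ ->]. Qed.

Lemma braid_piM u v : braid_pi (u ++ v) = braid_pi u * braid_pi v.
Proof.
by apply/braid_piP/rst_sym; apply: braid_eqv_cat; exact: braid_reprK.
Qed.

Lemma braid_pi_nil : braid_pi [::] = 1 :> braid n.
Proof. by []. Qed.

Lemma braid_piS (P : braid n -> Prop) : (forall w, P (braid_pi w)) -> forall b, P b.
Proof. by move=> HP b; rewrite -[b]reprK; exact: HP. Qed.

Section Word.
Variables (H : groupType) (f : 'I_n.-1 -> H).

Definition word_val w : H := \prod_(x <- w) (if x.2 then f x.1 else (f x.1)^-1).

Hypothesis f_far : forall i j : 'I_n.-1, (i.+1 < j)%N -> f i * f j = f j * f i.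
Hypothesis f_next : forall i j : 'I_n.-1, j = i.+1 :> nat ->
  f i * f j * f i = f j * f i * f j.

Lemma word_val_eqv u v : braid_eqv u v -> word_val u = word_val v.
Proof.
apply: braid_eqv_ind => a b x y xy; rewrite /word_val !big_cat /=.
congr (_ * (_ * _)); case: xy => [i s|i j ij|i j ij]; rewrite !big_cons !big_nil /= !mulg1.
- by case: s; rewrite /= ?mulgV ?mulVg.
- exact: f_far.
- by rewrite !mulgA; exact: f_next.
Qed.

Lemma braid_hom_pi w : braid_hom f (braid_pi w) = word_val w.
Proof. exact: word_val_eqv (braid_reprK w). Qed.

Lemma braid_homM : {morph braid_hom f : x y / x * y}.
Proof.
elim/braid_piS => u; elim/braid_piS => v.
by rewrite -braid_piM !braid_hom_pi /word_val big_cat.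
Qed.

End Word.

Lemma hom_eq H (f g : braid n -> H) :
  {morph f : x y / x * y} -> {morph g : x y / x * y} ->
  (forall i : 'I_n.-1, f (braid_pi [:: (i, true)]) = g (braid_pi [:: (i, true)])) ->
  f =1 g.
Proof.
move=> fM gM fg; elim/braid_piS; elim=> [|[i s] w IH].
  by rewrite braid_pi_nil (hom1 fM) (hom1 gM).
rewrite -cat1s braid_piM fM gM IH; congr (_ * _); case: s => //.
have -> : braid_pi [:: (i, false)] = (braid_pi [:: (i, true)])^-1.
  apply: (mulgI (braid_pi [:: (i, true)])); rewrite mulgV -braid_piM -braid_pi_nil.
  by apply/braid_piP/rst_step; exact: (BraidStep [::] [::] (BraidCancel i true)).
by rewrite (homV fM) (homV gM) fg.
Qed.

End BraidHom.

Lemma sigmaE n (i : nat) (Hi : (i < n.-1)%N) : sigma n i = braid_pi [:: (Ordinal Hi, true)].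
Proof. by rewrite /sigma insubT. Qed.

Lemma sigma_ord n (i : 'I_n.-1) : sigma n i = braid_pi [:: (i, true)].
Proof. by rewrite (sigmaE (ltn_ord i)); congr (braid_pi [:: (_, _)]); exact: val_inj. Qed.

Lemma sigmaV_ord n (i : 'I_n.-1) : (sigma n i)^-1 = braid_pi [:: (i, false)].
Proof.
apply: (mulgI (sigma n i)); rewrite mulgV sigma_ord -braid_piM -braid_pi_nil.
by apply/braid_piP/rst_sym/rst_step; exact: (BraidStep [::] [::] (BraidCancel i true)).
Qed.

Lemma sigma_sgn_ord n s (i : 'I_n.-1) : sigma_sgn n s i = braid_pi [:: (i, s)].
Proof. by case: s; rewrite /sigma_sgn ?sigmaV_ord ?sigma_ord. Qed.

Lemma sigma_far n i j : (i.+1 < j)%N -> (j < n.-1)%N ->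
  sigma n i * sigma n j = sigma n j * sigma n i.
Proof.
move=> ij jn; have iN : (i < n.-1)%N by lia.
rewrite (sigmaE jn) (sigmaE iN) -!braid_piM; apply/braid_piP/rst_step.
exact: (BraidStep [::] [::] (@BraidFar n (Ordinal iN) (Ordinal jn) ij)).
Qed.

Lemma sigma_next n i : (i.+1 < n.-1)%N ->
  sigma n i * sigma n i.+1 * sigma n i = sigma n i.+1 * sigma n i * sigma n i.+1.
Proof.
move=> jn; have iN : (i < n.-1)%N by lia.
rewrite (sigmaE jn) (sigmaE iN) -!braid_piM; apply/braid_piP/rst_step.
exact: (BraidStep [::] [::] (@BraidNext n (Ordinal iN) (Ordinal jn) erefl)).
Qed.

Section Shift.
Variables p n q : nat.

Lemma shift_far (i j : 'I_n.-1) : (i.+1 < j)%N ->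
  sigma (p + (n + q)) (p + i) * sigma _ (p + j) = sigma _ (p + j) * sigma _ (p + i).
Proof. by move=> ij; apply: sigma_far; move: (ltn_ord i) (ltn_ord j); lia. Qed.

Lemma shift_next (i j : 'I_n.-1) : j = i.+1 :> nat ->
  sigma (p + (n + q)) (p + i) * sigma _ (p + j) * sigma _ (p + i) =
  sigma _ (p + j) * sigma _ (p + i) * sigma _ (p + j).
Proof. by move=> ji; rewrite ji addnS; apply: sigma_next; move: (ltn_ord i) (ltn_ord j); lia. Qed.

Lemma braid_shiftM : {morph @braid_shift p n q : x y / x * y}.
Proof. apply: braid_homM; [exact: shift_far|exact: shift_next]. Qed.

Lemma braid_shift_pi w : braid_shift p q (braid_pi w) =
  word_val (fun i : 'I_n.-1 => sigma (p + (n + q)) (p + i)) w.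
Proof. apply: braid_hom_pi; [exact: shift_far|exact: shift_next]. Qed.

Lemma ucont_shift : ucont (@braid_shift p n q).
Proof. exact: ucont_hom braid_shiftM. Qed.

End Shift.

(* Ascending and descending products of consecutive generators, in any group
   that satisfies the braid relations below the bound M. *)
Section Ribbon.
Variables (H : groupType) (s : nat -> H) (M : nat).
Hypothesis s_far : forall i j, (i.+1 < j)%N -> (j < M)%N -> s i * s j = s j * s i.
Hypothesis s_next : forall i, (i.+1 < M)%N ->
  s i * s i.+1 * s i = s i.+1 * s i * s i.+1.

Definition asc i m : H := \prod_(j < m) s (i + j).
Definition desc i m : H := \prod_(j < m) s (i + rev_ord j).

Lemma asc0 i : asc i 0 = 1. Proof. exact: big_ord0. Qed.
Lemma desc0 i : desc i 0 = 1. Proof. exact: big_ord0. Qed.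

Lemma asc_recr i m : asc i m.+1 = asc i m * s (i + m).
Proof. by rewrite /asc big_ord_recr. Qed.

Lemma asc_recl i m : asc i m.+1 = s i * asc i.+1 m.
Proof.
rewrite /asc big_ord_recl addn0; congr mulg.
by apply: eq_bigr => j _; rewrite /= /bump /= addnA addn1.
Qed.

Lemma asc_cat i a b : asc i (a + b) = asc i a * asc (i + a) b.
Proof.
elim: b => [|b IH]; first by rewrite addn0 asc0 mulg1.
by rewrite addnS !asc_recr IH mulgA addnA.
Qed.

Lemma desc_recl i m : desc i m.+1 = s (i + m) * desc i m.
Proof.
by rewrite /desc big_ord_recl; congr (s (i + _) * _); rewrite /= subn1.
Qed.

Lemma desc_recr i m : desc i m.+1 = desc i.+1 m * s i.
Proof.
rewrite /desc big_ord_recr /= subnn addn0; congr (_ * _).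
apply: eq_bigr => j _; congr (s _); rewrite /= subSS.
have := ltn_ord j; lia.
Qed.

Lemma desc_cat i a b : desc i (a + b) = desc (i + a) b * desc i a.
Proof.
elim: b => [|b IH]; first by rewrite addn0 desc0 mul1g.
by rewrite addnS !desc_recl IH mulgA addnA.
Qed.

Lemma asc_comm j i m :
  (forall l, (l < m)%N -> s j * s (i + l) = s (i + l) * s j) ->
  s j * asc i m = asc i m * s j.
Proof.
elim: m => [|m IH] cj; first by rewrite asc0 mulg1 mul1g.
rewrite asc_recr mulgA IH; last by move=> l lm; apply: cj; lia.
by rewrite -!mulgA cj.
Qed.

Lemma desc_comm j i m :
  (forall l, (l < m)%N -> s j * s (i + l) = s (i + l) * s j) ->
  s j * desc i m = desc i m * s j.
Proof.
elim: m => [|m IH] cj; first by rewrite desc0 mulg1 mul1g.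
rewrite desc_recl mulgA cj // -!mulgA IH //; by move=> l lm; apply: cj; lia.
Qed.

Lemma s_comm i j : (i.+1 < j)%N || (j.+1 < i)%N -> (i < M)%N -> (j < M)%N ->
  s i * s j = s j * s i.
Proof. by case/orP=> ij iM jM; [|symmetry]; apply: s_far. Qed.

(** Splitting the product at [j] leaves one braid relation in the middle; all other factors commute
    with the generator that crosses them. *)
Lemma asc_shift i L j : (i <= j)%N -> (j.+1 < i + L)%N -> (i + L <= M)%N ->
  s j.+1 * asc i L = asc i L * s j.
Proof.
move=> ij jL LM.
have -> : L = ((j - i) + (2 + (L - (j - i) - 2)))%N by lia.
rewrite !asc_cat asc_recl asc_recl asc0 mulg1 subnKC //.
rewrite mulgA asc_comm; last by move=> l lm; apply: s_comm; lia.
rewrite -!mulgA -asc_comm; last by move=> l lm; apply: s_comm; lia.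
by congr (_ * _); rewrite !mulgA s_next //; lia.
Qed.

Lemma desc_shift i L j : (i <= j)%N -> (j.+1 < i + L)%N -> (i + L <= M)%N ->
  desc i L * s j.+1 = s j * desc i L.
Proof.
move=> ij jL LM.
have -> : L = ((j - i) + (2 + (L - (j - i) - 2)))%N by lia.
rewrite !desc_cat desc_recl desc_recl desc0 mulg1 subnKC // addn1 addn0.
rewrite -mulgA -desc_comm; last by move=> l lm; apply: s_comm; lia.
rewrite !mulgA desc_comm; last by move=> l lm; apply: s_comm; lia.
by congr (_ * _); rewrite -!mulgA; congr (_ * _); rewrite !mulgA s_next //; lia.
Qed.

(** This lemma and the next two are the third Reidemeister move with one of its strands replaced by
    [m] parallel ones, for the three choices of that strand. *)
Lemma asc_asc i m : (i + m.+1 <= M)%N -> asc i.+1 m * asc i m.+1 = asc i m.+1 * asc i m.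
Proof.
move=> iM; suff E l : (l <= m)%N -> asc i.+1 l * asc i m.+1 = asc i m.+1 * asc i l by exact: E.
elim: l => [|l IH] lm; first by rewrite !asc0 mulg1 mul1g.
rewrite !asc_recr -mulgA addSn -asc_recr asc_shift; try lia.
by rewrite !mulgA IH //; lia.
Qed.

Lemma desc_asc i m : (i + m.+1 <= M)%N -> desc i.+1 m * asc i m.+1 = asc i m.+1 * desc i m.
Proof.
move=> iM; suff E l : (l <= m)%N -> desc i.+1 l * asc i m.+1 = asc i m.+1 * desc i l by exact: E.
elim: l => [|l IH] lm; first by rewrite !desc0 mulg1 mul1g.
rewrite !desc_recl -mulgA IH; last lia.
by rewrite mulgA addSn asc_shift ?mulgA //; lia.
Qed.

Lemma desc_desc i m : (i + m.+1 <= M)%N -> desc i m.+1 * desc i.+1 m = desc i m * desc i m.+1.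
Proof.
move=> iM; suff E l : (l <= m)%N -> desc i m.+1 * desc i.+1 l = desc i l * desc i m.+1 by exact: E.
elim: l => [|l IH] lm; first by rewrite !desc0 mulg1 mul1g.
rewrite (desc_recl i.+1) (desc_recl i l) mulgA addSn desc_shift; try lia.
by rewrite -!mulgA IH //; lia.
Qed.

End Ribbon.

Lemma prod_ascV n i m : \prod_(j < m) sigma_sgn n false (i + j) = (desc (sigma n) i m)^-1.
Proof.
elim: m => [|m IH]; first by rewrite big_ord0 desc0 invg1.
by rewrite big_ord_recr /= IH desc_recl invMg.
Qed.

Lemma prod_descV n i m :
  \prod_(j < m) sigma_sgn n false (i + rev_ord j) = (asc (sigma n) i m)^-1.
Proof.
elim: m i => [|m IH] i; first by rewrite big_ord0 asc0 invg1.
by rewrite big_ord_recl asc_recr invMg -IH /= subn1.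
Qed.

Definition swapn (i k : nat) : nat :=
  if k == i then i.+1 else if k == i.+1 then i else k.

Lemma swapnK i : involutive (swapn i).
Proof. move=> k; rewrite /swapn; do ![case: eqP]; lia. Qed.

Lemma swapn_lt n (i : 'I_n.-1) k : (k < n)%N -> (swapn i k < n)%N.
Proof. by move=> kn; rewrite /swapn; have := ltn_ord i; do ![case: eqP]; lia. Qed.

Section Strands.
Variable n : nat.
Implicit Types (u v w : braid_word n) (k : nat).

Fixpoint strand_bot w k : nat :=
  if w is x :: w' then strand_bot w' (swapn x.1 k) else k.

Lemma strand_top_cons x w k :
  strand_top (x :: w) k = swapn x.1 (strand_top w k).
Proof.
rewrite /= /swapn -/(strand_top w k).
by case: eqP => [->|] //; case: eqP => [->|].
Qed.

Lemma strand_top_cat u v k : strand_top (u ++ v) k = strand_top u (strand_top v k).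
Proof. by rewrite /strand_top foldr_cat. Qed.

Lemma strand_topK w : cancel (strand_top w) (strand_bot w).
Proof. by elim: w => // x w IH k; rewrite strand_top_cons /= swapnK. Qed.

Lemma strand_botK w : cancel (strand_bot w) (strand_top w).
Proof. by elim: w => // x w IH k; rewrite strand_top_cons /= IH swapnK. Qed.

Lemma strand_top_lt w k : (k < n)%N -> (strand_top w k < n)%N.
Proof. by elim: w => // x w IH kn; rewrite strand_top_cons swapn_lt // IH. Qed.

Lemma strand_top_rel (x y : braid_word n) k : braid_rel x y -> strand_top x k = strand_top y k.
Proof.
case=> [i s|i j ij|i j ij]; rewrite !strand_top_cons //= ?swapnK //.
  by rewrite /swapn; do ![case: eqP]; lia.
by rewrite ij /swapn; do ![case: eqP]; lia.
Qed.

Lemma strand_top_eqv u v : braid_eqv u v -> strand_top u = strand_top v.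
Proof.
apply: braid_eqv_ind => a b x y xy; apply/funext => k.
by rewrite !strand_top_cat (strand_top_rel _ xy).
Qed.

Lemma strand_bot_eqv u v : braid_eqv u v -> strand_bot u = strand_bot v.
Proof.
move=> /strand_top_eqv uv; apply/funext => k.
by rewrite -{1}(strand_botK v k) -uv strand_topK.
Qed.

Let tp (i : 'I_n.-1) : 'S_n :=
  tperm (Ordinal (strand_lo_subproof i)) (Ordinal (strand_hi_subproof i)).

Lemma tpE i (k : 'I_n) : tp i k = swapn i k :> nat.
Proof.
rewrite /tp permE /= /swapn -!val_eqE /=; case: eqP => //= _.
by case: eqP.
Qed.

Lemma perm_far (i j : 'I_n.-1) : (i.+1 < j)%N -> tp i * tp j = tp j * tp i.
Proof.
move=> ij; apply/permP => k; apply: val_inj; rewrite /= !permM !tpE /swapn.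
by do ![case: eqP]; lia.
Qed.

Lemma perm_next (i j : 'I_n.-1) : j = i.+1 :> nat ->
  tp i * tp j * tp i = tp j * tp i * tp j.
Proof.
move=> ij; apply/permP => k; apply: val_inj; rewrite /= !permM !tpE ij /swapn.
by do ![case: eqP]; lia.
Qed.

Lemma braid_permM : {morph @braid_perm n : x y / x * y}.
Proof. apply: braid_homM; [exact: perm_far|exact: perm_next]. Qed.

Lemma braid_perm_pi w (j : 'I_n) : braid_perm (braid_pi w) j = strand_bot w j :> nat.
Proof.
rewrite /braid_perm braid_hom_pi; [|exact: perm_far|exact: perm_next].
elim: w j => [|[i s] w IH] j; first by rewrite /word_val big_nil perm1.
rewrite /word_val big_cons permM /= IH; congr (strand_bot w _).
by case: s; rewrite /= ?tpermV tpE.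
Qed.

Definition botb (b : braid n) := strand_bot (repr b).
Definition topb (b : braid n) := strand_top (repr b).

Lemma botb_pi w : botb (braid_pi w) = strand_bot w.
Proof. exact/strand_bot_eqv/braid_reprK. Qed.

Lemma topb_pi w : topb (braid_pi w) = strand_top w.
Proof. exact/strand_top_eqv/braid_reprK. Qed.

Lemma topbM x y k : topb (x * y) k = topb x (topb y k).
Proof.
elim/braid_piS: x => u; elim/braid_piS: y => v.
by rewrite -braid_piM !topb_pi strand_top_cat.
Qed.

Lemma topb_lt b k : (k < n)%N -> (topb b k < n)%N.
Proof. exact: strand_top_lt. Qed.

Lemma braid_permE b (j : 'I_n) : braid_perm b j = botb b j :> nat.
Proof. by elim/braid_piS: b => w; rewrite braid_perm_pi botb_pi. Qed.

Lemma braid_perm_topb b (j : 'I_n) k : braid_perm b j = k :> nat -> topb b k = j.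
Proof. by rewrite braid_permE => <-; rewrite /topb /botb strand_botK. Qed.

Lemma pro_permP (b : pro (braid n)) : pro_near b (fun g => braid_perm g = pro_perm b).
Proof.
rewrite /pro_perm; case: xgetP => [s _ [N HN]|nex]; first by exists N.
have [|s [N HN]] := @loc_const_near _ _ (@braid_perm n) b; last by case: (nex s); exists N.
have uc := ucont_hom braid_permM.
have [|||N HN] := @fin_normal_kernel _ _ (@braid_perm n).
- exact: finite_finset.
- by move=> x y g xy; rewrite !braid_permM xy.
- by move=> x y g xy; rewrite !braid_permM xy.
by exists N => g h /HN.
Qed.

Lemma pro_perm_in (g : braid n) : pro_perm (pro_in g) = braid_perm g.
Proof. by have := pro_near_in (pro_permP (pro_in g)). Qed.

Lemma pro_perm_mul (x y : pro (braid n)) : pro_perm (pro_mul x y) = pro_perm x * pro_perm y.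
Proof.
have Exy := pro_near_mul (pro_permP (pro_mul x y)).
have /pro_near_ex [g [Hg <-]] := pro_nearI Exy (pro_permP x).
have /pro_near_ex [h [<- <-]] := pro_nearI Hg (pro_permP y).
exact: braid_permM.
Qed.

End Strands.

Lemma finite_functions (I : finType) (T : choiceType) (A : set T) :
  finite_set A -> finite_set [set f : I -> T | forall i, A (f i)].
Proof.
move=> /finite_fsetP [S ->].
apply: (@sub_finite_set _ _ ((fun F : {ffun I -> S} => fun i => val (F i)) @` setT)).
  move=> f /= fS; exists [ffun i => [` fS i]%fset] => //.
  by apply/funext => i; rewrite ffunE.
by apply: finite_image; exact: finite_finset.
Qed.

(** * Cabling one strand of a braid *)

Section Cable.
Variables (n n' m : nat).
Hypothesis n'E : n' = (n.-1 + m)%N.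
Implicit Types (u v w : braid_word n) (k : nat).

Local Notation A := (asc (sigma n')).
Local Notation D := (desc (sigma n')).

Lemma cable_letter_lo s i k : (i.+1 < k)%N -> cable_letter n' m s i k = sigma_sgn n' s i.
Proof. by rewrite /cable_letter => ->. Qed.

Lemma cable_letter_hi s i k : (k < i)%N ->
  cable_letter n' m s i k = sigma_sgn n' s (i.-1 + m).
Proof. by clear n'E; rewrite /cable_letter => ki; rewrite ki ifF //; lia. Qed.

Lemma cable_letter_eq s i :
  cable_letter n' m s i i = if s then A i m else (D i m)^-1.
Proof. by rewrite /cable_letter ltnNge leqnSn ltnn eqxx; case: s; rewrite ?prod_ascV. Qed.

Lemma cable_letter_eqS s i :
  cable_letter n' m s i i.+1 = if s then D i m else (A i m)^-1.
Proof.
clear n'E; rewrite /cable_letter ltnn ltnNge leqnSn /= ifF; last by apply/eqP; lia.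
by case: s; rewrite ?prod_descV.
Qed.

Lemma cable_letterV s i k :
  cable_letter n' m s i (swapn i k) * cable_letter n' m (~~ s) i k = 1.
Proof.
have sgV j : sigma_sgn n' s j * sigma_sgn n' (~~ s) j = 1.
  by case: s; rewrite /= ?mulgV ?mulVg.
rewrite /swapn; case: eqP => [->|/eqP ki].
  by rewrite cable_letter_eq cable_letter_eqS; case: s {sgV}; rewrite /= ?mulgV ?mulVg.
case: eqP => [->|/eqP kSi].
  by rewrite cable_letter_eq cable_letter_eqS; case: s {sgV}; rewrite /= ?mulgV ?mulVg.
have [?|?|] := ltngtP k i; last by lia.
  by rewrite !cable_letter_hi.
by rewrite !cable_letter_lo //; lia.
Qed.

Let s_comm' := s_comm (@sigma_far n').

Lemma cable_letter_far i j k : (i.+1 < j)%N -> (j < n.-1)%N -> (k < n)%N ->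
  cable_letter n' m true i (swapn j k) * cable_letter n' m true j k =
  cable_letter n' m true j (swapn i k) * cable_letter n' m true i k.
Proof.
move=> ij jn kn.
have [kj|kj|->] := ltngtP k j.
- have -> : swapn j k = k by rewrite /swapn; do ![case: eqP]; lia.
  have [ki|ki|->] := ltngtP k i.
  + have -> : swapn i k = k by rewrite /swapn; do ![case: eqP]; lia.
    by rewrite !cable_letter_hi //= s_comm' //; lia.
  + case: (ltngtP k i.+1) => [||->]; [lia| |] => [iSk|].
      have -> : swapn i k = k by rewrite /swapn; do ![case: eqP]; lia.
      by rewrite !(@cable_letter_lo _ i) // !(@cable_letter_hi _ j) //= s_comm' //; lia.
    have -> : swapn i i.+1 = i by rewrite /swapn; do ![case: eqP]; lia.
    rewrite !cable_letter_eqS !(@cable_letter_hi _ j); try lia.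
    by rewrite /= desc_comm // => l lm; apply: s_comm'; lia.
  + have -> : swapn i i = i.+1 by rewrite /swapn; do ![case: eqP]; lia.
    rewrite !cable_letter_eq !(@cable_letter_hi _ j); try lia.
    by rewrite /= asc_comm // => l lm; apply: s_comm'; lia.
- have -> : swapn i k = k by rewrite /swapn; do ![case: eqP]; lia.
  have sij : (i.+1 < swapn j k)%N by rewrite /swapn; do ![case: eqP]; lia.
  rewrite !(cable_letter_lo _ sij) !(@cable_letter_lo _ i k); last by lia.
  case: (ltngtP k j.+1) => [||->]; [lia| |] => [jSk|].
    by rewrite !cable_letter_lo //= s_comm' //; lia.
  by rewrite !cable_letter_eqS /= desc_comm // => l lm; apply: s_comm'; lia.
- have -> : swapn j j = j.+1 by rewrite /swapn eqxx.
  have -> : swapn i j = j by rewrite /swapn; do ![case: eqP]; lia.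
  rewrite !(@cable_letter_lo _ i) ?cable_letter_eq; try lia.
  by rewrite /= asc_comm // => l lm; apply: s_comm'; lia.
Qed.

(** If the cabled strand avoids the three strands of the relation, this is a plain braid relation,
    with shifted indices when it lies to their left. If it is the leftmost, middle or rightmost of
    the three, the identity is [asc_asc], [desc_asc] or [desc_desc]. *)
Lemma cable_letter_next i k : (i.+1 < n.-1)%N -> (k < n)%N ->
  cable_letter n' m true i (swapn i.+1 (swapn i k)) *
    (cable_letter n' m true i.+1 (swapn i k) * cable_letter n' m true i k) =
  cable_letter n' m true i.+1 (swapn i (swapn i.+1 k)) *
    (cable_letter n' m true i (swapn i.+1 k) * cable_letter n' m true i.+1 k).
Proof.
move=> iN kn.
have bnd : (i + m.+1 <= n'.-1)%N by lia.
have [ki|ki|->] := ltngtP k i.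
- have -> : swapn i k = k by rewrite /swapn; do ![case: eqP]; lia.
  have -> : swapn i.+1 k = k by rewrite /swapn; do ![case: eqP]; lia.
  have -> : swapn i k = k by rewrite /swapn; do ![case: eqP]; lia.
  rewrite !cable_letter_hi /=; try lia.
  have -> : (i + m = (i.-1 + m).+1)%N by lia.
  by rewrite !mulgA sigma_next //; lia.
- have [k2|k2|] := ltngtP k i.+2.
  + have -> : k = i.+1 by lia.
    have -> : swapn i i.+1 = i by rewrite /swapn; do ![case: eqP]; lia.
    have -> : swapn i.+1 i = i by rewrite /swapn; do ![case: eqP]; lia.
    have -> : swapn i.+1 i.+1 = i.+2 by rewrite /swapn; do ![case: eqP]; lia.
    have -> : swapn i i.+2 = i.+2 by rewrite /swapn; do ![case: eqP]; lia.
    rewrite (@cable_letter_hi _ i.+1 i) // !cable_letter_eq !cable_letter_eqS /=.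
    rewrite (@cable_letter_lo _ i i.+2) //= mulgA -asc_recr -(desc_asc (@sigma_far n') (@sigma_next n') bnd).
    by rewrite asc_recl.
  + have -> : swapn i k = k by rewrite /swapn; do ![case: eqP]; lia.
    have -> : swapn i.+1 k = k by rewrite /swapn; do ![case: eqP]; lia.
    have -> : swapn i k = k by rewrite /swapn; do ![case: eqP]; lia.
    rewrite !cable_letter_lo //=; try lia.
    by rewrite !mulgA sigma_next //; lia.
  + move=> ->.
    have -> : swapn i i.+2 = i.+2 by rewrite /swapn; do ![case: eqP]; lia.
    have -> : swapn i.+1 i.+2 = i.+1 by rewrite /swapn; do ![case: eqP]; lia.
    have -> : swapn i i.+1 = i by rewrite /swapn; do ![case: eqP]; lia.
    rewrite !cable_letter_eqS (@cable_letter_lo _ i i.+2) // (@cable_letter_hi _ i.+1 i) //=.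
    by rewrite -desc_recr mulgA -desc_recl (desc_desc (@sigma_far n') (@sigma_next n') bnd).
- have -> : swapn i i = i.+1 by rewrite /swapn; do ![case: eqP]; lia.
  have -> : swapn i.+1 i.+1 = i.+2 by rewrite /swapn; do ![case: eqP]; lia.
  have -> : swapn i.+1 i = i by rewrite /swapn; do ![case: eqP]; lia.
  have -> : swapn i i = i.+1 by rewrite /swapn; do ![case: eqP]; lia.
  rewrite (@cable_letter_lo _ i i.+2) // (@cable_letter_hi _ i.+1 i) // !cable_letter_eq /=.
  by rewrite -asc_recr mulgA -asc_recl (asc_asc (@sigma_far n') (@sigma_next n') bnd).
Qed.

Lemma cable_word_cat u v k : cable_word n' m (u ++ v) k =
  cable_word n' m u (strand_top v k) * cable_word n' m v k.
Proof.
elim: u => [|x u IH] /=; first by rewrite mul1g.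
by rewrite IH strand_top_cat mulgA.
Qed.

Lemma cable_word_rel (x y : braid_word n) k : (k < n)%N -> braid_rel x y ->
  cable_word n' m x k = cable_word n' m y k.
Proof.
move=> kn; case=> [i s|i j ij|i j ij]; rewrite /cable_word !strand_top_cons /= !mulg1.
- exact: cable_letterV.
- exact: cable_letter_far.
- by rewrite ij; apply: cable_letter_next => //; rewrite -ij.
Qed.

Lemma cable_word_eqv u v k : (k < n)%N ->
  braid_eqv u v -> cable_word n' m u k = cable_word n' m v k.
Proof.
move=> kn; move: u v; apply: braid_eqv_ind => a b x y xy.
rewrite !cable_word_cat !strand_top_cat (strand_top_rel _ xy) (cable_word_rel _ xy) //.
exact: strand_top_lt.
Qed.

Definition cableb (b : braid n) k : braid n' := cable_word n' m (repr b) k.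

Lemma cableb_pi w k : (k < n)%N -> cableb (braid_pi w) k = cable_word n' m w k.
Proof. by move=> kn; apply/cable_word_eqv/braid_reprK. Qed.

Lemma cablebM x y k : (k < n)%N ->
  cableb (x * y) k = cableb x (topb y k) * cableb y k.
Proof.
elim/braid_piS: x => u; elim/braid_piS: y => v kn.
by rewrite -braid_piM !cableb_pi ?topb_lt // cable_word_cat topb_pi.
Qed.

(** By [cablebM] a product is cabled along a position that its lower factor has moved, so the coset
    of one cabling is not compatible with translations. Recording positions and cosets for all
    strands together gives a function of finite range that is compatible, and its kernel serves for
    every [k]. *)
Lemma ucont_cableb k : (k < n)%N -> ucont (cableb^~ k).
Proof.
move=> kn N.
pose phi (g : braid n) (k : 'I_n) := (topb g k, gcoset (sval N) (cableb g k)).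
have [|||M HM] := @fin_normal_kernel _ _ phi.
- apply: (@sub_finite_set _ _ [set f : 'I_n -> nat * set (braid n') |
    forall i, (`I_n `*` range (gcoset (sval N))) (f i)]).
    by move=> _ [g _ <-] i; split; [exact: topb_lt|exists (cableb g i)].
  by apply: finite_functions; apply: finite_setX; [exact: finite_II|exact: fin_gcoset].
- move=> x y g xy; apply/funext => i; have := congr1 (@^~ i) xy.
  rewrite /phi => -[txy /gcosetP cxy]; rewrite !topbM !cablebM // txy; congr pair.
  by apply/gcosetP; exact: gcoset_mull.
- move=> x y g xy; apply/funext => i.
  have := congr1 (@^~ (Ordinal (topb_lt g (ltn_ord i)))) xy.
  rewrite /phi => -[txy /gcosetP cxy]; rewrite !topbM !cablebM // txy; congr pair.
  by apply/gcosetP; exact: gcoset_mulr.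
by exists M => g h /HM /(congr1 (@^~ (Ordinal kn))) [_].
Qed.

End Cable.

Section CableMap.
Variables p m q : nat.

Lemma cableE b : @cable p m q b = cableb (p + (m + q)) m b p.
Proof. by []. Qed.

Lemma ucont_cable : ucont (@cable p m q).
Proof. by apply: ucont_cableb; lia. Qed.

End CableMap.

Lemma cable_word1 n (w : braid_word n) k : cable_word n 1 w k = braid_pi w.
Proof.
elim: w => // -[i s] w IH; rewrite -cat1s braid_piM -IH /=; congr (_ * _).
rewrite -sigma_sgn_ord /cable_letter; case: ifP => // _.
case: ifP => [ki|_]; first by congr sigma_sgn; lia.
by case: ifP => _; rewrite big_ord1 addn0.
Qed.

Lemma cable1 p q (b : braid (p + (1 + q))) : cable 1 b = b.
Proof. by rewrite /cable cable_word1 /braid_pi reprK. Qed.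

Lemma pro_ext_cable1 p q (b : pro (braid (p + (1 + q)))) : pro_ext (@cable p 1 q) b = b.
Proof. by rewrite -[RHS]pro_ext_id; apply: pro_near_ext2 => g; exact: cable1. Qed.

(** * Colourings *)

Lemma expgzS (G : groupType) (x : G) (z : int) :
  expgz x (z + 1)%R = expgz x z * x.
Proof.
case: z => k; first by rewrite /expgz -PoszD addn1 expgSr.
rewrite NegzE; case: k => [|k].
  by rewrite addNr /expgz /= expg1 mulVg expg0.
have -> : (- k.+2%:Z + 1)%R = Negz k by rewrite NegzE; lia.
by rewrite -NegzE /expgz /= [x ^+ k.+2]expgS invMg -mulgA mulVg mulg1.
Qed.

Lemma expgzM (G : groupType) (x : G) : {morph expgz x : a b / a * b}.
Proof.
move=> a b; suff: forall k : int, expgz x ((a : int) + k)%R = expgz x a * expgz x k by exact.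
move: (a : int) => {}a {b}.
have S z : expgz x (z - 1)%R = expgz x z * x^-1.
  by rewrite -[z in RHS](addrNK (1%R : int)) expgzS -mulgA mulgV mulg1.
elim/int_ind => [|k IH|k IH].
- by rewrite addr0 [expgz x 0]/(1 : G) mulg1.
- by rewrite -addn1 PoszD addrA !expgzS IH mulgA.
- by rewrite -addn1 PoszD opprD addrA !S IH mulgA.
Qed.

Lemma ucont_expgz (G : groupType) (x : G) : ucont (expgz x).
Proof. exact/ucont_hom/expgzM. Qed.

(** Unlike [is_tangle], this accepts the empty sequence, as an identity of any word, so that it is
    compatible with concatenation and splitting. *)
Fixpoint typed (w : seq bool) (T : fseq) (w' : seq bool) : bool :=
  if T is g :: T' then (fsource g == w) && typed (ftarget g) T' w' else w == w'.

Section Colours.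
Variable R : finComNzRingType.
Local Open Scope ring_scope.
Implicit Types (c d u v z : nat -> R) (f : (nat -> R) -> nat).

Definition cshift p c : nat -> R := fun j => c (p + j)%N.
Definition cjoin p c d : nat -> R := fun j => if (j < p)%N then c j else d (j - p)%N.
Definition refl (y : R) c : nat -> R := fun j => y - c j.

Lemma cshift_join p c d : cshift p (cjoin p c d) = d.
Proof. by apply/funext => j; rewrite /cshift /cjoin ltnNge leq_addr addKn. Qed.

Lemma cjoin_join p c d u : cjoin p (cjoin p c d) u = cjoin p c u.
Proof. by apply/funext => j; rewrite /cjoin; case: ltnP. Qed.

Lemma cjoin_shift p c : cjoin p c (cshift p c) = c.
Proof. by apply/funext => j; rewrite /cjoin /cshift; case: ltnP => // pj; rewrite subnKC. Qed.

(* A cable of m strands with colours c acts on a strand that crosses it through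
   alt m c, the alternating sum whose last term has sign +. *)
Fixpoint alt m c : R := if m is m'.+1 then c m' - alt m' c else 0.

Lemma alt_cat m r c : alt (m + r) c = alt r (cshift m c) + (-1) ^+ r * alt m c.
Proof.
elim: r => [|r IH]; first by rewrite addn0 /= expr0; ring.
by rewrite addnS /= IH /cshift exprS; ring.
Qed.

Lemma alt_eq m c d : (forall j, (j < m)%N -> c j = d j) -> alt m c = alt m d.
Proof.
elim: m => //= m IH cd; rewrite cd // IH // => j jm; apply: cd; exact: ltnW.
Qed.

(* The crossing of colours a and b replaces a by 2 b - a, as for the reflections
   of a dihedral group. *)
Definition lact (s : bool) (i : nat) c : nat -> R := fun j =>
  if j == i then (if s then c i.+1 else c i *+ 2 - c i.+1)
  else if j == i.+1 then (if s then c i.+1 *+ 2 - c i else c i) else c j.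

Lemma lactK s i : cancel (lact s i) (lact (~~ s) i).
Proof.
move=> c; apply/funext => j; rewrite /lact.
have E : (i.+1 == i) = false by lia.
case: eqP => [->|_]; last case: eqP => [->|//];
  by case: s => /=; rewrite ?eqxx ?E; ring.
Qed.

Section BraidAction.
Variable n : nat.
Implicit Types (w : braid_word n).

Definition wact w c : nat -> R := foldr (fun x : 'I_n.-1 * bool => lact x.2 x.1) c w.

Lemma wact_cat w w' c : wact (w ++ w') c = wact w (wact w' c).
Proof. by rewrite /wact foldr_cat. Qed.

Lemma wact_eqv w w' : braid_eqv w w' -> wact w = wact w'.
Proof.
apply: braid_eqv_ind => a b x y xy; apply/funext => c.
rewrite !wact_cat; congr wact; move: (wact b c) => {}c.
case: xy => [i s|i j ij|i j ij] /=.
- by rewrite -{1}[s]negbK lactK.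
- apply/funext => k; rewrite /lact /=.
  have E1 : (i == j :> nat) = false by lia.
  have E2 : (i == j.+1 :> nat) = false by lia.
  have E3 : (i.+1 == j :> nat) = false by lia.
  have E4 : (i.+1 == j.+1 :> nat) = false by lia.
  have E5 : (j == i :> nat) = false by lia.
  have E6 : (j == i.+1 :> nat) = false by lia.
  have E7 : (j.+1 == i :> nat) = false by lia.
  have E8 : (j.+1 == i.+1 :> nat) = false by lia.
  case: (eqVneq k i) => [kE|ki]; first by rewrite ?kE ?E1 ?E2 ?E3 ?E4.
  case: (eqVneq k i.+1) => [kE|ki']; first by rewrite ?kE ?E1 ?E2 ?E3 ?E4.
  case: (eqVneq k j) => [kE|kj]; first by rewrite ?kE ?E5 ?E6 ?E7 ?E8.
  by case: (eqVneq k j.+1) => [kE|kj']; rewrite ?kE ?E5 ?E6 ?E7 ?E8.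
- rewrite ij; apply/funext => k; rewrite /lact /= !eqxx.
  have -> : (i.+2 == i :> nat) = false by lia.
  have -> : (i.+2 == i.+1 :> nat) = false by lia.
  have -> : (i.+1 == i :> nat) = false by lia.
  have -> : (i == i.+1 :> nat) = false by lia.
  have -> : (i == i.+2 :> nat) = false by lia.
  by do ![case: eqP => //= ?]; try lia; try ring.
Qed.

Definition bact (b : braid n) := wact (repr b).

Lemma bact_pi w : bact (braid_pi w) = wact w.
Proof. exact/wact_eqv/braid_reprK. Qed.

Lemma bactM x y c : bact (x * y)%g c = bact x (bact y c).
Proof.
elim/braid_piS: x => w; elim/braid_piS: y => w'.
by rewrite -braid_piM !bact_pi wact_cat.
Qed.

Lemma bact1 c : bact 1%g c = c.
Proof. by rewrite -braid_pi_nil bact_pi. Qed.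

Lemma bactVK b c : bact b^-1%g (bact b c) = c.
Proof. by rewrite -bactM mulVg bact1. Qed.

Lemma bactV b c d : bact b d = c -> bact b^-1%g c = d.
Proof. by move=> <-; exact: bactVK. Qed.

Lemma bact_sigma i c : (i < n.-1)%N -> bact (sigma n i) c = lact true i c.
Proof. by move=> ni; rewrite (sigmaE ni) bact_pi. Qed.

Lemma bact_sigma_sgn s i c : (i < n.-1)%N -> bact (sigma_sgn n s i) c = lact s i c.
Proof.
move=> ni; rewrite -[i in sigma_sgn _ _ i]/(val (Ordinal ni)) sigma_sgn_ord.
by rewrite bact_pi.
Qed.

Lemma wact_hi w c j : (n <= j)%N -> wact w c j = c j.
Proof.
move=> nj; elim: w => //= [[i s] w IH]; rewrite /lact -IH.
by have := ltn_ord i; do ![case: eqP => //= ?]; lia.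
Qed.

Lemma wact_join w c d : wact w (cjoin n c d) = cjoin n (wact w c) d.
Proof.
elim: w => //= [[i s] w IH]; rewrite IH; apply/funext => j; rewrite /lact /cjoin /=.
have iN : (i < n)%N by have := ltn_ord i; lia.
have iN' : (i.+1 < n)%N by have := ltn_ord i; lia.
rewrite iN iN'; case: eqP => [->|_]; first by rewrite iN.
by case: eqP => [->|_]; first by rewrite iN'.
Qed.

(** Reflections are automorphisms of the colouring rule [2 b - a]. *)
Lemma wact_refl w y c : wact w (refl y c) = refl y (wact w c).
Proof.
elim: w => //= [[i s] w IH]; rewrite IH; apply/funext => j; rewrite /lact /refl /=.
by do ![case: eqP => // ?]; case: s; ring.
Qed.

(** A crossing preserves the difference of its two colours. In dihedral terms, the ordered product
    of the reflections in all colours is invariant under braiding. *)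
Lemma wact_alt w c : alt n (wact w c) = alt n c.
Proof.
elim: w => //= [[i s] w <-] /=; move: (wact w c) => {}c.
have := ltn_ord i; move: (nat_of_ord i) => {}i ni.
have -> : n = (i + (2 + (n - i - 2)))%N by lia.
rewrite !alt_cat; congr (_ + _).
  congr (_ + _).
    by apply: alt_eq => j _; rewrite /cshift /lact; do ![case: eqP => // ?]; lia.
  congr (_ * _); rewrite /= /cshift /lact addn0 addn1 !eqxx.
  have -> : (i.+1 == i :> nat) = false by lia.
  by case: s; ring.
by congr (_ * _); apply: alt_eq => j ji; rewrite /lact; do ![case: eqP => // ?]; lia.
Qed.

(** Strands beyond [n] keep their colours, so the action is determined by a self-map of the finite
    set of [n]-tuples. *)
Lemma bact_finite : finite_set (range bact).
Proof.
pose psi (F : {ffun n.-tuple R -> n.-tuple R}) : (nat -> R) -> nat -> R :=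
  fun c j => if (j < n)%N then nth 0 (F [tuple c i | i < n]) j else c j.
apply: (@sub_finite_set _ _ (psi @` setT)); last by apply: finite_image; exact: finite_finset.
move=> _ [b _ <-].
exists [ffun t : n.-tuple R => [tuple bact b (fun j => nth 0 t j) i | i < n]] => //.
have tE (F : nat -> R) k : nth 0 [tuple F i | i < n] k = if (k < n)%N then F k else 0.
  case: ltnP => nk; first by rewrite -[k in LHS]/(val (Ordinal nk)) nth_mktuple.
  by rewrite nth_default // size_tuple.
apply/funext => c; apply/funext => j; rewrite /psi.
case: ltnP => nj; last by rewrite /bact wact_hi.
rewrite ffunE tE nj; set c' := fun k => _.
have -> : c = cjoin n c' (cshift n c).
  apply/funext => k; rewrite /cjoin /cshift /c' tE.
  by case: ltnP => nk //; rewrite subnKC.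
rewrite /bact [in RHS]wact_join /cjoin nj; congr (wact _ _ _).
Qed.

Fact pact_subproof (b : pro (braid n)) :
  exists F, pro_near b (fun g => bact g = F).
Proof.
apply: loc_const_near; have [|||N HN] := @fin_normal_kernel _ _ bact.
- exact: bact_finite.
- by move=> x y g xy; apply/funext => c; rewrite !bactM xy.
- by move=> x y g xy; apply/funext => c; rewrite !bactM xy.
by exists N => g h /HN.
Qed.

Definition pact (b : pro (braid n)) : (nat -> R) -> nat -> R :=
  sval (cid (pact_subproof b)).

Lemma pactP b : pro_near b (fun g => bact g = pact b).
Proof. by rewrite /pact; case: cid. Qed.

Lemma pact_uniq b F : pro_near b (fun g => bact g = F) -> pact b = F.
Proof. exact/pro_near_uniq/pactP. Qed.

Lemma pact_ex b : exists w, pact b = wact w.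
Proof. by have /pro_near_ex [g <-] := pactP b; exists (repr g). Qed.

Lemma pact_in g : pact (pro_in g) = bact g.
Proof. by rewrite (pro_near_in (pactP (pro_in g))). Qed.

Lemma pactM x y c : pact (pro_mul x y) c = pact x (pact y c).
Proof.
have Exy := pro_near_mul (pactP (pro_mul x y)).
have /pro_near_ex [g [Hg <-]] := pro_nearI Exy (pactP x).
have /pro_near_ex [h [<- <-]] := pro_nearI Hg (pactP y).
exact: bactM.
Qed.

End BraidAction.
End Colours.

Ltac split_ifs := repeat match goal with
  | |- context [if (?a < ?b)%N then _ else _] =>
      case: (ltnP a b) => ?; try (exfalso; lia)
  | |- context [if (?a <= ?b)%N then _ else _] =>
      case: (leqP a b) => ?; try (exfalso; lia)
  | |- context [if (?a == ?b) then _ else _] =>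
      case: (eqVneq a b) => ?; try (exfalso; lia)
  end.
Ltac index_eq := match goal with
  | |- @eq nat _ _ => lia
  | |- _ => first [by [] | progress f_equal; index_eq]
  end.
Ltac pointwise := split_ifs; try index_eq.

Section Operators.
Variable R : finComNzRingType.
Local Open Scope ring_scope.
Implicit Types (c d u v z : nat -> R) (f : (nat -> R) -> nat).

(** A tangle pulls a weight on the colourings of its top back to a weight on the colourings of its
    bottom. Colourings are infinite sequences of which a tangle rewrites an initial part, up to a
    shift of the rest, so no width appears in the types. *)
Definition oper : Type := ((nat -> R) -> nat) -> (nat -> R) -> nat.
Implicit Types H : oper.

Definition oat (p : nat) H : oper :=
  fun f c => H (fun u => f (cjoin p c u)) (cshift p c).

(* An operator with s colours at the bottom and t at the top; a strand passing
   across it only sees the doubled alternating sums, which osupp 2 says to agree. *)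
Definition osupp (a : R) H s t : Prop := forall f f' v,
  (forall u, cshift t u = cshift s v -> a * alt t u = a * alt s v -> f u = f' u) ->
  H f v = H f' v.
Definition olocal H s t : Prop := forall f v z,
  H (fun u => f (cjoin t u z)) v = H f (cjoin s v z).
Definition orefl (y : R) H : Prop := forall f v,
  H (fun u => f (refl y u)) v = H f (refl y v).

(** What suffices to move an operator across any crossing; this is weaker than what tangles satisfy.
    The factors 2 let it hold over F_2 for the artificial operator of [sliding_insert]. *)
Record sliding H s t : Prop := Sliding {
  sl_supp : osupp 2%:R H s t;
  sl_local : olocal H s t;
  sl_refl : forall y, orefl (y *+ 2) H;
  sl_sign : (-1) ^+ s = (-1) ^+ t :> R }.

Lemma oat0 H : oat 0 H = H.
Proof.
apply/funext => f; apply/funext => c; rewrite /oat; congr (H _ _).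
by apply/funext => u; congr f; apply/funext => j; rewrite /cjoin subn0.
Qed.

(** The case where the cable keeps its colours: [Phi u] is the colouring above the crossing once the
    operator has produced [u] below it. *)
Lemma transport_id H s t f v (Phi : (nat -> R) -> nat -> R) k d :
  sliding H s t -> cshift k d = cjoin s v (cshift (k + s) d) ->
  (forall u, cshift t u = cshift s v -> 2%:R * alt t u = 2%:R * alt s v ->
    Phi u = cjoin k d (cjoin t u (cshift (k + s) d))) ->
  H (fun u => f (Phi u)) v = H (fun u => f (cjoin k d u)) (cshift k d).
Proof.
move=> sH -> HP; rewrite -(sl_local sH); apply: (sl_supp sH) => u tu au.
by rewrite HP.
Qed.

(** The case where each colour [c] of the cable becomes [2 y - c], [y] being the colour of the
    strand that it crosses; the operator commutes with this reflection. *)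
Lemma transport_refl H s t f v (Phi : (nat -> R) -> nat -> R) k d y :
  sliding H s t -> cshift k d = cjoin s (refl (y *+ 2) v) (cshift (k + s) d) ->
  (forall u, cshift t u = cshift s v -> 2%:R * alt t u = 2%:R * alt s v ->
    Phi u = cjoin k d (cjoin t (refl (y *+ 2) u) (cshift (k + s) d))) ->
  H (fun u => f (Phi u)) v = H (fun u => f (cjoin k d u)) (cshift k d).
Proof.
move=> sH -> HP; rewrite -(sl_local sH) -(sl_refl sH).
by apply: (sl_supp sH) => u tu au; rewrite HP.
Qed.

Section Letters.
Variables (n' : nat).

Lemma asc_act i m c : (i + m <= n'.-1)%N ->
  bact (asc (sigma n') i m) c = fun j =>
    if (j < i)%N then c j else if j == i then c (i + m)%N
    else if (j <= i + m)%N then c (i + m)%N *+ 2 - c j.-1 else c j.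
Proof.
elim: m i => [|m IH] i im.
  rewrite asc0 bact1 addn0; apply/funext => j.
  by case: ltnP => // ij; case: eqP => [->//|?]; rewrite ifF //; lia.
rewrite asc_recl bactM IH; last lia.
rewrite bact_sigma; last lia.
apply/funext => j; rewrite /lact !addSn addnS eqxx ltnSn ltnn.
case: (ltngtP j i) => [ji|ij|ji].
- by rewrite ifF ?ifT //; lia.
- case: eqP => [->|ji]; first by rewrite ifT //; lia.
  by rewrite ifF //; lia.
- by [].
Qed.

(** Reflecting one colour successively in [m] others gives an affine map, with the sign of [m]
    reflections and with twice the alternating sum as constant term. This is all that a strand sees
    of a cable crossing it. *)
Lemma desc_act i m c : (i + m <= n'.-1)%N ->
  bact (desc (sigma n') i m) c = fun j =>
    if (j < i)%N then c j else if (j < i + m)%N then c j.+1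
    else if j == (i + m)%N then (-1) ^+ m * c i + alt m (cshift i.+1 c) *+ 2
    else c j.
Proof.
elim: m => [|m IH] im.
  rewrite desc0 bact1 addn0; apply/funext => j.
  case: ltngtP => // ->; rewrite /= expr0; ring.
rewrite desc_recl bactM IH; last lia.
rewrite bact_sigma; last lia.
apply/funext => j; rewrite /lact !addnS.
have -> : ((i + m).+1 < i)%N = false by lia.
have -> : ((i + m).+1 < i + m)%N = false by lia.
have -> : ((i + m).+1 == (i + m)%N :> nat) = false by lia.
have -> : ((i + m)%N < i)%N = false by lia.
rewrite ltnn eqxx; case: eqP => [->|jm].
  have -> : (i + m < i)%N = false by lia.
  by rewrite ltnSn.
case: eqP => [->|jm'].
  rewrite ifF; last lia.
  rewrite ifF; last lia.
  by rewrite /= /cshift addSn exprS; ring.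
case: ltnP => // ij; have -> : (j < (i + m).+1)%N = (j < i + m)%N by lia.
by case: ltnP => //; rewrite ifF //; lia.
Qed.

Lemma ascV_act i m c : (i + m <= n'.-1)%N ->
  bact (asc (sigma n') i m)^-1%g c = fun j =>
    if (j < i)%N then c j else if (j < i + m)%N then c i *+ 2 - c j.+1
    else if j == (i + m)%N then c i else c j.
Proof.
move=> im; apply: bactV; rewrite asc_act //; apply/funext => j.
have -> : (i + m < i)%N = false by lia.
rewrite ltnn eqxx; case: (ltngtP j i) => [//|ij|ji]; last by rewrite ?ji.
case: (leqP j (i + m)) => jm; last by rewrite !ifF //; lia.
rewrite ifF; last lia.
rewrite ifT; last lia.
by rewrite prednK; [ring|lia].
Qed.

Lemma descV_act i m c : (i + m <= n'.-1)%N ->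
  bact (desc (sigma n') i m)^-1%g c = fun j =>
    if (j < i)%N then c j
    else if j == i then (-1) ^+ m * (c (i + m)%N - alt m (cshift i c) *+ 2)
    else if (j <= i + m)%N then c j.-1 else c j.
Proof.
move=> im; apply: bactV; rewrite desc_act //; apply/funext => j.
rewrite ltnn eqxx; case: (ltnP j i) => // ij; case: (ltnP j (i + m)) => jm.
  have -> : (j.+1 < i)%N = false by lia.
  by have -> : (j.+1 == i :> nat) = false by lia.
case: (eqVneq j (i + m)%N) => [jE|jm']; last first.
  have -> : (j == i :> nat) = false by lia.
  by rewrite ifF //; lia.
rewrite jE.
have -> : alt m (cshift i.+1 (fun j => if (j < i)%N then c j
    else if j == i then (-1) ^+ m * (c (i + m)%N - alt m (cshift i c) *+ 2)
    else if (j <= i + m)%N then c j.-1 else c j)) = alt m (cshift i c).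
  apply: alt_eq => l lm; rewrite /cshift.
  have -> : (i.+1 + l < i)%N = false by lia.
  have -> : (i.+1 + l == i :> nat)%N = false by lia.
  by have -> : (i.+1 + l <= i + m)%N by lia.
by rewrite mulrA -expr2 sqrr_sign; ring.
Qed.

End Letters.

(** Either the cable avoids the crossing, or it is crossed by a single strand. In the second case,
    depending on the sign and the side, the whole cable is reflected in the colour of that strand,
    or that strand is changed through the alternating sum and the parity of the cable. The operator
    respects all of these. *)
Lemma cable_letter_slide H s t n i k sg f c :
  sliding H s t -> (i < n.-1)%N -> (k < n)%N ->
  oat k H (fun c' => f (bact (cable_letter (n.-1 + t) t sg i k) c')) c =
  oat (swapn i k) H f (bact (cable_letter (n.-1 + s) s sg i k) c).
Proof.
move=> sH iN kn; rewrite /oat.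
have iM m : (i + m <= (n.-1 + m).-1)%N by lia.
have TS u v l : cshift t u = cshift s v -> u (t + l)%N = v (s + l)%N.
  by move=> /(congr1 (@^~ l)).
have Sg := sl_sign sH.
case: (ltngtP k i) => ki.
- have -> : swapn i k = k by rewrite /swapn; do ![case: eqP]; lia.
  have lo m c' : bact (cable_letter (n.-1 + m) m sg i k) c' = lact sg (i.-1 + m) c'.
    by rewrite cable_letter_hi // bact_sigma_sgn //; lia.
  rewrite lo; apply: (transport_id f sH).
    by apply/funext => j; rewrite /cshift /cjoin /lact; pointwise.
  move=> u /TS ut _; rewrite lo; apply/funext => j.
  rewrite /cjoin /cshift /lact; case: (ltnP j (k + t)) => jt; first by pointwise.
  have [l ->] : exists l, j = (k + (t + l))%N by exists (j - k - t)%N; lia.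
  have E l' : (k + (t + l') - k)%N = (t + l')%N by lia.
  have [l' E'] : exists l', (i.-1 + t)%N = (k + (t + l'))%N by exists (i.-1 - k)%N; lia.
  have S2 : (k + (t + l')).+2 = (k + (t + l'.+2))%N by lia.
  have S1 : (k + (t + l')).+1 = (k + (t + l'.+1))%N by lia.
  rewrite E' S2 S1 !E !ut /cshift.
  have -> : (i.-1 + s)%N = (k + (s + l'))%N by lia.
  by case: sg {lo} => /=; pointwise.
- case: (eqVneq k i.+1) => kE; last first.
    have -> : swapn i k = k by rewrite /swapn; do ![case: eqP]; lia.
    have lo m c' : bact (cable_letter (n.-1 + m) m sg i k) c' = lact sg i c'.
      by rewrite cable_letter_lo ?bact_sigma_sgn //; lia.
    rewrite lo; apply: (transport_id f sH).
      by apply/funext => j; rewrite /cshift /cjoin /lact; pointwise.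
    move=> u /TS ut _; rewrite lo; apply/funext => j.
    rewrite /cjoin /cshift /lact; case: (ltnP j (k + t)) => jt; first by pointwise.
    have [l ->] : exists l, j = (k + (t + l))%N by exists (j - k - t)%N; lia.
    have E l' : (k + (t + l') - k)%N = (t + l')%N by lia.
    by rewrite E ut /cshift; pointwise.
  subst k.
  have -> : swapn i i.+1 = i by rewrite /swapn; do ![case: eqP]; lia.
  rewrite !cable_letter_eqS; case: sg.
    rewrite desc_act //.
    apply: (transport_id f sH).
      by apply/funext => j; rewrite /cshift /cjoin; pointwise.
    move=> u /TS ut alts; rewrite desc_act //; apply/funext => j.
    case: (ltnP j (i + t)) => jt; first by rewrite /cjoin /cshift; pointwise.
    case: (eqVneq j (i + t)%N) => [->|jt'].
      rewrite cshift_join /cjoin /cshift; split_ifs.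
      (* The crossing strand leaves with the colour given by [desc_act]; its sign and its constant
         term are the same for the widths [s] and [t]. *)
      by rewrite Sg; congr (_ + _); rewrite -[LHS]mulr_natl -[RHS]mulr_natl; exact: alts.
    have [l ->] : exists l, j = (i.+1 + (t + l))%N by exists (j - i - t.+1)%N; lia.
    have E l' : (i.+1 + (t + l') - i.+1)%N = (t + l')%N by lia.
    by rewrite /cjoin /cshift E ut /cshift; pointwise.
  rewrite ascV_act //.
  apply: (@transport_refl _ _ _ f _ _ _ _ (c i) sH).
    by apply/funext => j; rewrite /cshift /cjoin /refl; pointwise.
  move=> u /TS ut alts; rewrite ascV_act //; apply/funext => j.
  case: (ltnP j (i + t)) => jt; first by rewrite /cjoin /cshift /refl; pointwise.
  case: (eqVneq j (i + t)%N) => [->|jt']; first by rewrite /cjoin /cshift /refl; pointwise.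
  have [l ->] : exists l, j = (i.+1 + (t + l))%N by exists (j - i - t.+1)%N; lia.
  have E l' : (i.+1 + (t + l') - i.+1)%N = (t + l')%N by lia.
  by rewrite /cjoin /cshift E ut /cshift; pointwise.
- subst k; have -> : swapn i i = i.+1 by rewrite /swapn; do ![case: eqP]; lia.
  rewrite !cable_letter_eq; case: sg.
    rewrite asc_act //.
    apply: (@transport_refl _ _ _ f _ _ _ _ (c (i + s)%N) sH).
      by apply/funext => j; rewrite /cshift /cjoin /refl; pointwise.
    move=> u /TS ut alts; rewrite asc_act //; apply/funext => j.
    have E l' : (i + (t + l') - i)%N = (t + l')%N by lia.
    have ut0 := ut 0%N; rewrite !addn0 in ut0.
    case: (leqP j (i + t)) => jt.
      rewrite /cjoin /cshift /refl; have -> : (i + t - i)%N = t by lia.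
      by rewrite ut0 /cshift; pointwise.
    have [l ->] : exists l, j = (i + (t + l.+1))%N by exists (j - i - t.+1)%N; lia.
    by rewrite /cjoin /cshift /refl E ut /cshift; pointwise.
  rewrite descV_act //.
  apply: (transport_id f sH).
    by apply/funext => j; rewrite /cshift /cjoin; pointwise.
  move=> u /TS ut alts; rewrite descV_act //; apply/funext => j.
  have E l' : (i + (t + l') - i)%N = (t + l')%N by lia.
  have ut0 := ut 0%N; rewrite !addn0 in ut0.
  case: (ltnP j i) => ji; first by rewrite /cjoin; pointwise.
  case: (eqVneq j i) => [->|ji'].
    rewrite cshift_join /cjoin /cshift; split_ifs.
    have -> : (i + t - i)%N = t by lia.
    rewrite ut0 Sg; congr (_ * (_ - _)).
    by rewrite -[LHS]mulr_natl -[RHS]mulr_natl; exact: alts.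
  case: (leqP j (i + t)) => jt; first by rewrite /cjoin /cshift; pointwise.
  have [l ->] : exists l, j = (i + (t + l.+1))%N by exists (j - i - t.+1)%N; lia.
  by rewrite /cjoin /cshift E ut /cshift; pointwise.
Qed.

Lemma cable_word_slide H s t n (w : braid_word n) k f c :
  sliding H s t -> (k < n)%N ->
  oat k H (fun c' => f (bact (cable_word (n.-1 + t) t w k) c')) c =
  oat (strand_top w k) H f (bact (cable_word (n.-1 + s) s w k) c).
Proof.
move=> sH kn; elim: w f => [|[i sg] w IH] f.
  rewrite /= bact1; congr (oat _ _ _); apply/funext => c'; by rewrite bact1.
rewrite strand_top_cons [cable_word (n.-1 + s) s _ _]/= bactM.
rewrite -(cable_letter_slide sg f _ sH) //; last exact: strand_top_lt.
rewrite -IH; congr (oat _ _ _); apply/funext => c'.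
by rewrite /= bactM.
Qed.

(** The form of the sliding conditions that tangles satisfy over every ring; caps and cups change
    the width by two, whence the parity condition. *)
Record good_oper H s t : Prop := GoodOper {
  go_supp : osupp 1 H s t;
  go_local : olocal H s t;
  go_refl : forall y, orefl y H;
  go_odd : odd s = odd t }.

Lemma good_sliding H s t : good_oper H s t -> sliding H s t.
Proof.
case=> Hs Hl Hr Ho; split=> //.
  by move=> f f' v ff'; apply: Hs => u su au; apply: ff' => //; move: au; rewrite !mul1r => ->.
by rewrite -signr_odd Ho signr_odd.
Qed.

Lemma good_comp H1 H2 s r t : good_oper H1 s r -> good_oper H2 r t ->
  good_oper (fun f => H1 (H2 f)) s t.
Proof.
move=> [s1 l1 r1 o1] [s2 l2 r2 o2]; split.
- move=> f f' v ff'; apply: s1 => u su au; apply: s2 => w sw aw.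
  by apply: ff'; rewrite ?sw ?aw.
- move=> f v z; rewrite -l1; congr (H1 _ _); apply/funext => u.
  by rewrite -l2.
- move=> y f v; rewrite -r1; congr (H1 _ _); apply/funext => u; exact: r2.
- by rewrite o1.
Qed.

Lemma good_id n : good_oper (fun f => f) n n.
Proof. by split=> // f f' v; apply. Qed.

Definition rm k c : nat -> R := fun j => if (j < k)%N then c j else c j.+2.
Definition ins k (a : R) c : nat -> R := fun j =>
  if (j < k)%N then c j else if (j < k.+2)%N then a else c j.-2.

Lemma rm_ins k a c : rm k (ins k a c) = c.
Proof. by apply/funext => j; rewrite /rm /ins; pointwise. Qed.

Lemma alt_rm k r c : c k = c k.+1 -> alt (k + (2 + r)) c = alt (k + r) (rm k c).
Proof.
move=> ck; rewrite !alt_cat.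
have -> : alt 2 (cshift k c) = 0 by rewrite /= /cshift addn0 addn1 ck; ring.
rewrite mulr0 addr0 exprD sqrrN expr1n mul1r; congr (_ + _ * _).
  apply: alt_eq => j _; rewrite /cshift /rm; pointwise.
by apply: alt_eq => j jk; rewrite /rm jk.
Qed.

Lemma alt_ins k r a c : alt (k + (2 + r)) (ins k a c) = alt (k + r) c.
Proof. by rewrite alt_rm ?rm_ins // /ins; pointwise. Qed.

(* The sum of f over the colourings of the top of g that extend the colouring c of
   its bottom. *)
Definition eop (g : fund) : oper := fun f c =>
  match g with
  | Cap u o v => ((c (size u) == c (size u).+1) * f (rm (size u) c))%N
  | Braid n b eps => f (pact b c)
  | Cup u o v => (\sum_(a : R) f (ins (size u) a c))%N
  end.

Definition eops (T : fseq) : oper := fun f => foldr eop f T.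

Lemma eops_cat S T f : eops (S ++ T) f = eops S (eops T f).
Proof. exact: foldr_cat. Qed.

(** Caps and cups remove or insert two equal adjacent colours, which cancel in the alternating sum,
    and braids preserve it by [wact_alt]. Reflecting all colours only reindexes the sum over the
    colour of a cup. *)
Lemma good_eop g : good_oper (eop g) (size (fsource g)) (size (ftarget g)).
Proof.
case: g => [u o v|n b eps|u o v] /=.
- rewrite !size_cat /=; split.
  + move=> f f' c ff' /=; case: eqP => // ck; rewrite !mul1n; apply: ff'.
      by apply/funext => j; rewrite /cshift /rm; pointwise.
    by rewrite alt_rm.
  + move=> f c z /=; have -> : cjoin (size u + (size v).+2) c z (size u) = c (size u).
      by rewrite /cjoin; pointwise.
    have -> : cjoin (size u + (size v).+2) c z (size u).+1 = c (size u).+1.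
      by rewrite /cjoin; pointwise.
    congr (_ * f _)%N; apply/funext => j; rewrite /cjoin /rm; pointwise.
  + move=> y f c /=; rewrite /refl (inj_eq (@subrI _ y)); congr (_ * f _)%N.
    by apply/funext => j; rewrite /rm; pointwise.
  + by rewrite !oddD /= negbK.
- rewrite size_tuple size_map size_enum_ord; have [w bw] := pact_ex R b; split=> //.
  + move=> f f' c /=; rewrite bw; apply; last by rewrite wact_alt.
    by apply/funext => j; rewrite /cshift wact_hi // leq_addr.
  + by move=> f c z /=; rewrite bw wact_join.
  + by move=> y f c /=; rewrite bw wact_refl.
- rewrite !size_cat /=; split.
  + move=> f f' c ff' /=; apply: eq_bigr => a _; apply: ff'.
      by apply/funext => j; rewrite /cshift /ins; pointwise.
    by rewrite alt_ins.
  + move=> f c z /=; apply: eq_bigr => a _; congr f.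
    apply/funext => j; rewrite /cjoin /ins; pointwise.
  + move=> y f c /=; rewrite [RHS](reindex_inj (@subrI _ y)) /=.
    apply: eq_bigr => a _; congr f.
    by apply/funext => j; rewrite /refl /ins; pointwise.
  + by rewrite !oddD /= negbK.
Qed.

Lemma good_eops w T w' : typed w T w' -> good_oper (eops T) (size w) (size w').
Proof.
elim: T w => [|g T IH] w /=; first by move=> /eqP ->; exact: good_id.
by case/andP=> /eqP <- /IH; apply: good_comp; exact: good_eop.
Qed.

Definition olinear H : Prop :=
  (forall (I : finType) (F : I -> (nat -> R) -> nat) v,
     H (fun u => \sum_i F i u)%N v = (\sum_i H (F i) v)%N) /\
  (forall k f v, H (fun u => k * f u)%N v = (k * H f v)%N).

Lemma olinear_eop g : olinear (eop g).
Proof.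
split=> [I F c|k f c]; case: g => [u o v|n b eps|u o v] //=.
- by rewrite big_distrr.
- by rewrite exchange_big.
- by rewrite mulnCA.
- by rewrite big_distrr.
Qed.

Lemma olinear_comp H1 H2 : olinear H1 -> olinear H2 -> olinear (fun f => H1 (H2 f)).
Proof.
move=> [s1 m1] [s2 m2]; split=> [I F v|k f v].
  by rewrite -s1; congr (H1 _ _); apply/funext => u.
by rewrite -m1; congr (H1 _ _); apply/funext => u.
Qed.

Lemma olinear_eops T : olinear (eops T).
Proof. by elim: T => [|g T IH] //; apply: (olinear_comp (olinear_eop g) IH). Qed.

(** The two operators act on disjoint strands; linearity lets [H] pass through the sum of a cup and
    the factor of a cap. *)
Lemma eop_comm H g f c : olinear H ->
  eop g (oat (size (ftarget g)) H f) c = oat (size (fsource g)) H (eop g f) c.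
Proof.
move=> [Hs Hm]; rewrite /oat; case: g => [u o v|n b eps|u o v] /=.
- rewrite !size_cat /= -Hm.
  have -> : cshift (size u + size v) (rm (size u) c) = cshift (size u + (size v).+2) c.
    by apply/funext => j; rewrite /cshift /rm; pointwise.
  congr (H _ _); apply/funext => d; congr ((_ == _) * f _)%N.
  + by rewrite /cjoin; pointwise.
  + by rewrite /cjoin; pointwise.
  + apply/funext => j; rewrite /cjoin /rm; pointwise.
- rewrite size_tuple size_map size_enum_ord; have [w bw] := pact_ex R b; rewrite bw.
  have -> : cshift n (wact w c) = cshift n c.
    by apply/funext => j; rewrite /cshift wact_hi // leq_addr.
  by congr (H _ _); apply/funext => d; rewrite wact_join.
- rewrite !size_cat /= Hs; apply: eq_bigr => a _.
  have -> : cshift (size u + (size v).+2) (ins (size u) a c) = cshift (size u + size v) c.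
    by apply/funext => j; rewrite /cshift /ins; pointwise.
  congr (H _ _); apply/funext => d; congr f.
  apply/funext => j; rewrite /cjoin /ins; pointwise.
Qed.

Lemma eops_comm H w T w' f : olinear H -> typed w T w' ->
  eops T (oat (size w') H f) = oat (size w) H (eops T f).
Proof.
move=> lH; elim: T w => [|g T IH] w /=; first by move=> /eqP ->.
case/andP=> /eqP <- /IH E; apply/funext => c.
by rewrite -eop_comm // -E.
Qed.

End Operators.

Section Typed.
Implicit Types (w : seq bool) (S T : fseq).

Lemma typed_cat w S T w' r : typed w S r -> typed r T w' -> typed w (S ++ T) w'.
Proof.
elim: S w => [|g S IH] w /=; first by move/eqP ->.
by case/andP=> -> gS /(IH _ gS).
Qed.

Lemma typed_split w S T w' : typed w (S ++ T) w' ->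
  exists r, typed w S r /\ typed r T w'.
Proof.
elim: S w => [|g S IH] w /=; first by move=> ?; exists w.
by case/andP=> -> /IH [r [? ?]]; exists r.
Qed.

Lemma typed_source w T w' : ~~ nilp T -> typed w T w' -> w = source T.
Proof. by case: T => //= g T _ /andP[/eqP]. Qed.

Lemma typed_target w T w' : ~~ nilp T -> typed w T w' -> w' = target T.
Proof.
case: T => //= g T _ /andP[_]; elim: T g => [|h T IH] g /=; first by move/eqP.
by case/andP=> _ /IH.
Qed.

Lemma typed_uniq w T w1 w2 : typed w T w1 -> typed w T w2 -> w1 = w2.
Proof.
case: T => [|g T]; first by move=> /eqP <- /eqP <-.
by move=> /typed_target -> // /typed_target ->.
Qed.

Lemma is_tangleE T : is_tangle T = (~~ nilp T) && typed (source T) T (target T).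
Proof.
case: T => [|g T] //=; rewrite /is_tangle /= eqxx /=.
elim: T g => [|h T IH] g /=; first by rewrite eqxx.
by rewrite IH eq_sym.
Qed.

Lemma typed_tangle w T w' : ~~ nilp T -> typed w T w' -> is_tangle T.
Proof.
move=> T0 tT; rewrite is_tangleE T0 /=.
by rewrite -(typed_source T0 tT) -(typed_target T0 tT).
Qed.

Lemma tangle_typed T : is_tangle T -> typed (source T) T (target T).
Proof. by rewrite is_tangleE => /andP[]. Qed.

Lemma tangle_neq0 T : is_tangle T -> ~~ nilp T.
Proof. by rewrite is_tangleE => /andP[]. Qed.

End Typed.

Section Pad.
Variable R : finComNzRingType.
Local Open Scope ring_scope.
Implicit Types (c d : nat -> R) (f : (nat -> R) -> nat).

Lemma pact_near n H (x : pro H) (k : H -> braid n) : ucont k ->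
  pro_near x (fun g => bact (R := R) (k g) = pact (R := R) (pro_ext k x)).
Proof.
by move=> uk; apply: (@pro_near_ext _ _ _ _ (fun g => bact g = _)) => //; exact: pactP.
Qed.

Lemma pact_shift p n q (b : pro (braid n)) c :
  pact (R := R) (pro_ext (@braid_shift p n q) b) c = cjoin p c (pact (R := R) b (cshift p c)).
Proof.
have /pro_near_ex [g [<- <-]] :=
  pro_nearI (pact_near b (@ucont_shift p n q)) (pactP R b).
elim/braid_piS: g => w; rewrite braid_shift_pi bact_pi.
elim: w => [|[i s] w IH] /=; first by rewrite /word_val big_nil bact1 cjoin_shift.
have -> : word_val (fun i : 'I_n.-1 => sigma (p + (n + q)) (p + i)) ((i, s) :: w) =
  (sigma_sgn _ s (p + i) * word_val (fun i : 'I_n.-1 => sigma _ (p + i)) w)%g.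
  by rewrite /word_val big_cons; case: s.
rewrite bactM IH bact_sigma_sgn; last by have := ltn_ord i; lia.
apply/funext => j; rewrite /lact /cjoin; case: s; pointwise.
Qed.

Lemma eop_fpad u g v f : eop (R := R) (fpad u g v) f = oat (size u) (eop g) f.
Proof.
apply/funext => c; rewrite /oat; case: g => [u' o v'|n b eps|u' o v'] /=.
- rewrite size_cat [cshift _ _ (size _).+1]/cshift addnS; congr (_ * f _)%N.
  by apply/funext => j; rewrite /cjoin /rm /cshift; pointwise.
- by rewrite pact_shift.
- rewrite size_cat; apply: eq_bigr => a _; congr f.
  by apply/funext => j; rewrite /cjoin /ins /cshift; pointwise.
Qed.

Lemma oat_comp p (H1 H2 : oper R) f :
  oat p H1 (oat p H2 f) = oat p (fun f => H1 (H2 f)) f.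
Proof.
apply/funext => c; rewrite /oat; congr (H1 _ _); apply/funext => u.
by rewrite cshift_join; congr (H2 _ _); apply/funext => u'; rewrite cjoin_join.
Qed.

Lemma eops_pad u T v f : eops (R := R) (pad u T v) f = oat (size u) (eops T) f.
Proof.
elim: T => [|g T IH]; first by apply/funext => c; rewrite /oat /eops /= cjoin_shift.
transitivity (eop (fpad u g v) (eops (pad u T v) f)); first by [].
by rewrite eop_fpad IH oat_comp.
Qed.

Lemma pact1 n c : pact (R := R) (pro_in (1 : braid n)) c = c.
Proof. by rewrite pact_in bact1. Qed.

Lemma eop_triv w f : eop (R := R) (triv w) f = f.
Proof. by apply/funext => c; rewrite /= pact1. Qed.

(** A single group element near [b] serves for both cables and for the permutation, which reduces
    the claim to words. *)
Lemma pact_cable_slide (H : oper R) s t p q (b : pro (braid (p + (1 + q))))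
    (j : 'I_(p + (1 + q))) f c :
  sliding H s t -> pro_perm b j = p :> nat ->
  oat p H (fun c' => f (pact (R := R) (pro_ext (@cable p t q) b) c')) c =
  oat j H f (pact (R := R) (pro_ext (@cable p s q) b) c).
Proof.
move=> sH bj.
have /pro_near_ex [g [<- [<- gj]]] := pro_nearI (pact_near b (@ucont_cable p t q))
  (pro_nearI (pact_near b (@ucont_cable p s q)) (pro_permP b)).
have pn : (p < p + (1 + q))%N by lia.
have -> : nat_of_ord j = topb g p by rewrite (@braid_perm_topb _ g j) // gj.
(* The widths index the types of the braids, so they are generalized before being rewritten. *)
have E m : (p + (m + q))%N = ((p + (1 + q)).-1 + m)%N by lia.
rewrite !cableE /cableb /topb.
move: (p + (t + q))%N (p + (s + q))%N (E t) (E s) => nt ns -> ->.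
exact: cable_word_slide.
Qed.

(* The invariance of colourings under (T6), read off on the integral powers of a
   crossing. *)
Definition twist_like n k (g : braid n) : Prop := forall c,
  (bact g c k == bact g c k.+1) = (c k == c k.+1) /\ (c k = c k.+1 -> bact g c = c).

Lemma twist_likeM n k (g h : braid n) :
  twist_like k g -> twist_like k h -> twist_like k (g * h)%g.
Proof.
move=> Qg Qh c; rewrite bactM; have [e1 i1] := Qh c; have [e2 i2] := Qg (bact h c).
split; first by rewrite e2 e1.
by move=> ck; rewrite i2 ?i1.
Qed.

Lemma twist_likeV n k (g : braid n) : twist_like k g -> twist_like k g^-1%g.
Proof.
move=> Qg c; set d := bact _ c.
have cd : bact g d = c by rewrite -bactM mulgV bact1.
have [e i] := Qg d; rewrite cd in e i; split=> [|ck]; first by rewrite e.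
by rewrite i //; apply/eqP; rewrite -e; apply/eqP.
Qed.

Lemma twist_like_sigma n k : (k < n.-1)%N -> twist_like k (sigma n k).
Proof.
move=> kn c; rewrite bact_sigma //.
have L0 : lact true k c k = c k.+1 by rewrite /lact eqxx.
have L1 : lact true k c k.+1 = c k.+1 *+ 2 - c k.
  by rewrite /lact eqxx ifF //; lia.
split; first rewrite L0 L1.
  by rewrite -[LHS]subr_eq0 -[RHS]subr_eq0; congr (_ == _); ring.
move=> ck; apply/funext => j; rewrite /lact; case: eqVneq => [->//|_].
by case: eqVneq => [->|//]; rewrite ck; ring.
Qed.

Lemma twist_like_expgz n k z : (k < n.-1)%N -> twist_like k (expgz (sigma n k) z).
Proof.
move=> kn; have Q := twist_like_sigma kn.
have QX m : twist_like k (sigma n k ^+ m)%g.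
  elim: m => [|m IH]; first by rewrite expg0 => c; rewrite bact1.
  by rewrite expgS; exact: twist_likeM.
by case: z => m; [exact: QX | exact/twist_likeV/QX].
Qed.

Lemma pact_pow n k z c : (k < n.-1)%N -> let d := pact (R := R) (pro_pow (sigma n k) z) c in
  (d k == d k.+1) = (c k == c k.+1) /\ (c k = c k.+1 -> d = c).
Proof.
move=> kn /=; have /pro_near_ex [e <-] := pact_near z (ucont_expgz (sigma n k)).
exact: twist_like_expgz.
Qed.

(** [T3] is the commutation of operators on disjoint strands and [T4] the sliding along a cable.
    [T6cup] and [T6cap] hold because a twist fixes the colourings whose two twisted strands have the
    same colour, and creates no others. *)
Lemma turaev_eops L L' f : turaev L L' -> eops (R := R) L f = eops L' f.
Proof.
case=> [T _|T _|n b1 b2 e1 e2 _|S T tS tT|T u o v u' v' b i j tT iu ju bj _|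
  u o v u' o' v' uu' _|u o v o' c b _|u o v o' c b _].
- by rewrite eops_cat; congr eops; rewrite /eops /= eop_triv.
- by rewrite /eops /= eop_triv.
- by apply/funext => c /=; rewrite pactM.
- rewrite !eops_cat !eops_pad !oat0.
  by apply: eops_comm (tangle_typed tS); exact: olinear_eops.
- rewrite eops_cat eops_pad /= eops_pad; apply/funext => c.
  rewrite (@pact_cable_slide (eops T) (size (source T)) (size (target T)) _ _ _ j) ?bj -?iu //.
    by rewrite ju.
  exact/good_sliding/good_eops/tangle_typed.
- apply/funext => c; rewrite /= pact1.
  (* In the sum over the colour of the cup, the cap keeps one term: the colour of the strand being
     straightened, which stands at the smaller of the two indices. *)
  have E a : ((ins (size u) a c (size u') == ins (size u) a c (size u').+1) *
      f (rm (size u') (ins (size u) a c)))%N = ((a == c (minn (size u) (size u'))) * f c)%N.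
    case: uu' => ->.
      rewrite [minn _ _](minn_idPl _) //.
      have -> : ins (size u) a c (size u).+1 = a by rewrite /ins; pointwise.
      have -> : ins (size u) a c (size u).+2 = c (size u) by rewrite /ins; pointwise.
      case: eqP => // ac; congr (_ * f _)%N; apply/funext => j.
      by rewrite /rm /ins; pointwise; rewrite ac; index_eq.
    rewrite [minn _ _](minn_idPr _) //.
    have -> : ins (size u').+1 a c (size u').+1 = a by rewrite /ins; pointwise.
    have -> : ins (size u').+1 a c (size u') = c (size u') by rewrite /ins; pointwise.
    rewrite eq_sym; case: eqP => // ac; congr (_ * f _)%N; apply/funext => j.
    by rewrite /rm /ins; pointwise; rewrite ac; index_eq.
  rewrite (eq_bigr _ (fun a _ => E a)) -big_distrl /=.
  rewrite (bigD1 (c (minn (size u) (size u')))) //= eqxx big1 ?addn0 ?mul1n // => a.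
  by move/negbTE ->.
- apply/funext => d /=; apply: eq_bigr => a _.
  have [|_ ->] := @pact_pow (size u + (2 + size v)) (size u) c (ins (size u) a d) => //.
    lia.
  by rewrite /ins; pointwise.
- apply/funext => d /=.
  have [|E F] := @pact_pow (size u + (2 + size v)) (size u) c d; first lia.
  by rewrite E; case: eqP => // /F ->.
Qed.

End Pad.

(** * Orientations and connectedness *)

Section Orientation.
Local Open Scope ring_scope.
Local Notation F2 := ('F_2 : finComNzRingType).
Implicit Types (c : nat -> F2) (u v w : seq bool).

Lemma nth_ord_image n (F : 'I_n -> bool) j (jn : (j < n)%N) :
  nth false [seq F i | i : 'I_n] j = F (Ordinal jn).
Proof.
rewrite (nth_map (Ordinal jn)) ?size_enum_ord //.
by congr F; apply: val_inj; rewrite /= nth_enum_ord.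
Qed.

Lemma F2_double (x : F2) : x *+ 2 = 0.
Proof. by apply/val_inj; case: x => [[|[|]]]. Qed.

Lemma F2_opp (x : F2) : - x = x.
Proof. by apply/val_inj; case: x => [[|[|]]]. Qed.

(** Orientation words are read as colourings over F_2, on which braids act by permuting strands.
    Target words can then be computed with the lemmas on colourings. *)
Definition col w : nat -> F2 := fun j => (nth false w j)%:R.

Lemma col_inj w w' : size w = size w' -> col w = col w' -> w = w'.
Proof.
move=> sw cw; apply: (@eq_from_nth _ false) => // j _.
by have := congr1 (@^~ j) cw; rewrite /col; do 2 case: nth.
Qed.

Lemma col_cat u w : col (u ++ w) = cjoin (size u) (col u) (col w).
Proof. by apply/funext => j; rewrite /col /cjoin nth_cat; case: ltnP. Qed.

(** In characteristic two the reflection [2 b - a] is [a] itself, so crossings merely exchange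
    colours. *)
Lemma wact_perm n (w : braid_word n) c j : wact w c j = c (strand_bot w j).
Proof.
elim: w j => //= -[i s] w IH j; rewrite /lact /swapn /=.
have L (x y : F2) : (if s then x else y *+ 2 - x) = x by rewrite F2_double sub0r F2_opp; case: (s).
have L' (x y : F2) : (if s then y *+ 2 - x else x) = x by rewrite F2_double sub0r F2_opp; case: (s).
by rewrite L L' !IH; case: eqP => // _; case: eqP.
Qed.

Lemma pact_perm n (b : pro (braid n)) c (j : 'I_n) : pact b c j = c (pro_perm b j).
Proof.
have /pro_near_ex [g [<- <-]] := pro_nearI (pactP F2 b) (pro_permP b).
by rewrite /bact wact_perm braid_permE.
Qed.

Lemma size_ftarget_braid n (b : pro (braid n)) eps :
  size (ftarget (Braid b eps)) = n.
Proof. by rewrite /= size_map size_enum_ord. Qed.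

Lemma col_ftarget n (b : pro (braid n)) eps : col (ftarget (Braid b eps)) = pact b (col eps).
Proof.
apply/funext => j; rewrite /col; case: (ltnP j n) => jn.
  rewrite -[j]/(nat_of_ord (Ordinal jn)) pact_perm [ftarget _]/=.
  by rewrite (nth_ord_image _ jn) (tnth_nth false).
rewrite nth_default ?size_ftarget_braid //; have [w ->] := pact_ex F2 b.
by rewrite wact_hi // nth_default // size_tuple.
Qed.

Lemma fsource_fpad u g v : fsource (fpad u g v) = u ++ fsource g ++ v.
Proof. by case: g => [u' o v'|n b eps|u' o v'] /=; rewrite -?catA. Qed.

Lemma ftarget_fpad u g v : ftarget (fpad u g v) = u ++ ftarget g ++ v.
Proof.
case: g => [u' o v'|n b eps|u' o v']; rewrite /fpad; try by rewrite /= -?catA.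
apply: col_inj; first by rewrite size_ftarget_braid !size_cat size_ftarget_braid.
rewrite col_ftarget pact_shift [tval _]/= !col_cat cjoin_join cshift_join.
rewrite size_tuple size_ftarget_braid col_ftarget.
by have [w ->] := pact_ex F2 b; rewrite wact_join.
Qed.

Lemma typed_pad u T v w w' : typed w T w' ->
  typed (u ++ w ++ v) (pad u T v) (u ++ w' ++ v).
Proof.
elim: T w => [|g T IH] w /=; first by move/eqP ->.
by case/andP=> /eqP <- /IH; rewrite fsource_fpad ftarget_fpad eqxx.
Qed.

(** This operator does not come from a tangle: it erases one colour and writes [m] prescribed ones.
    Over F_2 the terms with a factor 2 vanish, so it still slides along braids, and thereby shows
    where the strands of a cable arrive. *)
Lemma sliding_insert m (x : nat -> F2) :
  sliding (fun f c => f (cjoin m x (cshift 1 c))) 1 m.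
Proof.
split.
- move=> f f' c; apply; first by rewrite cshift_join.
  by rewrite !mulr_natl !F2_double.
- by move=> f c z; rewrite cjoin_join cshift_join.
- move=> y f c; rewrite F2_double.
  have rI d : refl 0 d = d :> (nat -> F2) by apply/funext => j; rewrite /refl sub0r F2_opp.
  by rewrite !rI.
- by rewrite F2_opp !expr1n.
Qed.

Lemma ftarget_cable u o v x u' v' (b : pro (braid (size u + (1 + size v))))
    (i j : 'I_(size u + (1 + size v))) :
  i = size u :> nat -> j = size u' :> nat -> pro_perm b j = i ->
  ftarget (Braid b (word3 u [:: o] v)) = u' ++ [:: o] ++ v' ->
  ftarget (Braid (pro_ext (@cable (size u) (size x) (size v)) b) (word3 u x v)) =
  u' ++ x ++ v'.
Proof.
move=> iu ju bj bt; apply: col_inj.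
  rewrite size_ftarget_braid; have := congr1 size bt.
  by rewrite size_ftarget_braid !size_cat /=; lia.
rewrite col_ftarget; apply/funext => k.
have bj' : pro_perm b j = size u :> nat by rewrite bj.
(* The weight that reads the colour at position [k] turns the equality of operators into an equality
   of orientations. *)
have := pact_cable_slide (fun d => nat_of_ord (d k)) (col (u ++ [:: o] ++ v))
  (sliding_insert (size x) (col x)) bj'.
have cb : pact b (col (u ++ [:: o] ++ v)) = col (u' ++ [:: o] ++ v').
  by rewrite -bt col_ftarget.
have sE p y y' : cshift 1 (cshift (size p) (col (p ++ y :: y'))) = col y'.
  by rewrite col_cat cshift_join -cat1s col_cat cshift_join.
have jE p y y' : cjoin (size p) (col (p ++ y)) y' = cjoin (size p) (col p) y'.
  by rewrite col_cat cjoin_join.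
by rewrite pro_ext_cable1 ju /oat cb !sE !jE => /val_inj; rewrite -!col_cat => <-.
Qed.

Lemma turaev_typed L L' : turaev L L' ->
  exists s t, [/\ typed s L t, typed s L' t, ~~ nilp L & ~~ nilp L'].
Proof.
have triv_typed w : typed w [:: triv w] w.
  rewrite /= eqxx /=; apply/eqP; apply: (@eq_from_nth _ false) => [|j].
    by rewrite size_map size_enum_ord.
  rewrite size_map size_enum_ord => jn.
  rewrite (nth_ord_image _ jn) pro_perm_in (tnth_nth false).
  by rewrite braid_permE -braid_pi_nil botb_pi.
have cat0 : forall T : fseq, ~~ nilp T -> forall S, ~~ nilp (S ++ T).
  by move=> T; rewrite /nilp => T0 S; rewrite size_cat addn_eq0 negb_and T0 orbT.
case=> [T tT|T tT|n b1 b2 e1 e2 e12|S T tS tT|T u o v u' v' b i j tT iu ju bj bt|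
  u o v u' o' v' uu' bt|u o v o' c b bt|u o v o' c b bt].
- exists (source T), (target T); split; first last.
  + exact: tangle_neq0. + exact: cat0. + exact: tangle_typed.
  by apply: typed_cat (tangle_typed tT) _.
- exists (source T), (target T); split=> //; first last.
  + exact: tangle_neq0. + exact: tangle_typed.
  by apply: (@typed_cat _ [:: _] _ _ (source T)) => //; exact: tangle_typed.
- exists e1, (ftarget (Braid b2 e2)); split=> //.
    by rewrite /typed e12 !eqxx.
  rewrite /typed eqxx andTb; apply/eqP.
  apply: (@eq_from_nth _ false) => [|j]; first by rewrite !size_ftarget_braid.
  rewrite size_ftarget_braid => jn.
  rewrite !(nth_ord_image _ jn) pro_perm_mul permM.
  rewrite [RHS](tnth_nth false) -e12 (nth_ord_image _ (ltn_ord _)).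
  by congr (tnth e1 (pro_perm b1 _)); apply: val_inj.
- exists (source S ++ source T), (target S ++ target T).
  have sp : forall w w' S', typed w S' w' -> forall v, typed (w ++ v) (pad [::] S' v) (w' ++ v).
    by move=> w w' S' ts v; exact: (@typed_pad [::]).
  have sp' : forall w w' S', typed w S' w' -> forall v, typed (v ++ w) (pad v S' [::]) (v ++ w').
    by move=> w w' S' ts v; have := @typed_pad v S' [::] w w' ts; rewrite !cats0.
  have nS := tangle_neq0 tS; have nT := tangle_neq0 tT.
  have np u v S' : ~~ nilp S' -> ~~ nilp (pad u S' v) by rewrite /nilp size_map.
  split; try by apply: cat0; apply: np.
  + by apply: typed_cat (sp _ _ _ (tangle_typed tS) _) (sp' _ _ _ (tangle_typed tT) _).
  + by apply: typed_cat (sp' _ _ _ (tangle_typed tT) _) (sp _ _ _ (tangle_typed tS) _).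
- exists (u ++ source T ++ v), (u' ++ target T ++ v'); split.
  + apply: typed_cat (typed_pad _ _ (tangle_typed tT)) _.
    by rewrite /typed (ftarget_cable _ iu ju bj bt) !eqxx.
  + apply: (@typed_cat _ [:: _] _ _ (u' ++ source T ++ v')).
      by rewrite /typed (ftarget_cable _ iu ju bj bt) !eqxx.
    exact: typed_pad (tangle_typed tT).
  + exact: cat0.
  + by [].
- exists (u ++ v), (u' ++ v'); split=> //.
    by rewrite /typed bt !eqxx.
  suff -> : u' ++ v' = u ++ v by exact: triv_typed.
  move: bt; rewrite /= => bt; case: uu' => su.
    have {}su : u' = u ++ [:: o].
      have := congr1 (take (size u')) bt; rewrite [RHS]take_size_cat // su.
      by rewrite take_cat ifF ?subSnn /= ?take0 => [->|]; last lia.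
    move: bt; rewrite su -!catA => /eqP; rewrite eqseq_cat // eqxx /= => /eqP [<- ->].
    by rewrite -?catA /= negbK.
  have {}su : u = u' ++ [:: o'].
    have := congr1 (take (size u)) bt; rewrite [LHS]take_size_cat // su.
    by rewrite take_cat ifF ?subSnn /= ?take0 => [->|]; last lia.
  move: bt; rewrite su -!catA => /eqP; rewrite eqseq_cat // eqxx /= => /eqP [-> <-].
  by rewrite -?catA /= negbK.
- exists (u ++ v), (ftarget (Cup u o' v)); split=> //.
    by rewrite /typed -/b bt /= !eqxx.
  by rewrite /typed !eqxx.
- exists (fsource b), (u ++ v); split=> //.
    by rewrite /typed bt !eqxx.
  by rewrite /typed /= !eqxx.
Qed.

Lemma turaev_typed_in L L' A B w w' : turaev L L' ->
  typed w (A ++ L ++ B) w' <-> typed w (A ++ L' ++ B) w'.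
Proof.
move=> /turaev_typed [s [t [tL tL' nL nL']]].
have H S S' : typed s S t -> typed s S' t -> ~~ nilp S ->
    typed w (A ++ S ++ B) w' -> typed w (A ++ S' ++ B) w'.
  move=> tS tS' nS /typed_split [r [tA /typed_split [r' [tSr tB]]]].
  apply: typed_cat tA _; apply: typed_cat tB.
  rewrite (typed_source nS tSr) -(typed_source nS tS).
  by rewrite (typed_target nS tSr) -(typed_target nS tS).
by split; apply: H.
Qed.

End Orientation.

Section Isotopy.
Variable R : finComNzRingType.

Lemma isotopic_eops T T' f : isotopic T T' -> eops (R := R) T f = eops T' f.
Proof.
elim=> [_ _ [A B L L' LL' _ _]|//|? ? _ -> //|? ? ? _ -> _ -> //].
by rewrite !eops_cat (turaev_eops _ LL').
Qed.

Definition count_col (T : fseq) : nat := eops (R := R) T (fun=> 1%N) (fun=> 0%R).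

Lemma isotopic_count T T' : isotopic T T' -> count_col T = count_col T'.
Proof. by move=> TT'; rewrite /count_col (isotopic_eops _ TT'). Qed.

End Isotopy.

Lemma isotopic_typed T T' w w' : isotopic T T' -> typed w T w' <-> typed w T' w'.
Proof.
elim=> [_ _ [A B L L' LL' _ _]|//|? ? _ -> //|? ? ? _ -> _ -> //].
exact: turaev_typed_in.
Qed.

(** * Explicit colourings and the components of the skeleton *)

Section Runs.
Variable R : finComNzRingType.
Implicit Types (c d : nat -> R) (T : fseq) (r : seq (nat -> R)).

Definition nxt (g : fund) c : seq (nat -> R) :=
  match g with
  | Cap u o v => if c (size u) == c (size u).+1 then [:: rm (size u) c] else [::]
  | Braid n b eps => [:: pact b c]
  | Cup u o v => [seq ins (size u) a c | a <- enum R]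
  end.

(** Lists the colourings that [eops] only counts, so that they can be matched one by one with
    labellings of the skeleton. *)
Fixpoint runs T c : seq (seq (nat -> R)) :=
  if T is g :: T' then [seq d :: r | d <- nxt g c, r <- runs T' d] else [:: [::]].

Lemma size_runs T c : size (runs T c) = eops T (fun=> 1%N) c.
Proof.
elim: T c => //= g T IH c; rewrite size_allpairs_dep sumnE big_map.
rewrite (eq_bigr (eops T (fun=> 1%N))) => [|d _]; last exact: IH.
case: g => [u o v|n b eps|u o v] /=.
- by case: eqP => _; rewrite ?big_seq1 ?big_nil ?mul1n ?mul0n.
- by rewrite big_seq1.
- by rewrite big_map big_enum.
Qed.

Lemma uniq_nxt g c : uniq (nxt g c).
Proof.
case: g => [u o v|n b eps|u o v] //=; first by case: eqP.
rewrite map_inj_uniq ?enum_uniq // => a a' /(congr1 (@^~ (size u))).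
by rewrite /ins ltnn leqnSn.
Qed.

Lemma uniq_runs T c : uniq (runs T c).
Proof.
elim: T c => //= g T IH c; apply: allpairs_uniq_dep => //; first exact: uniq_nxt.
by move=> [d r] [d' r'] _ _ /= [-> ->].
Qed.

Fixpoint valid T c r : bool :=
  match T, r with
  | [::], [::] => true
  | g :: T', d :: r' => (d \in nxt g c) && valid T' d r'
  | _, _ => false
  end.

Lemma mem_runs T c r : (r \in runs T c) = valid T c r.
Proof.
elim: T c r => [|g T IH] c [|d r] //=; first by apply/negP => /allpairsPdep [? [? []]].
apply/allpairsPdep/idP.
- by move=> [d' [r' [d'g r'T [-> ->]]]]; rewrite d'g -IH.
- by case/andP=> dg dT; exists d, r; rewrite IH.
Qed.

End Runs.

Section Widths.
Implicit Types (T A B : fseq) (w : seq bool).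

Definition width w T i : nat := nth 0%N (size w :: [seq size (ftarget g) | g <- T]) i.

Lemma width_cat w A B w' r : typed w A r -> width w (A ++ B) (size A) = size r.
Proof.
elim: A w => [|g A IH] w /=; first by move/eqP ->; case: B.
by case/andP=> _ /IH.
Qed.

Lemma skel_vertexE w T w' x : typed w T w' -> ~~ nilp T ->
  skel_vertex T x <-> (x.2 < width w T x.1)%N.
Proof.
move=> tT T0; split.
  move=> [A [g [B [E [[-> xg]|[-> xg]]]]]]; rewrite E in tT *.
    have [r [tA /andP[/eqP gr _]]] := typed_split tT.
    by rewrite (width_cat _ w' tA) -gr.
  rewrite -cat_rcons -(size_rcons A g).
  move: tT; rewrite -cat_rcons => /typed_split [r [tA _]].
  rewrite (width_cat _ w' tA); suff -> : r = ftarget g by [].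
  by move: tA; rewrite -cats1 => /typed_split [s [_ /andP[_ /eqP]]].
case: x => [[|i] j] /=; rewrite /width /=.
  case: T tT T0 => // g T /andP[/eqP gw _] _ jw; exists [::], g, T.
  by split=> //; left; rewrite gw.
case: (ltnP i (size T)) => iT; last by rewrite nth_default ?size_map.
case: T tT T0 iT => // g0 T _ _ iT; rewrite (nth_map g0) // => jw.
exists (take i (g0 :: T)), (nth g0 (g0 :: T) i), (drop i.+1 (g0 :: T)).
rewrite -drop_nth // cat_take_drop; split=> //; right.
by rewrite size_take iT.
Qed.

Lemma skel_edge_cons g T x y : skel_edge (g :: T) x y <->
  Defs.arc g x y \/ exists x' y', [/\ x = (x'.1.+1, x'.2), y = (y'.1.+1, y'.2) & skel_edge T x' y'].
Proof.
split=> [[A h B [i j] [i' j'] E a]|[a|[x' [y' [-> -> [A h B x'' y'' E a]]]]]].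
- case: A E => [|g' A] [-> E]; first by left; rewrite !add0n.
  right; exists ((size A + i)%N, j), ((size A + i')%N, j'); split=> //.
  exact: (SkelEdge E a).
- case: x a => [i j]; case: y => [i' j'] a.
  exact: (@SkelEdge (g :: T) [::] g T (i, j) (i', j') erefl a).
- by rewrite E; exact: (@SkelEdge _ (g :: A) h B _ _ erefl a).
Qed.

End Widths.

Section Connectivity.
Local Open Scope ring_scope.
Local Notation F2 := ('F_2 : finComNzRingType).
Implicit Types (c : nat -> F2) (T : fseq) (w : seq bool) (la : nat * nat -> F2).

(** Beyond the width the value is 0, as in every run that starts from the zero colouring. Equality
    of runs thus means equality on the vertices. *)
Definition lab (n : nat) (l : nat -> F2) : nat -> F2 := fun j => if (j < n)%N then l j else 0.

Fixpoint lab_run T (la : nat * nat -> F2) : seq (nat -> F2) :=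
  if T is g :: T' then
    lab (size (ftarget g)) (fun j => la (1%N, j)) :: lab_run T' (fun x => la (x.1.+1, x.2))
  else [::].

Definition lab_ok T la : Prop := forall x y, skel_edge T x y -> la x = la y.

Lemma lab_ok_cons g T la : lab_ok (g :: T) la <->
  (forall x y, Defs.arc g x y -> la x = la y) /\ lab_ok T (fun x => la (x.1.+1, x.2)).
Proof.
split=> [H|[H1 H2] x y /skel_edge_cons []]; last first.
- by move=> [x' [y' [-> -> /H2]]].
- exact: H1.
split=> x y xy; first by apply: H; apply/skel_edge_cons; left.
by apply: H; apply/skel_edge_cons; right; exists x, y.
Qed.

Lemma nxt_lab g la : (forall x y, Defs.arc g x y -> la x = la y) ->
  lab (size (ftarget g)) (fun j => la (1%N, j)) \in
  nxt g (lab (size (fsource g)) (fun j => la (0%N, j))).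
Proof.
case: g => [u o v|n b eps|u o v] H /=.
- rewrite !size_cat /=; set l0 := lab (size u + (size v).+2) _.
  have -> : l0 (size u) = l0 (size u).+1.
    by rewrite /l0 /lab !ifT ?(H _ _ (ArcCap u o v)) //; lia.
  rewrite eqxx inE; apply/eqP/funext => j; rewrite /l0.
  rewrite /lab /rm; case: (ltnP j (size u)) => ju.
    have -> : (j < size u + size v)%N by lia.
    have -> : (j < size u + (size v).+2)%N by lia.
    by rewrite (H _ _ (ArcCapL o v ju)).
  case: ltnP => juv; last by rewrite ifF //; lia.
  have -> : (j.+2 < size u + (size v).+2)%N by lia.
  by rewrite -(H _ _ (@ArcCapR u o v j _)) // ju.
- rewrite inE size_map size_enum_ord size_tuple; apply/eqP/funext => j.
  rewrite {1}/lab; case: ltnP => jn.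
    rewrite -(H _ _ (ArcBraid b eps (Ordinal jn))) -[j]/(nat_of_ord (Ordinal jn)) pact_perm.
    by rewrite /lab ltn_ord.
  have [s ->] := pact_ex F2 b; rewrite wact_hi // /lab ifF //.
  by rewrite ltnNge jn.
- rewrite !size_cat /=; apply/mapP; exists (la (1%N, size u)); first by rewrite mem_enum.
  apply/funext => j; rewrite /lab /ins; case: (ltnP j (size u)) => ju.
    have -> : (j < size u + size v)%N by lia.
    have -> : (j < size u + (size v).+2)%N by lia.
    by rewrite (H _ _ (ArcCupL o v ju)).
  case: (ltnP j (size u).+2) => ju2.
    have -> : (j < size u + (size v).+2)%N by lia.
    have [->//|->] : j = size u \/ j = (size u).+1 by lia.
    by rewrite (H _ _ (ArcCup u o v)).
  have jE : j = j.-2.+2 by lia.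
  case: ltnP => juv; last by rewrite ifF //; lia.
  have -> : (j.-2 < size u + size v)%N by lia.
  rewrite (H _ _ (@ArcCupR u o v j.-2 _)); last lia.
  by rewrite -jE.
Qed.

Lemma valid_lab w T w' la : typed w T w' -> lab_ok T la ->
  valid T (lab (size w) (fun j => la (0%N, j))) (lab_run T la).
Proof.
elim: T w la => //= g T IH w la /andP[/eqP <- tT] /lab_ok_cons [H1 H2].
by rewrite nxt_lab //= (IH _ _ tT H2).
Qed.

Definition run_lab (c : nat -> F2) (r : seq (nat -> F2)) (x : nat * nat) : F2 :=
  nth (fun=> 0) (c :: r) x.1 x.2.

Lemma nxt_arc g c d x y : d \in nxt g c -> Defs.arc g x y ->
  run_lab c [:: d] x = run_lab c [:: d] y.
Proof.
move=> dg xy; case: xy dg => [n b eps j|u o v|u o v j ju|u o v j ju|u o v|u o v j ju|u o v j ju] /=;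
  rewrite /run_lab /=.
- by rewrite inE => /eqP ->; rewrite pact_perm.
- by case: eqP.
- by case: eqP => // _; rewrite inE => /eqP ->; rewrite /rm ju.
- by case: eqP => // _; rewrite inE => /eqP ->; rewrite /rm ifF //; lia.
- by case/mapP => a _ ->; rewrite /ins ltnn ltnSn leqnSn ltnNge leqnSn.
- by case/mapP => a _ ->; rewrite /ins ju.
- by case/mapP => a _ ->; rewrite /ins !ifF //; lia.
Qed.

Lemma valid_lab_ok T c r : valid T c r -> lab_ok T (run_lab c r).
Proof.
elim: T c r => [|g T IH] c [|d r] //=.
  by move=> _ x y [A h B x' y' E]; case: A E.
case/andP=> dg /IH dr; apply/lab_ok_cons; split=> // x y xy.
have := nxt_arc dg xy; rewrite /run_lab.
by case: xy.
Qed.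

Lemma nxt_tail g c d : d \in nxt g c ->
  (forall j, (size (fsource g) <= j)%N -> c j = 0) ->
  forall j, (size (ftarget g) <= j)%N -> d j = 0.
Proof.
case: g => [u o v|n b eps|u o v] dg c0 j; move: dg => /=.
- rewrite !size_cat; case: eqP => // _; rewrite inE => /eqP -> juv.
  by rewrite /rm ifF ?c0 //= ?size_cat /=; lia.
- rewrite inE size_map size_enum_ord => /eqP -> nj; have [s ->] := pact_ex F2 b.
  by rewrite wact_hi // c0 //= size_tuple.
- case/mapP => a _ ->; rewrite !size_cat /= => juv.
  by rewrite /ins !ifF ?c0 //= ?size_cat; lia.
Qed.

Lemma lab_run_lab w T w' c r : typed w T w' -> valid T c r ->
  (forall j, (size w <= j)%N -> c j = 0) -> r = lab_run T (run_lab c r).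
Proof.
elim: T w c r => [|g T IH] w c [|d r] //= /andP[/eqP <- tT] /andP[dg dr] c0.
have d0 := nxt_tail dg c0.
rewrite {1}(IH _ _ _ tT dr d0); congr cons.
apply/funext => j; rewrite /lab /run_lab /=; case: ltnP => // /d0.
by [].
Qed.

Lemma lab_run_eq w T la la' :
  lab_run T la = lab_run T la' <->
  (forall i j, (j < width w T i.+1)%N -> la (i.+1, j) = la' (i.+1, j)).
Proof.
elim: T w la la' => [|g T IH] w la la' /=.
  by split=> // _ i j; rewrite /width /= nth_nil.
split=> [[E /(IH (ftarget g)) E'] [|i] j jw|H].
- have := congr1 (@^~ j) E; rewrite /lab.
  by move: jw; rewrite /width /= => ->.
- exact: (E' i).
- congr cons; last by apply/(IH (ftarget g)) => i j jw; apply: H.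
  by apply/funext => j; rewrite /lab; case: ltnP => // jw; apply: (H 0%N).
Qed.

(* Over F_2 colourings are constant along strands, hence are the functions on the
   set of components. *)
Lemma connected_count T w' : typed [::] T w' -> ~~ nilp T ->
  skel_connected T <-> count_col F2 T = 2%N.
Proof.
move=> tT T0; rewrite /count_col -size_runs; set c0 := fun=> _.
have vE x := skel_vertexE x tT T0.
have w0 j : ~ (j < width [::] T 0)%N by [].
pose cst (a : F2) (x : nat * nat) := a.
have rl la : lab_ok T la -> lab_run T la \in runs T c0.
  by move=> /(valid_lab tT); rewrite mem_runs; congr (valid _ _ _); apply/funext.
have rc a : lab_run T (cst a) \in runs T c0 by apply: rl.
have neq x : skel_vertex T x -> lab_run T (cst 0) <> lab_run T (cst 1).
  move/vE; case: x => [[|i] j] //= jw /(lab_run_eq [::]) /(_ i j jw).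
  by move/eqP; rewrite eq_sym oner_eq0.
have runE r : r \in runs T c0 -> lab_ok T (run_lab c0 r) /\ r = lab_run T (run_lab c0 r).
  rewrite mem_runs => vr; split; first exact: valid_lab_ok.
  exact: lab_run_lab tT vr _.
have eqc la a : (forall x, skel_vertex T x -> la x = a) -> lab_run T la = lab_run T (cst a).
  by move=> H; apply/(lab_run_eq [::]) => i j jw; apply/H/vE.
split=> [[[x0 vx0] conn]|cnt].
  (* Connectedness makes every colouring constant, which leaves the two constant ones. *)
  have sub : {subset runs T c0 <= [:: lab_run T (cst 0); lab_run T (cst 1)]}.
    move=> r /runE [ok ->].
    have cc x : skel_vertex T x -> run_lab c0 r x = run_lab c0 r x0.
      move=> vx; have := conn _ _ vx vx0.
      by elim=> [x' y' /ok|//|? ? _ ->|? ? ? _ -> _ ->].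
    rewrite (eqc _ _ cc) !inE; move: (run_lab c0 r x0) => a.
    have [->|->] : a = 0 \/ a = 1; last by rewrite eqxx orbT.
      by case: a => [[|[|]]] // i; [left|right]; apply: val_inj.
    by rewrite eqxx.
  apply/eqP; rewrite eqn_leq (uniq_leq_size (uniq_runs T c0) sub) /=.
  rewrite -[2%N]/(size [:: lab_run T (cst 0); lab_run T (cst 1)]).
  apply: uniq_leq_size; first by rewrite /= inE andbT; apply/eqP/(neq _ vx0).
  by move=> r; rewrite !inE => /orP[]/eqP ->.
(* Without vertices all colourings coincide, against the count of two. *)
have [[x0 vx0]|nv] := pselect (exists x, skel_vertex T x); last first.
  have : (size (runs T c0) <= size [:: lab_run T (cst 0%R)])%N.
    apply: uniq_leq_size; first exact: uniq_runs.
    move=> r /runE [_ ->]; rewrite inE; apply/eqP/eqc => x vx.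
    by case: nv; exists x.
  by rewrite cnt.
have conn x : skel_vertex T x -> clos_refl_sym_trans _ (skel_edge T) x0 x.
  (* The indicator of the component of [x0] is a colouring; if it differed from both constants there
     would be at least three colourings. *)
  pose la y : F2 := if `[< clos_refl_sym_trans _ (skel_edge T) x0 y >] then 1 else 0.
  have laE : lab_ok T la.
    move=> y z yz; rewrite /la; congr (if _ then _ else _).
    apply/asboolP/asboolP => H; apply: rst_trans H _.
      exact: rst_step.
    exact/rst_sym/rst_step.
  have la0 : la x0 = 1 by rewrite /la asboolT //; exact: rst_refl.
  have : lab_run T la \in [:: lab_run T (cst 0); lab_run T (cst 1)].
    apply: contraPT (leqnn 3%N) => nla; apply/negP; rewrite -ltnNge -cnt ltnS.
    suff : (3 <= size (runs T c0))%N by rewrite cnt.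
    rewrite -[3%N]/(size [:: lab_run T la; lab_run T (cst 0); lab_run T (cst 1)]).
    apply: uniq_leq_size.
      by rewrite cons_uniq nla /= inE andbT; apply/eqP/(neq _ vx0).
    by move=> r; rewrite !inE => /or3P[]/eqP -> //; exact: rl.
  have vv a y : lab_run T la = lab_run T (cst a) -> skel_vertex T y -> la y = a.
    move/(lab_run_eq [::]) => H /vE; case: y => [[|i] j] //= jw; exact: H.
  rewrite !inE => /orP[]/eqP E vx.
    have := vv _ _ E vx0; rewrite la0 => /eqP; by rewrite oner_eq0.
  have := vv _ _ E vx; rewrite /la; by case: asboolP.
split; first by exists x0.
by move=> x y vx vy; apply: rst_trans (conn y vy); apply/rst_sym/conn.
Qed.

End Connectivity.

Notation F2 := ('F_2 : finComNzRingType).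

Lemma is_knotE T : is_knot T <->
  [/\ ~~ nilp T, typed [::] T [::] & count_col F2 T = 2%N].
Proof.
split=> [[tT sT eT cT]|[T0 tT cT]].
  have t0 : typed [::] T [::] by have := tangle_typed tT; rewrite sT eT.
  by split=> //; [exact: tangle_neq0 | apply/(connected_count t0 (tangle_neq0 tT))].
split; first exact: typed_tangle T0 tT.
- by rewrite -(typed_source T0 tT).
- by rewrite -(typed_target T0 tT).
- by apply/(connected_count tT T0).
Qed.

Lemma isotopic_nilp T T' : isotopic T T' -> nilp T = nilp T'.
Proof.
elim=> [_ _ [A B L L' _ tL tL']|//|? ? _ -> //|? ? ? _ -> _ -> //].
by rewrite (negbTE (tangle_neq0 tL)) (negbTE (tangle_neq0 tL')).
Qed.

Lemma isotopic_knot T T' : isotopic T T' -> is_knot T <-> is_knot T'.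
Proof.
move=> TT'; rewrite !is_knotE (isotopic_nilp TT') (isotopic_count _ TT').
by have H := isotopic_typed [::] [::] TT'; split=> -[? /H ? ?].
Qed.

(** * Local isotopies *)

Section Casts.

Definition bcast n n' (e : n = n') (b : braid n) : braid n' :=
  eq_rect n (fun k => braid k) b n' e.
Definition pcast n n' (e : n = n') (b : pro (braid n)) : pro (braid n') :=
  eq_rect n (fun k => pro (braid k)) b n' e.

Lemma bcastM n n' (e : n = n') : {morph bcast e : x y / x * y}.
Proof. by case: n' / e. Qed.

Lemma bcast_sigma n n' (e : n = n') i : bcast e (sigma n i) = sigma n' i.
Proof. by case: n' / e. Qed.

Lemma pcast_ext (G : groupType) n n' (e : n = n') (f : G -> braid n) x :
  pcast e (pro_ext f x) = pro_ext (bcast e \o f) x.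
Proof. by case: n' / e; apply: pro_near_ext2. Qed.

Lemma Braid_cast n n' (e : n = n') (b : pro (braid n)) (eps : n.-tuple bool)
    (eps' : n'.-tuple bool) :
  eps = eps' :> seq bool -> Braid b eps = Braid (pcast e b) eps'.
Proof.
case: n' / e eps' => eps' E; congr (Braid _ _); exact: val_inj.
Qed.

Lemma shift_sigma p n q i : (i < n.-1)%N ->
  @braid_shift p n q (sigma n i) = sigma _ (p + i).
Proof.
move=> ni; rewrite (sigmaE ni) braid_shift_pi /word_val big_seq1 /=.
by [].
Qed.

(** The two widths agree only through a proof, so the braid is transported along it; the shifts are
    then homomorphisms that agree on generators. *)
Lemma fpad_fpad u u' g v' v : fpad u (fpad u' g v') v = fpad (u ++ u') g (v' ++ v).
Proof.
case: g => [u1 o v1|n b eps|u1 o v1] /=; rewrite ?catA //.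
have e : (size u + (size u' + (n + size v') + size v) =
  size (u ++ u') + (n + size (v' ++ v)))%N by rewrite !size_cat; lia.
rewrite (@Braid_cast _ _ e _ _ (cat_tuple (in_tuple (u ++ u')) (cat_tuple eps (in_tuple (v' ++ v))))).
  congr (Braid _ _); rewrite pro_ext_comp; [|exact: ucont_shift|exact: ucont_shift].
  rewrite pcast_ext; apply: pro_near_ext2 => g; apply: hom_eq; last first.
  - move=> i; rewrite -sigma_ord /= !shift_sigma ?bcast_sigma ?size_cat ?addnA //.
    by have := ltn_ord i; lia.
  - exact: braid_shiftM.
  - by move=> x y /=; rewrite !braid_shiftM bcastM.
by rewrite /= -!catA.
Qed.

Lemma fpad_nil g : fpad [::] g [::] = g.
Proof.
case: g => [u1 o v1|n b eps|u1 o v1] /=; rewrite ?cats0 //.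
have e : (0 + (n + 0) = n)%N by rewrite addn0.
rewrite (@Braid_cast _ _ e _ _ eps); last by rewrite /= cats0.
congr (Braid _ _); rewrite -[RHS]pro_ext_id pcast_ext.
apply: pro_near_ext2 => g; apply: hom_eq => //.
  by move=> x y /=; rewrite !braid_shiftM bcastM.
by move=> i; rewrite -sigma_ord /= shift_sigma ?bcast_sigma.
Qed.

Lemma pad_pad u u' T v' v : pad u (pad u' T v') v = pad (u ++ u') T (v' ++ v).
Proof. by rewrite /pad -map_comp; apply: eq_map => g; exact: fpad_fpad. Qed.

Lemma pad_nil T : pad [::] T [::] = T.
Proof. by rewrite /pad -[RHS]map_id; apply: eq_map => g; exact: fpad_nil. Qed.

Lemma pad_cat u S T v : pad u (S ++ T) v = pad u S v ++ pad u T v.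
Proof. exact: map_cat. Qed.

Lemma nilp_pad u T v : nilp (pad u T v) = nilp T.
Proof. by rewrite /nilp size_map. Qed.

End Casts.

Section LocalIsotopy.
Implicit Types (w s t u v x : seq bool) (S T : fseq).

(* The leading trivial tangle keeps both sides nonempty. *)
Definition eqt w w' T T' : Prop :=
  [/\ typed w T w', typed w T' w' &
    forall A B v v', typed v A w -> typed w' B v' ->
      isotopic (triv v :: A ++ T ++ B) (triv v :: A ++ T' ++ B)].

Lemma triv_typed w : typed w [:: triv w] w.
Proof.
rewrite /= eqxx /=; apply/eqP; apply: col_inj; first by rewrite size_ftarget_braid.
by rewrite col_ftarget; apply/funext => j; rewrite pact1.
Qed.

Lemma eqt_refl w w' T : typed w T w' -> eqt w w' T T.
Proof. by split=> // A B v v' _ _; exact: rst_refl. Qed.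

Lemma eqt_sym w w' T T' : eqt w w' T T' -> eqt w w' T' T.
Proof. by case=> tT tT' H; split=> // A B v v' tA tB; apply/rst_sym/(H _ _ _ v'). Qed.

Lemma eqt_trans w w' T T' T'' : eqt w w' T T' -> eqt w w' T' T'' -> eqt w w' T T''.
Proof.
move=> [tT _ H] [_ tT'' H']; split=> // A B v v' tA tB.
exact: rst_trans (H _ _ _ _ tA tB) (H' _ _ _ _ tA tB).
Qed.

Lemma eqt_ctx w w' s t A T T' B : eqt s t T T' -> typed w A s -> typed t B w' ->
  eqt w w' (A ++ T ++ B) (A ++ T' ++ B).
Proof.
move=> [tT tT' H] tA tB; split=> [||A' B' v v' tA' tB'].
- exact: typed_cat tA (typed_cat tT tB).
- exact: typed_cat tA (typed_cat tT' tB).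
have := H (A' ++ A) (B ++ B') v v' (typed_cat tA' tA) (typed_cat tB tB').
by rewrite -!catA.
Qed.

Lemma eqt_turaev w w' L L' : turaev L L' -> typed w L w' -> eqt w w' L L'.
Proof.
move=> LL' tL; have tL' : typed w L' w'.
  by have := turaev_typed_in [::] [::] w w' LL'; rewrite /= !cats0 => -[/(_ tL)].
split=> // A B v v' tA tB; apply: rst_step.
have tt T : typed w T w' -> is_tangle (triv v :: A ++ T ++ B).
  move=> tT; apply: (typed_tangle (w := v) (w' := v')) => //.
  exact: (typed_cat (triv_typed v) (typed_cat tA (typed_cat tT tB))).
exact: (@TangleStep (triv v :: A) B L L' LL' (tt _ tL) (tt _ tL')).
Qed.

Lemma eqt_triv w : eqt w w [:: triv w] [::].
Proof.
split; [exact: triv_typed|exact/eqP|] => A B v v' tA tB; apply: rst_step.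
have tvA : typed v (triv v :: A) w := typed_cat (triv_typed v) tA.
(* [triv v :: A] is a tangle even when [A] is empty, so it absorbs the trivial tangle on top of it
   by [T1top]. *)
have := @TangleStep [::] B _ _ (T1top (typed_tangle (isT : ~~ nilp (triv v :: A)) tvA)).
rewrite -(typed_target (isT : ~~ nilp (triv v :: A)) tvA) /= -catA; apply.
- apply: (@typed_tangle v _ v') => //.
  exact: (typed_cat (typed_cat (triv_typed v) tA) (typed_cat (triv_typed w) tB)).
- apply: (@typed_tangle v _ v') => //.
  exact: (typed_cat (typed_cat (triv_typed v) tA) tB).
Qed.

Lemma isotopic_triv w T w' : typed w T w' -> ~~ nilp T -> isotopic (triv w :: T) T.
Proof.
move=> tT T0; apply: rst_step.
have := @TangleStep [::] [::] _ _ (T1bottom (typed_tangle T0 tT)).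
rewrite -(typed_source T0 tT) /= cats0; apply; last exact: typed_tangle T0 tT.
apply: (@typed_tangle w _ w') => //; exact: (typed_cat (triv_typed w) tT).
Qed.

Lemma eqt_isotopic w w' T T' : eqt w w' T T' -> ~~ nilp T -> ~~ nilp T' -> isotopic T T'.
Proof.
move=> [tT tT' H] T0 T0'.
have := H [::] [::] w w' (eqxx _) (eqxx _); rewrite /= !cats0 => E.
apply: rst_trans (isotopic_triv tT' T0'); apply: rst_trans E.
exact/rst_sym/(isotopic_triv tT T0).
Qed.

(** [T3] concerns two tangles side by side: [u] and [x] are first absorbed into the left one and [v]
    into the right one. Empty sequences are not tangles and are treated apart. *)
Lemma eqt_comm s s' t t' S T u x v : typed s S s' -> typed t T t' ->
  eqt (u ++ s ++ x ++ t ++ v) (u ++ s' ++ x ++ t' ++ v)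
    (pad u S (x ++ t ++ v) ++ pad (u ++ s' ++ x) T v)
    (pad (u ++ s ++ x) T v ++ pad u S (x ++ t' ++ v)).
Proof.
move=> tS tT; case: S tS => [/eqP <-|g S tS].
  by rewrite cats0; apply: eqt_refl; have := @typed_pad (u ++ s ++ x) T v _ _ tT; rewrite -!catA.
case: T tT => [/eqP <-|h T tT].
  by rewrite cats0; apply: eqt_refl; exact: typed_pad.
set S0 := g :: S in tS *; set T0 := h :: T in tT *.
have tS' : typed (u ++ s ++ x) (pad u S0 x) (u ++ s' ++ x) by exact: typed_pad.
have tT' : typed (t ++ v) (pad [::] T0 v) (t' ++ v) by exact: (@typed_pad [::]).
have nS : ~~ nilp (pad u S0 x) by [].
have nT : ~~ nilp (pad [::] T0 v) by [].
have := T3 (typed_tangle nS tS') (typed_tangle nT tT').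
rewrite -(typed_source nS tS') -(typed_target nS tS') -(typed_source nT tT') -(typed_target nT tT').
rewrite !pad_pad !cats0 !cat0s => /eqt_turaev; apply.
have H : typed (u ++ s ++ x ++ t ++ v) (pad u S0 (x ++ t ++ v)) (u ++ s' ++ x ++ t ++ v).
  exact: typed_pad.
apply: typed_cat H _.
by have := @typed_pad (u ++ s' ++ x) T0 v _ _ tT; rewrite -!catA.
Qed.

Lemma eqt_zig1 u o v :
  eqt (u ++ [:: o] ++ v) (u ++ [:: o] ++ v)
    [:: Cup (u ++ [:: o]) (~~ o) v; Cap u o ([:: o] ++ v)] [::].
Proof.
have E : ftarget (Cup (u ++ [:: o]) (~~ o) v) = fsource (Cap u o ([:: o] ++ v)).
  by rewrite /= -catA negbK.
apply: eqt_trans (eqt_triv _); rewrite catA.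
apply: eqt_turaev; first by apply: T5 E; right; rewrite size_cat addn1.
by rewrite /typed E !eqxx /= -catA.
Qed.

Lemma eqt_zig2 u o v :
  eqt (u ++ [:: o] ++ v) (u ++ [:: o] ++ v)
    [:: Cup u o ([:: o] ++ v); Cap (u ++ [:: o]) (~~ o) v] [::].
Proof.
have E : ftarget (Cup u o ([:: o] ++ v)) = fsource (Cap (u ++ [:: o]) (~~ o) v).
  by rewrite /= -catA negbK.
apply: eqt_trans (eqt_triv _).
apply: eqt_turaev; first by apply: T5 E; left; rewrite size_cat addn1.
by rewrite /typed E !eqxx /= -catA.
Qed.

(** For a tangle from one strand to one strand, both cables in [T4] are the braid itself. *)
Lemma eqt_slide o u v n (b : pro (braid n)) (eps : n.-tuple bool) (j : 'I_n) u' v' P :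
  eps = u ++ [:: o] ++ v :> seq bool -> pro_perm b j = size u :> nat ->
  ftarget (Braid b eps) = u' ++ [:: o] ++ v' -> size u' = j ->
  typed [:: o] P [:: o] ->
  eqt (u ++ [:: o] ++ v) (u' ++ [:: o] ++ v')
    (pad u P v ++ [:: Braid b eps]) ([:: Braid b eps] ++ pad u' P v').
Proof.
move=> eE bj bt uj tP.
have tb : typed (u ++ [:: o] ++ v) [:: Braid b eps] (u' ++ [:: o] ++ v').
  by rewrite /typed bt eqxx andbT; apply/eqP; rewrite /= eE.
case: (boolP (nilp P)) => [/nilP ->|nP]; first exact: eqt_refl.
have nE : n = (size u + (1 + size v))%N by rewrite -(size_tuple eps) eE !size_cat.
move: b eps j eE bj bt uj tb; rewrite nE => b eps j eE bj bt uj tb.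
have epsE : eps = word3 u [:: o] v by apply: val_inj.
rewrite {}epsE {eE eps} in bt tb *.
have bj' : pro_perm b j = pro_perm b j by [].
have := @T4 P u o v u' v' b (pro_perm b j) j (typed_tangle nP tP) bj (esym uj) erefl bt.
rewrite -(typed_source nP tP) -(typed_target nP tP) /= pro_ext_cable1 => /eqt_turaev; apply.
exact: typed_cat (typed_pad u v tP) tb.
Qed.

End LocalIsotopy.

Lemma eqt_ctxE w w' s t A T T' B Z Z' : eqt s t T T' -> typed w A s -> typed t B w' ->
  Z = A ++ T ++ B -> Z' = A ++ T' ++ B -> eqt w w' Z Z'.
Proof. by move=> TT' tA tB -> ->; exact: eqt_ctx TT' tA tB. Qed.

Lemma typed_padE s s' Q u v w w' : typed s Q s' -> w = u ++ s ++ v -> w' = u ++ s' ++ v ->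
  typed w (pad u Q v) w'.
Proof. by move=> tQ -> ->; exact: typed_pad. Qed.

Lemma typed1 g w w' : fsource g = w -> ftarget g = w' -> typed w [:: g] w'.
Proof. by move=> /= -> ->; rewrite !eqxx. Qed.

Lemma typed2 g h T w r w' : typed w [:: g] r -> typed r (h :: T) w' ->
  typed w (g :: h :: T) w'.
Proof. exact: (@typed_cat _ [:: g]). Qed.

Lemma typed0 w w' : w = w' -> typed w [::] w'.
Proof. by move=> ->; rewrite /= eqxx. Qed.

Ltac word_eq := first [reflexivity | by rewrite /= ?negbK -?catA /= ?cats0].
Ltac typing := first
  [ eassumption
  | eapply typed_cat; [typing | typing]
  | eapply typed_padE; [eassumption | word_eq | word_eq]
  | eapply typed2; [typing | typing]
  | eapply typed1; [word_eq | word_eq]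
  | eapply typed0; word_eq ].
Ltac list_eq := by rewrite /= -?catA /= ?cats0 ?pad_cat ?pad_pad /= -?catA.

Section Crossing.
Implicit Types (u v : seq bool).

(** Written as a profinite power of exponent 1, the shape that [T6cup] and [T6cap] require. *)
Definition pro_sigma u v : pro (braid (size u + (2 + size v))) :=
  pro_pow (sigma _ (size u)) (pro_in (1%R : zgroup)).

Lemma pro_perm_sigma u v (j : 'I_(size u + (2 + size v))) :
  pro_perm (pro_sigma u v) j = swapn (size u) j :> nat.
Proof.
rewrite /pro_sigma /pro_pow pro_ext_in; last exact: ucont_expgz.
have kn : (size u < (size u + (2 + size v)).-1)%N by lia.
rewrite pro_perm_in braid_permE /expgz /= expg1 (sigmaE kn) botb_pi.
by [].
Qed.

Definition sigma_fund u o v : fund := Braid (pro_sigma u v) (word3 u [:: o; ~~ o] v).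

Lemma ftarget_sigma u o v : ftarget (sigma_fund u o v) = u ++ [:: ~~ o; o] ++ v.
Proof.
apply: (@eq_from_nth _ false) => [|j]; first by rewrite size_ftarget_braid !size_cat.
rewrite size_ftarget_braid => jn; rewrite (nth_ord_image _ jn) (tnth_nth false).
rewrite pro_perm_sigma /= /swapn !nth_cat.
case: (eqVneq j (size u)) => [->|ju]; first by rewrite ltnn subnn ltnNge leqnSn subSnn.
case: (eqVneq j (size u).+1) => [->|ju1].
  by rewrite ltnn subnn ltnNge leqnSn subSnn.
case: ltnP => // uj; have -> : (j - size u = (j - size u).-2.+2)%N by lia.
by [].
Qed.

Lemma typed_sigma u o v :
  typed (u ++ [:: o; ~~ o] ++ v) [:: sigma_fund u o v] (u ++ [:: ~~ o; o] ++ v).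
Proof. by apply: typed1; [|exact: ftarget_sigma]. Qed.

Lemma eqt_cross_cap u o v : eqt (u ++ [:: o; ~~ o] ++ v) (u ++ v)
  ([:: sigma_fund u o v] ++ [:: Cap u (~~ o) v]) [:: Cap u o v].
Proof.
have E : ftarget (sigma_fund u o v) = fsource (Cap u (~~ o) v).
  by rewrite ftarget_sigma /= negbK.
have tS := typed_sigma u o v.
by apply: eqt_turaev (T6cap E) _; typing.
Qed.

Lemma eqt_cross_cup u v : eqt (u ++ v) (u ++ [:: true; false] ++ v)
  ([:: Cup u false v] ++ [:: sigma_fund u false v]) [:: Cup u true v].
Proof.
have E : ftarget (sigma_fund u false v) = ftarget (Cup u true v) by rewrite ftarget_sigma.
have tS := typed_sigma u false v.
by apply: eqt_turaev (T6cup E) _; typing.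
Qed.

Lemma eqt_sigma_left u o v P : typed [:: o] P [:: o] ->
  eqt (u ++ [:: o; ~~ o] ++ v) (u ++ [:: ~~ o; o] ++ v)
    (pad u P ([:: ~~ o] ++ v) ++ [:: sigma_fund u o v])
    ([:: sigma_fund u o v] ++ pad (u ++ [:: ~~ o]) P v).
Proof.
move=> tP; have jn : ((size u).+1 < size u + (2 + size v))%N by lia.
have H1 : pro_perm (pro_sigma u v) (Ordinal jn) = size u :> nat.
  by rewrite pro_perm_sigma /= /swapn ifF ?eqxx //; lia.
have H2 : ftarget (sigma_fund u o v) = (u ++ [:: ~~ o]) ++ [:: o] ++ v.
  by rewrite ftarget_sigma -catA.
have H3 : size (u ++ [:: ~~ o]) = Ordinal jn by rewrite size_cat addn1.
have H0 : word3 u [:: o; ~~ o] v = u ++ [:: o] ++ [:: ~~ o] ++ v :> seq bool by [].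
by have := @eqt_slide o u ([:: ~~ o] ++ v) _ _ _ (Ordinal jn) _ _ _ H0 H1 H2 H3 tP;
  rewrite -!catA.
Qed.

Lemma eqt_sigma_right u o v P : typed [:: ~~ o] P [:: ~~ o] ->
  eqt (u ++ [:: o; ~~ o] ++ v) (u ++ [:: ~~ o; o] ++ v)
    (pad (u ++ [:: o]) P v ++ [:: sigma_fund u o v])
    ([:: sigma_fund u o v] ++ pad u P ([:: o] ++ v)).
Proof.
move=> tP; have jn : (size u < size u + (2 + size v))%N by lia.
have H0 : word3 u [:: o; ~~ o] v = (u ++ [:: o]) ++ [:: ~~ o] ++ v :> seq bool.
  by rewrite -catA.
have H1 : pro_perm (pro_sigma u v) (Ordinal jn) = size (u ++ [:: o]) :> nat.
  by rewrite pro_perm_sigma /= /swapn eqxx size_cat addn1.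
have H2 : ftarget (sigma_fund u o v) = u ++ [:: ~~ o] ++ [:: o] ++ v.
  by rewrite ftarget_sigma.
by have := @eqt_slide (~~ o) (u ++ [:: o]) v _ _ _ (Ordinal jn) _ _ _ H0 H1 H2 erefl tP;
  rewrite -!catA.
Qed.

End Crossing.

Section Rotation.
Variable Q : fseq.
Hypothesis tQ : typed [:: false] Q [:: false].
Implicit Types (u v : seq bool).

(* Q, or its rotation by half a turn when the strand is oriented upwards. *)
Definition rotated (o : bool) : fseq :=
  if o then [:: Cup [:: true] false [::]] ++ pad [:: true] Q [:: true] ++
    [:: Cap [::] true [:: true]] else Q.

Lemma rotated_typed o : typed [:: o] (rotated o) [:: o].
Proof. by case: o => //=; typing. Qed.

Lemma pad_rotated u v : pad u (rotated true) v =
  [:: Cup (u ++ [:: true]) false v] ++ pad (u ++ [:: true]) Q ([:: true] ++ v) ++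
    [:: Cap u true ([:: true] ++ v)].
Proof. by rewrite /rotated /= pad_cat pad_pad /= cats0. Qed.

(** The cap of the half-turn is exchanged with the outer cap and then moved below [Q], where it
    cancels against the cup of the half-turn. *)
Lemma eqt_cap_true u v : eqt (u ++ [:: true; false] ++ v) (u ++ v)
  (pad u (rotated true) ([:: false] ++ v) ++ [:: Cap u true v])
  (pad (u ++ [:: true]) (rotated false) v ++ [:: Cap u true v]).
Proof.
rewrite pad_rotated [rotated false]/=.
have tC : typed [:: true; false] [:: Cap [::] true [::]] [::] by [].
have := eqt_comm u [::] v tC tC; rewrite /= !cats0 => C1.
apply: eqt_trans.
  by apply: (eqt_ctxE (A := [:: Cup (u ++ [:: true]) false ([:: false] ++ v)] ++
    pad (u ++ [:: true]) Q ([:: true] ++ [:: false] ++ v)) (B := [::]) C1);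
    [typing | typing | list_eq | reflexivity].
have C2 := eqt_comm (u ++ [:: true]) [::] v tQ tC; rewrite /= !cats0 in C2.
apply: eqt_trans.
  by apply: (eqt_ctxE (A := [:: Cup (u ++ [:: true]) false ([:: false] ++ v)])
    (B := [:: Cap u true v]) C2); [typing | typing | list_eq | reflexivity].
apply: (eqt_ctxE (A := [::]) (B := pad (u ++ [:: true]) Q v ++ [:: Cap u true v])
  (eqt_zig2 (u ++ [:: true]) false v)); [typing | typing | list_eq | reflexivity].
Qed.

Lemma eqt_cup_false u v : eqt (u ++ v) (u ++ [:: false; true] ++ v)
  ([:: Cup u false v] ++ pad u (rotated false) ([:: true] ++ v))
  ([:: Cup u false v] ++ pad (u ++ [:: false]) (rotated true) v).
Proof.
rewrite pad_rotated [rotated false]/=; apply: eqt_sym.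
have tC : typed [::] [:: Cup [::] false [::]] [:: false; true] by [].
have := eqt_comm u [::] v tC tC; rewrite /= !cats0 => C1.
apply: eqt_trans.
  by apply: (eqt_ctxE (A := [::])
    (B := pad (u ++ [:: false; true]) Q ([:: true] ++ v) ++
          [:: Cap (u ++ [:: false]) true ([:: true] ++ v)]) C1);
    [typing | typing | list_eq | reflexivity].
have C2 := eqt_comm u [::] ([:: true] ++ v) tC tQ; rewrite /= !cats0 in C2.
apply: eqt_trans.
  by apply: (eqt_ctxE (A := [:: Cup u false v])
    (B := [:: Cap (u ++ [:: false]) true ([:: true] ++ v)]) C2);
   [typing | typing | list_eq | reflexivity].
apply: (eqt_ctxE (A := [:: Cup u false v] ++ pad u Q ([:: true] ++ v)) (B := [::])
  (eqt_zig2 u false ([:: true] ++ v))); [typing | typing | list_eq | list_eq].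
Qed.

(** A zigzag alone would produce the opposite half-turn of [Q]. Instead [T6cap] replaces this cap by
    a crossing followed by the other cap; the inserted tangle slides through the crossing, changes
    foot under the other cap, and slides back. *)
Lemma eqt_cap_false u v : eqt (u ++ [:: false; true] ++ v) (u ++ v)
  (pad u (rotated false) ([:: true] ++ v) ++ [:: Cap u false v])
  (pad (u ++ [:: false]) (rotated true) v ++ [:: Cap u false v]).
Proof.
have tR := rotated_typed true; have tC := eqt_cross_cap u false v; have tS := typed_sigma u false v.
have tQ' : typed [:: false] (rotated false) [:: false] by exact: tQ.
apply: eqt_trans.
  by apply: (eqt_ctxE (A := pad u (rotated false) ([:: true] ++ v)) (B := [::]) (eqt_sym tC));
   [typing | typing | list_eq | reflexivity].
apply: eqt_trans.
  by apply: (eqt_ctxE (A := [::]) (B := [:: Cap u true v]) (@eqt_sigma_left u false v _ tQ));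
   [typing | typing | list_eq | reflexivity].
apply: eqt_trans.
  apply: (eqt_ctxE (A := [:: sigma_fund u false v]) (B := [::]) (eqt_sym (eqt_cap_true u v)));
   [typing | typing | list_eq | reflexivity].
apply: eqt_trans.
  by apply: (eqt_ctxE (A := [::]) (B := [:: Cap u true v]) (eqt_sym (@eqt_sigma_right u false v _ tR)));
   [typing | typing | list_eq | reflexivity].
by apply: (eqt_ctxE (A := pad (u ++ [:: false]) (rotated true) v) (B := [::]) tC);
  [typing | typing | list_eq | reflexivity].
Qed.

Lemma eqt_cup_true u v : eqt (u ++ v) (u ++ [:: true; false] ++ v)
  ([:: Cup u true v] ++ pad u (rotated true) ([:: false] ++ v))
  ([:: Cup u true v] ++ pad (u ++ [:: true]) (rotated false) v).
Proof.
have tR := rotated_typed true; have tC := eqt_cross_cup u v; have tS := typed_sigma u false v.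
have tQ' : typed [:: false] (rotated false) [:: false] by exact: tQ.
apply: eqt_sym; apply: eqt_trans.
  by apply: (eqt_ctxE (A := [::]) (B := pad (u ++ [:: true]) (rotated false) v) (eqt_sym tC));
   [typing | typing | list_eq | reflexivity].
apply: eqt_trans.
  by apply: (eqt_ctxE (A := [:: Cup u false v]) (B := [::]) (eqt_sym (@eqt_sigma_left u false v _ tQ)));
   [typing | typing | list_eq | reflexivity].
apply: eqt_trans.
  apply: (eqt_ctxE (A := [::]) (B := [:: sigma_fund u false v]) (eqt_cup_false u v));
   [typing | typing | list_eq | reflexivity].
apply: eqt_trans.
  by apply: (eqt_ctxE (A := [:: Cup u false v]) (B := [::]) (@eqt_sigma_right u false v _ tR));
   [typing | typing | list_eq | reflexivity].
by apply: (eqt_ctxE (A := [::]) (B := pad u (rotated true) ([:: false] ++ v)) tC);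
  [typing | typing | list_eq | reflexivity].
Qed.

Lemma eqt_cap u o v : eqt (u ++ [:: o; ~~ o] ++ v) (u ++ v)
  (pad u (rotated o) ([:: ~~ o] ++ v) ++ [:: Cap u o v])
  (pad (u ++ [:: o]) (rotated (~~ o)) v ++ [:: Cap u o v]).
Proof. by case: o; [exact: eqt_cap_true | exact: eqt_cap_false]. Qed.

Lemma eqt_cup u o v : eqt (u ++ v) (u ++ [:: o; ~~ o] ++ v)
  ([:: Cup u o v] ++ pad u (rotated o) ([:: ~~ o] ++ v))
  ([:: Cup u o v] ++ pad (u ++ [:: o]) (rotated (~~ o)) v).
Proof. by case: o; [exact: eqt_cup_true | exact: eqt_cup_false]. Qed.

End Rotation.

(** * Insertion of a long knot *)

Lemma cat_inj (T : Type) (A A' B B' : seq T) :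
  size A = size A' -> A ++ B = A' ++ B' -> A = A' /\ B = B'.
Proof.
elim: A A' => [|a A IH] [|a' A'] //= [sA] [-> E].
by have [-> ->] := IH _ sA E.
Qed.

Section Insertion.
Variable Q : fseq.
Hypothesis tQ : typed [:: false] Q [:: false].
Implicit Types (u v w : seq bool) (T Z : fseq) (x y : nat * nat).

Definition pin w j : fseq := pad (take j w) (rotated Q (nth false w j)) (drop j.+1 w).

Lemma word_split w j : (j < size w)%N -> w = take j w ++ [:: nth false w j] ++ drop j.+1 w.
Proof. by move=> jw; rewrite /= -drop_nth // cat_take_drop. Qed.

Lemma typed_pin w j : (j < size w)%N -> typed w (pin w j) w.
Proof.
move=> jw; exact: typed_padE (rotated_typed tQ _) (word_split jw) (word_split jw).
Qed.

Lemma pin_cat u o v : pin (u ++ [:: o] ++ v) (size u) = pad u (rotated Q o) v.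
Proof.
rewrite /pin take_size_cat // nth_cat ltnn subnn /=; congr pad.
by rewrite -cat_rcons drop_size_cat ?size_rcons.
Qed.

Lemma pin_catl u v j : (j < size u)%N ->
  pin (u ++ v) j = pad (take j u) (rotated Q (nth false u j)) (drop j.+1 u ++ v).
Proof.
move=> ju; rewrite /pin take_cat ju nth_cat ju drop_cat.
case: ltnP => // uj; have -> : j.+1 = size u by lia.
by rewrite subnn drop0 drop_size.
Qed.

Lemma pin_catr u v j : (size u <= j)%N ->
  pin (u ++ v) j = pad (u ++ take (j - size u) v) (rotated Q (nth false v (j - size u)))
    (drop (j - size u).+1 v).
Proof.
move=> uj; rewrite /pin take_cat ltnNge uj nth_cat ltnNge uj drop_cat.
by rewrite ltnNge (leq_trans uj) //= subSn.
Qed.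

Definition arc_ins (g : fund) x : fseq :=
  if x.1 is 0 then pin (fsource g) x.2 ++ [:: g] else [:: g] ++ pin (ftarget g) x.2.

(** One slide along one edge: through a braid by [T4], around a cap or a cup with a half-turn, and
    past a cap or a cup standing beside the strand by [T3]. *)
Lemma arc_eqt g x y : Defs.arc g x y ->
  eqt (fsource g) (ftarget g) (arc_ins g x) (arc_ins g y).
Proof.
have tR := rotated_typed tQ.
case=> [n b eps j|u o v|u o v j ju|u o v j juv|u o v|u o v j ju|u o v j juv]; rewrite /arc_ins /=.
- have it : (pro_perm b j < size (tval eps))%N by rewrite size_tuple.
  have jt : (j < size (ftarget (Braid b eps)))%N by rewrite size_ftarget_braid.
  have Es := word_split it; have Et := word_split jt.
  have En : nth false (ftarget (Braid b eps)) j = nth false eps (pro_perm b j).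
    by rewrite (nth_ord_image _ (ltn_ord j)) (tnth_nth false); congr nth; congr (nat_of_ord (pro_perm b _)); apply: val_inj.
  rewrite En in Et.
  have H1 : pro_perm b j = size (take (pro_perm b j) eps) :> nat by rewrite size_takel // ltnW.
  have H2 : size (take j (ftarget (Braid b eps))) = j by rewrite size_takel // ltnW.
  have := eqt_slide Es H1 Et H2 (tR _); rewrite -Es -Et /pin => H.
  by rewrite -[in X in eqt _ _ _ X]En in H.
- rewrite pin_cat.
  have := pin_cat (u ++ [:: o]) (~~ o) v; rewrite size_cat addn1 -catA => ->.
  exact: eqt_cap.
- rewrite pin_catl // pin_catl //.
  have tC : typed [:: o; ~~ o] [:: Cap [::] o [::]] [::] by rewrite /= !eqxx.
  have := eqt_comm (take j u) (drop j.+1 u) v (tR (nth false u j)) tC.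
  have E := word_split ju; rewrite /= in E.
  have E' z : take j u ++ nth false u j :: drop j.+1 u ++ z = u ++ z.
    by rewrite [in RHS]E -catA.
  by rewrite /= !cats0 !E' -E.
- case/andP: juv => uj juv.
  rewrite pin_catr ?pin_catr //; last by lia.
  have -> : (j.+2 - size u = (j - size u).+2)%N by lia.
  have jv : (j - size u < size v)%N by lia.
  have tC : typed [:: o; ~~ o] [:: Cap [::] o [::]] [::] by rewrite /= !eqxx.
  have := eqt_comm u (take (j - size u) v) (drop (j - size u).+1 v) tC (tR (nth false v (j - size u))).
  have E := word_split jv; rewrite /= in E.
  by rewrite /= -E !cats0 => /eqt_sym.
- rewrite pin_cat.
  have := pin_cat (u ++ [:: o]) (~~ o) v; rewrite size_cat addn1 -catA => ->.
  exact: eqt_cup.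
- rewrite pin_catl // pin_catl //.
  have tC : typed [::] [:: Cup [::] o [::]] [:: o; ~~ o] by rewrite /= !eqxx.
  have := eqt_comm (take j u) (drop j.+1 u) v (tR (nth false u j)) tC.
  have E := word_split ju; rewrite /= in E.
  have E' z : take j u ++ nth false u j :: drop j.+1 u ++ z = u ++ z.
    by rewrite [in RHS]E -catA.
  by rewrite /= !cats0 !E' -E.
- case/andP: juv => uj juv.
  rewrite pin_catr ?pin_catr //; last by lia.
  have -> : (j.+2 - size u = (j - size u).+2)%N by lia.
  have jv : (j - size u < size v)%N by lia.
  have tC : typed [::] [:: Cup [::] o [::]] [:: o; ~~ o] by rewrite /= !eqxx.
  have := eqt_comm u (take (j - size u) v) (drop (j - size u).+1 v) tC (tR (nth false v (j - size u))).
  have E := word_split jv; rewrite /= in E.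
  by rewrite /= -E !cats0 => /eqt_sym.
Qed.

(* Z is T with the long knot Q, or its rotation, inserted at the vertex x. *)
Definition isins T x Z : Prop := exists A B w,
  [/\ T = A ++ B, size A = x.1, typed [::] A w, typed w B [::] &
      (x.2 < size w)%N /\ Z = A ++ pin w x.2 ++ B].

Lemma isins_uniq T x Z Z' : isins T x Z -> isins T x Z' -> Z = Z'.
Proof.
move=> [A [B [w [-> sA tA _ [_ ->]]]]] [A' [B' [w' [E sA' tA' _ [_ ->]]]]].
have [AA' BB'] := cat_inj (etrans sA (esym sA')) E.
by subst A' B'; rewrite (typed_uniq tA tA').
Qed.

Lemma isins_typed T x Z : isins T x Z -> typed [::] Z [::].
Proof.
move=> [A [B [w [_ _ tA tB [xw ->]]]]].
exact: typed_cat tA (typed_cat (typed_pin xw) tB).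
Qed.

Lemma isins_ex T x : typed [::] T [::] -> skel_vertex T x -> exists Z, isins T x Z.
Proof.
case: x => i j tT [A [g [B [TE /= [[-> jw]|[-> jw]]]]]].
- have [w [tA tB]] : exists w, typed [::] A w /\ typed w (g :: B) [::].
    by apply: typed_split; rewrite -TE.
  exists (A ++ pin w j ++ g :: B), A, (g :: B), w; split=> //; split=> //=.
  by case/andP: tB => /eqP <-.
- rewrite -cat_rcons in TE; have [w [tA tB]] : exists w, typed [::] (rcons A g) w /\ typed w B [::].
    by apply: typed_split; rewrite -TE.
  exists (rcons A g ++ pin w j ++ B), (rcons A g), B, w; split; rewrite ?size_rcons //; split=> //=.
  move: tA; rewrite -cats1 => /typed_split [r [_]].
  by rewrite /= => /andP[_ /eqP <-].
Qed.

Lemma isins_edge T x y : typed [::] T [::] -> skel_edge T x y ->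
  forall Z Z', isins T x Z -> isins T y Z' -> eqt [::] [::] Z Z'.
Proof.
move=> tT [A g B x' y' TE gxy] Z Z' iZ iZ'.
have [w [tA tgB]] : exists w, typed [::] A w /\ typed w (g :: B) [::].
  by apply: typed_split; rewrite -TE.
have /andP[/eqP gw tB] := tgB.
have key z W : isins T ((size A + z.1)%N, z.2) W ->
    (z.1 <= 1)%N -> W = A ++ arc_ins g z ++ B.
  move=> iW z1; case: z iW z1 => [[|[|k]] j] //= iW _; apply: isins_uniq (iW) _.
    case: iW => [A' [B' [r [E sA' tA' _ [jr _]]]]]; rewrite addn0 in sA'.
    have [AA' _] : A' = A /\ B' = g :: B by apply: cat_inj; rewrite // -E.
    exists A, (g :: B), w; split; rewrite ?addn0 //; split.
      by move: jr; rewrite AA' in tA'; rewrite (typed_uniq tA tA').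
    by rewrite /arc_ins /= gw -catA.
  case: iW => [A' [B' [r [E sA' tA' _ [jr _]]]]]; rewrite /= addn1 in sA'.
  have [AA' _] : A' = rcons A g /\ B' = B.
    by apply: cat_inj; rewrite ?size_rcons // -E TE cat_rcons.
  have tAg : typed [::] (rcons A g) (ftarget g).
    by rewrite -cats1; apply: typed_cat tA _; rewrite /= gw !eqxx.
  exists (rcons A g), B, (ftarget g); split; rewrite ?size_rcons ?addn1 ?cat_rcons //; split.
    by move: jr; rewrite AA' in tA'; rewrite (typed_uniq tAg tA').
  by rewrite /arc_ins /= ?cat_rcons.
have [x1 y1] : (x'.1 <= 1)%N /\ (y'.1 <= 1)%N by case: gxy.
rewrite (key _ _ iZ) // (key _ _ iZ') //; apply: eqt_ctx tA tB.
by rewrite -gw; exact: arc_eqt.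
Qed.

Lemma isins_vertex T x Z : isins T x Z -> typed [::] T [::] -> ~~ nilp T -> skel_vertex T x.
Proof.
move=> [A [B [w [-> sA tA tB [xw _]]]]] tT T0; apply/(skel_vertexE x tT T0).
by rewrite -sA (width_cat B [::] tA).
Qed.

(** A path in the skeleton is a chain of slides along edges, so in a knot all places of insertion
    are equivalent. *)
Lemma isins_connected T x y Z Z' : typed [::] T [::] -> ~~ nilp T -> count_col F2 T = 2 ->
  isins T x Z -> isins T y Z' -> eqt [::] [::] Z Z'.
Proof.
move=> tT T0 cT iZ iZ'.
have [_ conn] := (connected_count tT T0).2 cT.
have := conn _ _ (isins_vertex iZ tT T0) (isins_vertex iZ' tT T0).
move=> xy; move: Z Z' iZ iZ'.
(* A path may follow edges backwards, and its intermediate vertices come without an insertion;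
   transporting insertions in both directions makes the induction go through. *)
suff : (forall Z, isins T x Z -> exists2 Z', isins T y Z' & eqt [::] [::] Z Z') /\
       (forall Z', isins T y Z' -> exists2 Z, isins T x Z & eqt [::] [::] Z Z').
  by case=> H _ Z Z' /H [Z'' iZ'' E] iZ'; rewrite (isins_uniq iZ' iZ'').
have vx z z' : skel_edge T z z' -> skel_vertex T z /\ skel_vertex T z'.
  move=> [A g B p q TE gpq]; split; exists A, g, B; split=> //; move: gpq; clear;
    case=> [n b eps j|u o v|u o v j ju|u o v j juv|u o v|u o v j ju|u o v j juv] /=;
    rewrite ?size_map -?enumT ?size_enum_ord ?size_tuple ?size_cat /= ?addn0 ?addn1;
    first [left; split; [by []|lia] | right; split; [by []|lia]
          | left; split; [by []|exact: ltn_ord] | right; split; [by []|exact: ltn_ord]].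
elim: xy => [z z' zz'|z|z z' _ [IH1 IH2]|z z' z'' _ [IH1 IH2] _ [IH3 IH4]].
- have [vz vz'] := vx _ _ zz'; split=> Z iZ.
    by have [Z' iZ'] := isins_ex tT vz'; exists Z' => //; exact: isins_edge tT zz' _ _ iZ iZ'.
  by have [Z' iZ'] := isins_ex tT vz; exists Z' => //; exact: isins_edge tT zz' _ _ iZ' iZ.
- by split=> Z iZ; exists Z => //; apply: eqt_refl; exact: isins_typed iZ.
- split=> Z iZ; [have [Z' iZ' E] := IH2 _ iZ | have [Z' iZ' E] := IH1 _ iZ];
    by exists Z' => //; exact: eqt_sym.
- split=> Z iZ.
    have [Z' iZ' E] := IH1 _ iZ; have [Z'' iZ'' E'] := IH3 _ iZ'.
    by exists Z'' => //; exact: eqt_trans E E'.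
  have [Z' iZ' E] := IH4 _ iZ; have [Z'' iZ'' E'] := IH2 _ iZ'.
  by exists Z'' => //; exact: eqt_trans E' E.
Qed.

Lemma isins_ctx A T B x Z : typed [::] A [::] -> typed [::] B [::] -> isins T x Z ->
  isins (A ++ T ++ B) ((size A + x.1)%N, x.2) (A ++ Z ++ B).
Proof.
move=> tA tB [A' [B' [w [-> sA' tA' tB' [xw ->]]]]].
exists (A ++ A'), (B' ++ B), w; split; rewrite ?size_cat ?sA' -?catA //.
- exact: typed_cat tA tA'.
- exact: typed_cat tB' tB.
Qed.

Lemma isins_cat S T x Z : typed [::] S [::] -> typed [::] T [::] -> isins (S ++ T) x Z ->
  (exists2 Z', isins S x Z' & Z = Z' ++ T) \/
  (exists y Z', isins T y Z' /\ Z = S ++ Z').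
Proof.
move=> tS tT [A [B [w [E sA tA tB [xw ->]]]]].
case: (leqP (size A) (size S)) => AS; [left|right].
- have [S' [SE BE]] : exists S', S = A ++ S' /\ B = S' ++ T.
    have [AE BE] : A = take (size A) S /\ B = drop (size A) S ++ T.
      apply: cat_inj; first by rewrite size_takel.
      by rewrite catA cat_take_drop E.
    by exists (drop (size A) S); rewrite {1}AE cat_take_drop.
  exists (A ++ pin w x.2 ++ S'); last by rewrite BE -!catA.
  exists A, S', w; split=> //; rewrite SE in tS.
  have [r [tA' tS']] := typed_split tS.
  by rewrite (typed_uniq tA tA').
- have [T' [TE AE]] : exists T', T = T' ++ B /\ A = S ++ T'.
    have [SE TE] : S = take (size S) A /\ T = drop (size S) A ++ B.
      apply: cat_inj; first by rewrite size_takel // ltnW.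
      by rewrite catA cat_take_drop E.
    by exists (drop (size S) A); rewrite {2}SE cat_take_drop.
  exists (size T', x.2), (T' ++ pin w x.2 ++ B); split; last by rewrite AE -catA.
  exists T', B, w; split=> //; rewrite AE in tA.
  have [r [tS' tT']] := typed_split tA.
  by rewrite (typed_uniq tS tS').
Qed.

Lemma isins1 g x Z : typed [::] [:: g] [::] -> ~ isins [:: g] x Z.
Proof.
move=> tg [[|g' [|g'' A]] [B [w [E _ tA _ [xw _]]]]] //.
- by move/eqP: tA xw => <-.
- case: E tA => <- _ tA.
  by rewrite -(typed_uniq tg tA) in xw.
Qed.

Lemma isins_neq0 T x Z : isins T x Z -> ~~ nilp T -> ~~ nilp Z.
Proof.
move=> [A [B [w [-> _ _ _ [_ ->]]]]]; apply: contraNN.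
by rewrite /nilp !size_cat !addn_eq0 => /and3P[-> _ ->].
Qed.

(** A move between closed sequences offers no boundary strand for the insertion. Closedness excludes
    [T5], [T6cup] and [T6cap], and braids on no strands leave no place to insert. In the other moves
    the insertion lies inside a tangle that the move takes as a parameter, and the same kind of move
    applies to the modified tangle. *)
Lemma turaev_ins L L' x Z : turaev L L' -> typed [::] L [::] -> isins L x Z ->
  exists y Z', isins L' y Z' /\ eqt [::] [::] Z Z'.
Proof.
have nil_cat s t : [::] = s ++ t :> seq bool -> s = [::] /\ t = [::].
  by case: s; case: t.
case=> [T tT|T tT|n b1 b2 e1 e2 e12|S T tS tT|T u o v u' v' b i j tT iu ju bj bt|
  u o v u' o' v' uu' bt|u o v o' c b bt|u o v o' c b bt] tL iL.
- have [r [tTr tr]] := typed_split tL.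
  have rE := typed_target (tangle_neq0 tT) tTr; rewrite {r}rE in tTr tr.
  have r0 : target T = [::] := typed_uniq (triv_typed _) tr.
  rewrite r0 in tr tTr iL tL *.
  have [[Z' iZ' ->]|[y [Z' [/(isins1 tr)]]]] // := isins_cat tTr tr iL.
  exists x, Z'; split=> //.
  have := eqt_ctx (eqt_triv [::]) (isins_typed iZ') (eqxx _ : typed [::] [::] [::]).
  by rewrite /= cats0.
- have r0 : source T = [::] := esym (typed_source (isT : ~~ nilp (triv _ :: T)) tL).
  rewrite r0 in tL iL *.
  have tr := triv_typed [::].
  have tT' : typed [::] T [::].
    have [r [t1 t2]] := @typed_split _ [:: _] _ _ tL.
    by rewrite (typed_uniq t1 tr) in t2.
  have [[Z' /(isins1 tr)]|[y [Z' [iZ' ->]]]] // := @isins_cat [:: _] T x Z tr tT' iL.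
  exists y, Z'; split=> //.
  exact: (@eqt_ctx [::] [::] [::] [::] [::] _ _ Z' (eqt_triv [::]) (eqxx _) (isins_typed iZ')).
- have [r [t1 t2]] := @typed_split _ [:: _] _ _ tL.
  have n0 : n = 0%N.
    by rewrite -(size_tuple e1) (esym (typed_source (isT : ~~ nilp [:: _]) t1) : tval e1 = [::]).
  have r0 : r = [::].
    apply/size0nil; rewrite (typed_target (isT : ~~ nilp [:: _]) t1).
    by rewrite [target _]/(ftarget (Braid b1 e1)) size_ftarget_braid.
  rewrite r0 in t1 t2.
  by have [[Z' /(isins1 t1)]|[y [Z' [/(isins1 t2)]]]] := @isins_cat [:: _] [:: _] x Z t1 t2 iL.
- have nS := tangle_neq0 tS; have nT := tangle_neq0 tT.
  have tS' := tangle_typed tS; have tT' := tangle_typed tT.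
  have [r [t1 t2]] := typed_split tL.
  have [sS sT] : source S = [::] /\ source T = [::].
    have nP : ~~ nilp (pad [::] S (source T)) by rewrite nilp_pad.
    apply: nil_cat; apply: etrans (typed_source nP t1) _.
    exact/esym/(typed_source nP)/(@typed_pad [::] _ _ _ _ tS').
  have [eS eT] : target S = [::] /\ target T = [::].
    have nP : ~~ nilp (pad (target S) T [::]) by rewrite nilp_pad.
    apply: nil_cat; apply: etrans (typed_target nP t2) _.
    have := @typed_pad (target S) T [::] _ _ tT'; rewrite !cats0 => t3.
    exact/esym/(typed_target nP t3).
  rewrite sS sT eS eT !pad_nil in tS' tT' iL *.
  have C := @eqt_comm [::] [::] [::] [::] _ _ [::] [::] [::].
  have [[Z' iZ' ->]|[y [Z' [iZ' ->]]]] := isins_cat tS' tT' iL.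
  + exists ((size T + x.1)%N, x.2), (T ++ Z'); split.
      by have := isins_ctx tT' (eqxx _ : typed [::] [::] [::]) iZ'; rewrite !cats0.
    by have := C _ _ (isins_typed iZ') tT'; rewrite /= !pad_nil.
  + exists y, (Z' ++ S); split.
      by have := isins_ctx (eqxx _ : typed [::] [::] [::]) tS' iZ'; case: (y).
    by have := C _ _ tS' (isins_typed iZ'); rewrite /= !pad_nil.
- have nT := tangle_neq0 tT; have tT' := tangle_typed tT.
  have [r [t1 t2]] := typed_split tL.
  have [u0 /esym/nil_cat[sT v0]] : u = [::] /\ source T ++ v = [::].
    have nP : ~~ nilp (pad u T v) by rewrite nilp_pad.
    apply: nil_cat; apply: etrans (typed_source nP t1) _.
    exact/esym/(typed_source nP)/(typed_pad u v tT').
  have eT : target T = [::].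
    have := congr1 size (typed_target (isT : ~~ nilp [:: _]) t2 : [::] = ftarget (Braid _ _)).
    by rewrite size_ftarget_braid /= => E; apply/size0nil; lia.
  have [u0' v0'] : u' = [::] /\ v' = [::].
    have := congr1 size bt; rewrite size_ftarget_braid !size_cat u0 v0 /= => E.
    by split; apply/size0nil; lia.
  subst u v u' v'; rewrite !pad_nil in t1 iL tL *.
  rewrite sT eT in tT'.
  have r0 := typed_uniq t1 tT'; rewrite r0 in t2.
  have [[Z' iZ' ->]|[y [Z' [/(isins1 t2)]]]] // := isins_cat tT' t2 iL.
  have tZ := isins_typed iZ'; have nZ := isins_neq0 iZ' nT.
  have := T4 (typed_tangle nZ tZ) iu ju bj bt.
  rewrite -(typed_source nZ tZ) -(typed_target nZ tZ) !pad_nil => tu.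
  rewrite sT eT in t2 iL tL *.
  have E := eqt_turaev tu (typed_cat tZ t2); have [_ tZb _] := E.
  have [r' [t3 t4]] := @typed_split _ [:: _] _ _ tZb.
  have r'0 : r' = [::] := etrans (typed_source nZ t4) (esym (typed_source nZ tZ)).
  rewrite r'0 in t3.
  have tn : typed [::] [::] [::] by [].
  have := isins_ctx t3 tn iZ'; rewrite !cats0 => iR.
  by eexists; eexists; split; [exact: iR | exact: E].
- have := typed_source (isT : ~~ nilp (_ :: _)) tL; rewrite /= => /nil_cat [u0 v0].
  move: bt uu'; rewrite u0 v0 /= => /(congr1 size); rewrite size_cat /=; lia.
- have := typed_target (isT : ~~ nilp (_ :: _)) tL; rewrite /= => /(congr1 size).
  by rewrite size_map size_enum_ord /=; lia.
- have := typed_source (isT : ~~ nilp (_ :: _)) tL; rewrite /= => /(congr1 size).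
  by rewrite size_cat /=; lia.
Qed.

(** If the part being replaced has a strand at its bottom or top, the knot is inserted there,
    outside the move. Otherwise that part is closed, and the insertion is either in the
    surroundings, which the move leaves alone, or handled by [turaev_ins]. *)
Lemma step_ins A L L' B x Z s t : turaev L L' -> typed [::] A s -> typed s L t ->
  typed t B [::] -> isins (A ++ L ++ B) x Z ->
  exists y y' Z1 Z2, [/\ isins (A ++ L ++ B) y Z1, isins (A ++ L' ++ B) y' Z2 &
    eqt [::] [::] Z1 Z2].
Proof.
move=> LL' tA tL tB iZ; have E := eqt_turaev LL' tL; have [_ tL' _] := E.
case: s tA tL tL' E => [|a s] tA tL tL' E; last first.
  exists (size A, 0%N), (size A, 0%N), (A ++ pin (a :: s) 0 ++ L ++ B),
    (A ++ pin (a :: s) 0 ++ L' ++ B); split.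
  - by exists A, (L ++ B), (a :: s); split=> //; exact: typed_cat tL tB.
  - by exists A, (L' ++ B), (a :: s); split=> //; exact: typed_cat tL' tB.
  - rewrite !(catA A); apply: eqt_ctx E _ tB.
    exact: typed_cat tA (@typed_pin (a :: s) 0 isT).
case: t tB tL tL' E => [|a t] tB tL tL' E; last first.
  exists (size (A ++ L), 0%N), (size (A ++ L'), 0%N), ((A ++ L) ++ pin (a :: t) 0 ++ B),
    ((A ++ L') ++ pin (a :: t) 0 ++ B); split.
  - exists (A ++ L), B, (a :: t); split=> //; rewrite ?catA //; exact: typed_cat tA tL.
  - exists (A ++ L'), B, (a :: t); split=> //; rewrite ?catA //; exact: typed_cat tA tL'.
  - rewrite -!(catA A); apply: eqt_ctx E tA _.
    exact: typed_cat (@typed_pin (a :: t) 0 isT) tB.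
have tn : typed [::] [::] [::] by [].
have [[Z' iZ' _]|[y [Z' [iZ' _]]]] := isins_cat tA (typed_cat tL tB) iZ.
- exists x, x, (Z' ++ L ++ B), (Z' ++ L' ++ B); split.
  + by have := isins_ctx tn (typed_cat tL tB) iZ'; case: (x).
  + by have := isins_ctx tn (typed_cat tL' tB) iZ'; case: (x).
  + exact: eqt_ctx E (isins_typed iZ') tB.
have [[Z'' iZ'' _]|[y' [Z'' [iZ'' _]]]] := isins_cat tL tB iZ'.
- have [y2 [Z2 [iZ2 E2]]] := turaev_ins LL' tL iZ''.
  exists ((size A + y.1)%N, y.2), ((size A + y2.1)%N, y2.2), (A ++ Z'' ++ B), (A ++ Z2 ++ B).
  split; [exact: isins_ctx | exact: isins_ctx | exact: eqt_ctx E2 tA tB].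
- exists ((size (A ++ L) + y'.1)%N, y'.2), ((size (A ++ L') + y'.1)%N, y'.2),
    ((A ++ L) ++ Z''), ((A ++ L') ++ Z''); split.
  + by have := isins_ctx (typed_cat tA tL) tn iZ''; rewrite !cats0 -catA.
  + by have := isins_ctx (typed_cat tA tL') tn iZ''; rewrite !cats0 -catA.
  + by rewrite -!catA; exact: eqt_ctx E tA (isins_typed iZ'').
Qed.

Lemma isins_some T : typed [::] T [::] -> ~~ nilp T -> count_col F2 T = 2 ->
  exists x Z, isins T x Z.
Proof.
move=> tT T0 cT; have [[x vx] _] := (connected_count tT T0).2 cT.
by exists x; exact: isins_ex.
Qed.

(** Before each step, connectedness brings the insertion to a place that the step can carry over,
    and afterwards to the place wanted. *)
Lemma isins_isotopic T T' x y Z Z' : isotopic T T' -> typed [::] T [::] ->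
  ~~ nilp T -> count_col F2 T = 2 -> isins T x Z -> isins T' y Z' -> eqt [::] [::] Z Z'.
Proof.
move=> TT'; elim: TT' x y Z Z' => [_ _ [A B L L' LL' tL tL']|X|X Y XY IH|X Y W XY IH YW IH']
  x y Z Z' tT T0 cT iZ iZ'.
- have st := rst_step _ _ _ _ (TangleStep LL' tL tL').
  have tT' := (isotopic_typed [::] [::] st).1 tT.
  have cT' : count_col F2 (A ++ L' ++ B) = 2 by rewrite -(isotopic_count _ st).
  have /typed_split [s [tA /typed_split [t [tLs tB]]]] := tT.
  have [x1 [y1 [Z1 [Z2 [i1 i2 E]]]]] := step_ins LL' tA tLs tB iZ.
  apply: eqt_trans (isins_connected tT T0 cT iZ i1) (eqt_trans E _).
  exact: isins_connected tT' (tangle_neq0 tL') cT' i2 iZ'.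
- exact: isins_connected iZ iZ'.
- apply/eqt_sym/(IH _ _ _ _ _ _ _ iZ' iZ).
  + exact/(isotopic_typed _ _ XY).
  + by rewrite (isotopic_nilp XY).
  + by rewrite (isotopic_count _ XY).
- have tY := (isotopic_typed [::] [::] XY).1 tT.
  have nY : ~~ nilp Y by rewrite -(isotopic_nilp XY).
  have cY : count_col F2 Y = 2 by rewrite -(isotopic_count _ XY).
  have [x1 [Z1 i1]] := isins_some tY nY cY.
  exact: eqt_trans (IH _ _ _ _ tT T0 cT iZ i1) (IH' _ _ _ _ tY nY cY i1 iZ').
Qed.

End Insertion.

(** * Connected sums *)

Section Multiplicativity.
Variable R : finComNzRingType.
Local Open Scope ring_scope.
Implicit Types (A B T : fseq) (f : (nat -> R) -> nat).

Lemma wact_cst n (w : braid_word n) (a : R) : wact w (fun=> a) = fun=> a.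
Proof.
elim: w => //= -[i s] w ->; apply/funext => j; rewrite /lact /=.
by case: s; case: ifP => // _; try ring; case: ifP => // _; try ring.
Qed.

Lemma eop_cst g f (a : R) : (f (fun=> a) <= eop g f (fun=> a))%N.
Proof.
case: g => [u o v|n b eps|u o v] /=.
- by rewrite eqxx mul1n; have -> : rm (size u) (fun=> a) = (fun=> a)
    by apply/funext => j; rewrite /rm; case: ifP.
- by have [w ->] := pact_ex R b; rewrite wact_cst.
- rewrite (bigD1 a) //=; have -> : ins (size u) a (fun=> a) = (fun=> a).
    by apply/funext => j; rewrite /ins; do 2 case: ifP => // _.
  exact: leq_addr.
Qed.

Lemma eops_cst T f (a : R) : (f (fun=> a) <= eops T f (fun=> a))%N.
Proof. by elim: T => //= g T IH; apply: leq_trans IH (eop_cst g _ a). Qed.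

Definition ends_eq (c : nat -> R) : nat := (c 0%N == c 1%N).

(* The number of colourings of a long knot whose end has a given colour. *)
Definition long_count A : nat := eops A ends_eq (fun=> 0).

Lemma long_count_gt0 A : (0 < long_count A)%N.
Proof. by apply: leq_trans (eops_cst A ends_eq 0); rewrite /ends_eq eqxx. Qed.

Definition nk A : fseq := Cup [::] false [::] :: rcons A (Cap [::] false [::]).

(** The reflection [c] to [a - c] carries the colour 0 to [a], so the count does not depend on the
    colour of the ends. *)
Lemma eops_ends_cst A (a : R) z : typed [:: false; true] A [:: false; true] ->
  eops A ends_eq (cjoin 2 (fun=> a) z) = long_count A.
Proof.
move=> tA; have [_ lA rA _] := good_eops R tA; rewrite /= in lA.
rewrite -lA /long_count.
have -> : (fun=> 0) = refl a (fun=> a) :> (nat -> R) by apply/funext => j; rewrite /refl subrr.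
rewrite -rA; congr (eops _ _ _); apply/funext => u.
by rewrite /ends_eq /cjoin /refl /= (inj_eq (@subrI _ a)).
Qed.

Lemma count_nk A : typed [:: false; true] A [:: false; true] ->
  count_col R (nk A) = (#|R| * long_count A)%N.
Proof.
move=> tA; rewrite /count_col /nk /= -cats1.
transitivity (\sum_(a : R) long_count A)%N; last by rewrite sum_nat_const.
apply: eq_bigr => a _; rewrite eops_cat -(eops_ends_cst a (fun=> 0) tA).
by congr (eops _ _ _); apply/funext => c; rewrite /eops /= muln1.
Qed.

(** Starting from two equal colours, [B] ends with two equal colours, since the alternating sum is
    preserved. Then [A] starts from a constant colouring, and its count is the same for every
    constant. *)
Lemma long_count_cat A B : typed [:: false; true] A [:: false; true] ->
  typed [:: false; true] B [:: false; true] ->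
  long_count (B ++ A) = (long_count B * long_count A)%N.
Proof.
move=> tA tB; rewrite {1}/long_count eops_cat.
have [sB _ _ _] := good_eops R tB; have [_ mB] := olinear_eops R B.
rewrite mulnC -mB; apply: sB => u su.
rewrite !mul1r /= !subr0 => /subr0_eq u01.
rewrite /ends_eq u01 eqxx muln1.
have -> : u = cjoin 2 (fun=> u 0%N) (cshift 2 u).
  apply/funext => -[|[|j]] //; by rewrite /cjoin /cshift /=; congr u; lia.
exact: eops_ends_cst.
Qed.

End Multiplicativity.

Notation ft := [:: false; true].

Definition is_body (A : fseq) : Prop := typed ft A ft /\ count_col F2 (nk A) = 2%N.

Lemma is_bodyE A : is_body A <-> typed ft A ft /\ long_count F2 A = 1%N.
Proof.
have E (tA : typed ft A ft) : (count_col F2 (nk A) = 2%N <-> long_count F2 A = 1%N).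
  have c2 : #|F2| = 2%N by rewrite (@card_Fp 2).
  by rewrite (count_nk F2 tA) c2; lia.
by split=> -[tA H]; split=> //; apply/(E tA).
Qed.

Lemma body_cat A B : is_body A -> is_body B -> is_body (B ++ A).
Proof.
rewrite !is_bodyE => -[tA cA] [tB cB]; split; first exact: typed_cat tB tA.
by rewrite long_count_cat // cA cB.
Qed.

Lemma body_nil : is_body [::].
Proof. by apply/is_bodyE; split=> //; rewrite /long_count /eops /= /ends_eq eqxx. Qed.

Lemma nk_typed A : typed ft A ft -> typed [::] (nk A) [::].
Proof. by move=> tA; rewrite /nk /= -cats1; apply: typed_cat tA _. Qed.

Lemma body_knot A : is_body A -> is_knot (nk A).
Proof. by move=> [tA cA]; apply/is_knotE; split=> //; exact: nk_typed. Qed.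

Section Sum.

(* The connected summand with body B, cut open at its top right strand. *)
Definition summand (B : fseq) : fseq :=
  [:: Cup [::] false [:: false]] ++ pad [::] B [:: false] ++ [:: Cap [:: false] true [::]].

Lemma summand_typed B : typed ft B ft -> typed [:: false] (summand B) [:: false].
Proof. by move=> tB; rewrite /summand; typing. Qed.

Definition host (A : fseq) (B : fseq) : fseq :=
  [:: Cup [::] false [::]] ++ pad [::] (summand B) [:: true] ++ A ++ [:: Cap [::] false [::]].

Lemma host_isins A B : typed ft A ft -> isins (summand B) (nk A) (1%N, 0%N) (host A B).
Proof.
move=> tA; exists [:: Cup [::] false [::]], (A ++ [:: Cap [::] false [::]]), ft.
split=> //; first by rewrite /nk -cats1.
exact: typed_cat tA _.
Qed.

(** The two cups at the bottom are exchanged, the one on the right is moved above [B], and it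
    cancels there against the cap of the summand: the strand that was cut open is pulled
    straight. *)
Lemma eqt_host A B : typed ft A ft -> typed ft B ft ->
  eqt [::] [::] (host A B) (nk (B ++ A)).
Proof.
move=> tA tB; have tC : typed [::] [:: Cup [::] false [::]] ft by [].
have tA' : typed ft (A ++ [:: Cap [::] false [::]]) [::] by exact: typed_cat tA _.
have C1 := eqt_comm [::] [::] [::] tC tC.
have C2 := eqt_comm [::] [::] [::] tB tC.
rewrite /host /summand !pad_cat !pad_pad /= -!catA /=.
apply: eqt_trans.
  apply: (eqt_ctxE (A := [::]) (B := pad [::] B ([:: false] ++ [:: true]) ++
    [:: Cap [:: false] true [:: true]] ++ A ++ [:: Cap [::] false [::]]) (eqt_sym C1));
    [typing|typing|reflexivity|reflexivity].
apply: eqt_trans.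
  apply: (eqt_ctxE (A := [:: Cup [::] false [::]]) (B := 
    [:: Cap [:: false] true [:: true]] ++ A ++ [:: Cap [::] false [::]]) (eqt_sym C2));
    [typing|typing|reflexivity|reflexivity].
rewrite pad_nil.
apply: (eqt_ctxE (A := [:: Cup [::] false [::]] ++ B) (B := A ++ [:: Cap [::] false [::]])
  (eqt_zig1 [:: false] true [::]));
  [typing|typing| |]; by rewrite /nk -?cats1 /= -?catA.
Qed.

(** [B] is inserted as a summand into both knots, and [isins_isotopic] says that the insertion only
    depends on the isotopy class of the host. *)
Lemma nk_congr A A' B : is_body A -> is_body A' -> is_body B ->
  isotopic (nk A) (nk A') -> isotopic (nk (B ++ A)) (nk (B ++ A')).
Proof.
move=> [tA cA] [tA' cA'] [tB _] AA'.
have E := isins_isotopic (summand_typed tB) AA' (nk_typed tA) isT cA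
  (host_isins B tA) (host_isins B tA').
apply: eqt_isotopic (_ : ~~ nilp (nk _)) (_ : ~~ nilp (nk _)) => //.
exact: eqt_trans (eqt_sym (eqt_host tA tB)) (eqt_trans E (eqt_host tA' tB)).
Qed.

Lemma nk_host A : typed ft A ft -> isotopic (nk A) (host [::] A).
Proof.
move=> tA; have tn : typed ft [::] ft by [].
have := eqt_host tn tA; rewrite cats0 => /eqt_sym E.
exact: eqt_isotopic E _ _.
Qed.

Lemma nk_comm A B : is_body A -> is_body B -> isotopic (nk (B ++ A)) (nk (A ++ B)).
Proof.
move=> [tA cA] [tB cB].
have sA := summand_typed tA; have sB := summand_typed tB.
(* Both summands lie on one strand of the unknot: [W] is at once [B] inserted into a copy of [nk A]
   and [A] inserted into a copy of [nk B]. *)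
pose W : fseq := [:: Cup [::] false [::]] ++ pad [::] (summand B) [:: true] ++
  pad [::] (summand A) [:: true] ++ [:: Cap [::] false [::]].
have tsA : typed ft (pad [::] (summand A) [:: true]) ft by exact: (@typed_pad [::] _ [:: true] _ _ sA).
have tsB : typed ft (pad [::] (summand B) [:: true]) ft by exact: (@typed_pad [::] _ [:: true] _ _ sB).
have iB : isins (summand B) (host [::] A) (1%N, 0%N) W.
  exists [:: Cup [::] false [::]], (pad [::] (summand A) [:: true] ++ [:: Cap [::] false [::]]), ft.
  split=> //; exact: typed_cat tsA _.
have iA : isins (summand A) (host [::] B) ((size (pad [::] (summand B) [:: true])).+1, 0%N) W.
  exists ([:: Cup [::] false [::]] ++ pad [::] (summand B) [:: true]), [:: Cap [::] false [::]], ft.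
  by split=> //; rewrite /host -?catA.
have E1 := isins_isotopic sB (nk_host tA) (nk_typed tA) isT cA (host_isins B tA) iB.
have E2 := isins_isotopic sA (nk_host tB) (nk_typed tB) isT cB (host_isins A tB) iA.
apply: eqt_isotopic (_ : ~~ nilp (nk _)) (_ : ~~ nilp (nk _)) => //.
apply: eqt_trans (eqt_sym (eqt_host tA tB)) (eqt_trans E1 _).
exact: eqt_trans (eqt_sym E2) (eqt_host tB tA).
Qed.

End Sum.

Section Normalisation.

Lemma braid0 (b : pro (braid 0)) : b = pro_in 1.
Proof.
apply: pro_eq => N; have [g bg] := pro_mem b N; exists g; split=> //=.
have -> : g = 1.
  by elim/braid_piS: g {bg} => w; case: w => [//|[[]]].
exact: gcoset_refl.
Qed.

Lemma eqt_braid0 n (b : pro (braid n)) (eps : n.-tuple bool) :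
  n = 0%N -> eqt [::] [::] [:: Braid b eps] [::].
Proof.
move=> n0; subst n; rewrite (braid0 b) (tuple0 eps).
have -> : Braid (pro_in (1 : braid 0)) [tuple] = triv [::].
  by rewrite /triv; congr (Braid _ _); exact: val_inj.
exact: eqt_triv.
Qed.

(** In a closed sequence only braids on no strands can precede the first cup, and they are trivial.
    A cup with the other orientation is the standard one followed by a crossing, by [T6cup]. *)
Fixpoint cut_bottom (T : fseq) : fseq :=
  match T with
  | [::] => [::]
  | Cup u o v :: T' => if o then sigma_fund [::] false [::] :: T' else T'
  | _ :: T' => cut_bottom T'
  end.

Fixpoint cut_top_rev (T : fseq) : fseq :=
  match T with
  | [::] => [::]
  | Cap u o v :: T' => if o then sigma_fund [::] true [::] :: T' else T'
  | _ :: T' => cut_top_rev T'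
  end.

(* A knot starts with a cup and ends with a cap; those with the wrong orientation
   are corrected by a crossing. *)
Definition body (T : fseq) : fseq := rev (cut_top_rev (rev (cut_bottom T))).

Lemma cut_bottom_eqt T : typed [::] T [::] ->
  eqt [::] [::] T [::] \/ eqt [::] [::] T (Cup [::] false [::] :: cut_bottom T).
Proof.
elim: T => [|g T IH]; first by left; exact: eqt_refl.
case: g => [u o v|n b eps|u o v] tT.
- by have := typed_source (isT : ~~ nilp (_ :: _)) tT; rewrite /= => /(congr1 size);
    rewrite size_cat /=; lia.
- have [r [t1 t2]] := @typed_split _ [:: _] _ _ tT.
  have n0 : n = 0%N.
    by rewrite -(size_tuple eps) (esym (typed_source (isT : ~~ nilp [:: _]) t1) : tval eps = [::]).
  have E := eqt_braid0 b eps n0.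
  have [tb _ _] := E; rewrite (typed_uniq t1 tb) in t2.
  have E' := @eqt_ctx [::] [::] [::] [::] [::] _ _ T E (eqxx _) t2.
  by have [H|H] := IH t2; [left|right]; exact: eqt_trans E' H.
- right; have := typed_source (isT : ~~ nilp (_ :: _)) tT; rewrite [source _]/= => uv.
  have {uv} [u0 v0] : u = [::] /\ v = [::] by case: (u) uv => //; case: (v).
  subst u v; case: o tT => tT /=; last exact: eqt_refl.
  have [r [t1 t2]] := @typed_split _ [:: _] _ _ tT.
  have E := eqt_cross_cup [::] [::]; have [_ tC _] := E.
  rewrite (typed_uniq t1 tC) in t2.
  exact: (@eqt_ctx [::] [::] [::] _ [::] _ _ T (eqt_sym E) (eqxx _) t2).
Qed.

Lemma cut_top_eqt X : typed ft X [::] ->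
  eqt ft [::] X (rcons (rev (cut_top_rev (rev X))) (Cap [::] false [::])).
Proof.
elim/last_ind: X => [|X g IH] // tX; rewrite rev_rcons.
have tX' := tX; rewrite -cats1 in tX'; have [r [t1 t2]] := typed_split tX'.
have tn : typed [::] [::] [::] by [].
case: g tX tX' t2 => [u o v|n b eps|u o v] tX tX' t2.
- have := typed_target (isT : ~~ nilp (_ :: _)) t2; rewrite [target _]/= => uv.
  have {uv} [u0 v0] : u = [::] /\ v = [::] by case: (u) uv => //; case: (v).
  subst u v; case: o tX tX' t2 => tX tX' t2 /=; last by rewrite revK; exact: eqt_refl.
  have E := eqt_cross_cap [::] true [::]; have [_ tC _] := E.
  have rE : r = [:: true; false] := typed_source (isT : ~~ nilp [:: _]) t2.
  rewrite rE in t1.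
  have := eqt_ctx (eqt_sym E) t1 tn; rewrite !cats0.
  by rewrite -!cats1 rev_cons revK -cats1 -catA.
- have n0 : n = 0%N.
    have := congr1 size (typed_target (isT : ~~ nilp [:: _]) t2 : [::] = ftarget (Braid b eps)).
    by rewrite size_ftarget_braid.
  have E := eqt_braid0 b eps n0; have [tb _ _] := E.
  have rE : r = [::].
    rewrite (typed_source (isT : ~~ nilp [:: _]) t2).
    exact/esym/(typed_source (isT : ~~ nilp [:: _]) tb).
  rewrite rE in t1; apply: eqt_trans (IH t1).
  by have := eqt_ctx E t1 tn; rewrite !cats0 cats1.
- have := typed_target (isT : ~~ nilp (_ :: _)) t2; rewrite [target _]/= => /(congr1 size).
  by rewrite size_cat /=; lia.
Qed.

Lemma body_isotopic T : is_knot T -> isotopic T (nk (body T)) /\ is_body (body T).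
Proof.
move=> kT; have /is_knotE [T0 tT cT] := kT.
(* In the first alternative [T] would be equivalent to the empty sequence, which has one colouring
   instead of two. *)
have [[_ _ E]|E] := cut_bottom_eqt tT.
  have tn : typed [::] [::] [::] by [].
  have := isotopic_count F2 (E [::] [::] [::] [::] tn tn).
  rewrite /= !cats0 /count_col /= pact1.
  by rewrite /count_col in cT; rewrite cT.
have [_ tE _] := E; have tb : typed ft (cut_bottom T) [::] by case/andP: tE.
have tC : typed [::] [:: Cup [::] false [::]] ft by [].
have tn : typed [::] [::] [::] by [].
have := eqt_ctx (cut_top_eqt tb) tC tn; rewrite !cats0 => E'.
have I : isotopic T (nk (body T)) by exact: eqt_isotopic (eqt_trans E E') T0 _.
split=> //; have tN := (isotopic_typed [::] [::] I).1 tT.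
split; last by rewrite -(isotopic_count _ I).
move: tN; rewrite /nk -cats1 => tN.
have [r [t1 t2]] := @typed_split _ [:: _] _ _ tN.
have [r' [t3 t4]] := typed_split t2.
rewrite (typed_uniq t1 tC) in t3.
by rewrite (typed_source (isT : ~~ nilp [:: _]) t4 : r' = ft) in t3.
Qed.

End Normalisation.

Lemma nk_body A : is_knot (nk A) -> is_body A.
Proof.
move=> /is_knotE [_ tN cN]; split=> //; move: tN; rewrite /nk -cats1 => tN.
have tC : typed [::] [:: Cup [::] false [::]] ft by [].
have [r [t1 t2]] := @typed_split _ [:: _] _ _ tN; have [r' [t3 t4]] := typed_split t2.
rewrite (typed_uniq t1 tC) in t3.
by rewrite (typed_source (isT : ~~ nilp [:: _]) t4 : r' = ft) in t3.
Qed.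

Definition mk_knot T (kT : is_knot T) : knot := SigSub (mem_set kT).

Lemma knot_seqP (K : knot) : is_knot (knot_seq K).
Proof. exact: (set_mem (valP K)). Qed.

Lemma knot_classP (K L : knot) :
  knot_class K = knot_class L <-> isotopic (knot_seq K) (knot_seq L).
Proof.
split=> [/eqquotP/asboolP //|KL].
exact/eqquotP/asboolP.
Qed.

(* The value on sequences that are not knots is irrelevant. *)
Definition cls (T : fseq) : Khat :=
  knot_class (if pselect (is_knot T) is left kT then mk_knot kT
              else mk_knot (body_knot body_nil)).

Lemma clsE (K : knot) : cls (knot_seq K) = knot_class K.
Proof.
rewrite /cls; case: pselect => [k|/(_ (knot_seqP K))] //.
by apply/knot_classP; exact: rst_refl.
Qed.

Lemma cls_mk T (kT : is_knot T) : cls T = knot_class (mk_knot kT).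
Proof. by rewrite -clsE. Qed.

Lemma cls_eq T T' : is_knot T -> is_knot T' -> cls T = cls T' <-> isotopic T T'.
Proof. by move=> kT kT'; rewrite (cls_mk kT) (cls_mk kT') knot_classP. Qed.

Lemma cls_surj (K : Khat) : exists2 A, is_body A & K = cls (nk A).
Proof.
rewrite -[K]reprK -[\pi_ _ _]/(knot_class (repr K)) -clsE.
have [I B] := body_isotopic (knot_seqP (repr K)).
exists (body (knot_seq (repr K))) => //; apply/cls_eq => //; [exact: knot_seqP|exact: body_knot].
Qed.

Lemma nk_congr2 A A' B B' : is_body A -> is_body A' -> is_body B -> is_body B' ->
  isotopic (nk A) (nk A') -> isotopic (nk B) (nk B') ->
  isotopic (nk (B ++ A)) (nk (B' ++ A')).
Proof.
move=> bA bA' bB bB' AA' BB'.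
apply: rst_trans (nk_congr bA bA' bB AA') _; apply: rst_trans (nk_comm bA' bB) _.
by apply: rst_trans (nk_congr bB bB' bA' BB') _; exact: nk_comm.
Qed.

(** The bodies hidden behind [xget] may differ from [A] and [B], but they close up to isotopic
    knots, and by [nk_congr2] the sum depends on nothing else. *)
Lemma sharp_nk A B : is_body A -> is_body B ->
  sharp (cls (nk A)) (cls (nk B)) = cls (nk (B ++ A)).
Proof.
move=> bA bB; rewrite /sharp; case: xgetP => [K _|/(_ (cls (nk (B ++ A))))]; last first.
  case; exists (mk_knot (body_knot bA)), (mk_knot (body_knot bB)),
    (mk_knot (body_knot (body_cat bA bB))), A, B.
  by split; split=> //; exact: cls_mk.
move=> [alpha [beta [gamma [A' [B' [[EA EB ->] [sA sB sC]]]]]]].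
have bA' : is_body A' by apply: nk_body; rewrite -[nk _]sA; exact: knot_seqP.
have bB' : is_body B' by apply: nk_body; rewrite -[nk _]sB; exact: knot_seqP.
rewrite -clsE sC; apply/cls_eq; try by apply: body_knot; exact: body_cat.
have kA := body_knot bA; have kB := body_knot bB.
apply: nk_congr2 => //.
  apply/rst_sym/(cls_eq kA (body_knot bA')).
  by rewrite EA -clsE sA.
apply/rst_sym/(cls_eq kB (body_knot bB')).
by rewrite EB -clsE sB.
Qed.

Lemma sharpC : commutative sharp.
Proof.
move=> K L; have [A bA ->] := cls_surj K; have [B bB ->] := cls_surj L.
rewrite !sharp_nk //; apply/cls_eq; try by apply: body_knot; exact: body_cat.
exact: nk_comm.
Qed.

Lemma sharpA : associative sharp.
Proof.
move=> K L M; have [A bA ->] := cls_surj K; have [B bB ->] := cls_surj L.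
have [C bC ->] := cls_surj M.
by rewrite !sharp_nk ?catA //; exact: body_cat.
Qed.

Definition unknot : Khat := cls (nk [::]).

Lemma sharpK1 K : sharp K unknot = K.
Proof. by have [A bA ->] := cls_surj K; rewrite sharp_nk //; exact: body_nil. Qed.

Lemma sharp1K K : sharp unknot K = K.
Proof. by rewrite sharpC sharpK1. Qed.

HB.instance Definition _ := Monoid.isComLaw.Build Khat unknot sharp sharpA sharpC sharp1K.

Lemma frac_eq_refl p : frac_eq p p.
Proof. by exists unknot. Qed.

Lemma frac_eq_sym p q : frac_eq p q -> frac_eq q p.
Proof. by move=> [t E]; exists t. Qed.

Lemma frac_eq_trans p q r : frac_eq p q -> frac_eq q r -> frac_eq p r.
Proof.
case: p q r => [p1 p2] [q1 q2] [r1 r2] [t /= E] [u /= F].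
(* The two equalities are multiplied, and the factors [q1] and [q2], present on both sides, join the
   cancelling term. *)
exists (sharp (sharp q1 q2) (sharp t u)); rewrite /=.
transitivity (sharp (sharp (sharp p1 q2) t) (sharp (sharp q1 r2) u)).
  by rewrite (sharp.[AC (2*(2*2)) (((1*4)*5)*((3*2)*6))]).
by rewrite E F (sharp.[AC (3*3) ((4*2)*((1*5)*(3*6)))]).
Qed.

Lemma frac_eqP p q : frac p = frac q <-> frac_eq p q.
Proof.
split=> [|pq]; last exact/eqquotP/asboolP/rst_step.
  move/eqquotP/asboolP; elim=> [//|x|x y _|x y z _ + _].
  - exact: frac_eq_refl.
  - exact: frac_eq_sym.
  - exact: frac_eq_trans.
Qed.

Lemma frac_eq_sharp2 p p' q q' : frac_eq p p' -> frac_eq q q' ->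
  frac_eq (sharp2 p q) (sharp2 p' q').
Proof.
case: p p' q q' => [p1 p2] [p1' p2'] [q1 q2] [q1' q2'] [t /= E] [u /= F].
exists (sharp t u); rewrite /=.
rewrite (sharp.[AC ((2*2)*2) (((1*3)*5)*((2*4)*6))]) E F.
by rewrite (sharp.[AC (3*3) (((1*4)*(2*5))*(3*6))]).
Qed.

Lemma frac_repr (x : GKhat) : frac (repr x) = x.
Proof. exact: reprK. Qed.

Definition gmul (x y : GKhat) : GKhat := frac (sharp2 (repr x) (repr y)).
Definition ginv (x : GKhat) : GKhat := frac ((repr x).2, (repr x).1).

Lemma gmulE p q : gmul (frac p) (frac q) = frac (sharp2 p q).
Proof. by apply/frac_eqP; apply: frac_eq_sharp2; apply/frac_eqP; rewrite frac_repr. Qed.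

Lemma ginvE p : ginv (frac p) = frac (p.2, p.1).
Proof.
apply/frac_eqP; have /frac_eqP [t E] := frac_repr (frac p).
by exists t; rewrite /= (sharpC _ p.1) -E (sharpC p.2).
Qed.

Lemma GKhat_ind (P : GKhat -> Prop) : (forall p, P (frac p)) -> forall x, P x.
Proof. by move=> HP x; rewrite -[x]frac_repr. Qed.

Lemma gmulA : associative gmul.
Proof.
elim/GKhat_ind=> p; elim/GKhat_ind=> q; elim/GKhat_ind=> r.
by rewrite !gmulE /sharp2 /= !sharpA.
Qed.

Lemma gmulC : commutative gmul.
Proof.
elim/GKhat_ind=> p; elim/GKhat_ind=> q.
by rewrite !gmulE /sharp2 [sharp p.1 _]sharpC [sharp p.2 _]sharpC.
Qed.

Definition gone : GKhat := frac (unknot, unknot).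

Lemma gmul1 : left_id gone gmul.
Proof. by elim/GKhat_ind=> -[r s]; rewrite gmulE /sharp2 /= !sharp1K. Qed.

Lemma gmulV : left_inverse gone ginv gmul.
Proof.
elim/GKhat_ind=> -[r s]; rewrite ginvE gmulE; apply/frac_eqP.
by exists unknot; rewrite /= !sharpK1 sharpC sharp1K.
Qed.

Section Infinite.
Local Open Scope ring_scope.
Local Notation F3 := ('F_3 : finComNzRingType).

(** The number of colourings over F_3 divided by 3, the number of choices for the colour of the
    ends; this division makes it multiplicative. *)
Definition tricol (K : Khat) : nat := long_count F3 (body (knot_seq (repr K))).

Lemma tricol_nk A : is_body A -> tricol (cls (nk A)) = long_count F3 A.
Proof.
move=> bA; rewrite /tricol; set K := repr _.
have [I [tB _]] := body_isotopic (knot_seqP K); have [tA _] := bA.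
have J : isotopic (knot_seq K) (nk A).
  apply/(cls_eq (knot_seqP K) (body_knot bA)).
  by rewrite clsE /knot_class reprK.
have := isotopic_count F3 (rst_trans _ _ _ _ _ (rst_sym _ _ _ _ I) J).
by rewrite !count_nk // (@card_Fp 3) // => /eqP; rewrite eqn_pmul2l // => /eqP.
Qed.

Lemma tricol_sharp K L : tricol (sharp K L) = (tricol K * tricol L)%N.
Proof.
have [A bA ->] := cls_surj K; have [B bB ->] := cls_surj L.
have [[tA _] [tB _]] := (bA, bB).
by rewrite sharp_nk // !tricol_nk ?long_count_cat // 1?mulnC //; exact: body_cat.
Qed.

Lemma tricol_gt0 K : (0 < tricol K)%N.
Proof. exact: long_count_gt0. Qed.

(** Two parallel upward strands crossing three times, one of them closed up on the right: a trefoil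
    cut open. *)
Definition trefoil_body : fseq :=
  [:: Cup [:: false; true] true [::];
      Braid (pro_in (sigma 4 1 ^+ 3)%g) [tuple false; true; true; false];
      Cap [:: false; true] true [::]].

Lemma trefoil_typed : typed ft trefoil_body ft.
Proof.
rewrite /trefoil_body /typed; apply/and3P; split=> //.
apply/andP; split=> //; apply/eqP/esym; apply: col_inj; first by rewrite size_ftarget_braid.
rewrite col_ftarget pact_in; apply/funext => j.
rewrite 2!expgS expg1 !bactM !bact_sigma // /lact.
case: j => [|[|[|[|j]]]] //=; rewrite /col /= ?nth_nil; exact: val_inj.
Qed.

(** With ends coloured 0 and the closed strand coloured [b], the cap and the agreement of the ends
    both amount to [3 b = 0]. This leaves one colouring over F_2, so that there is one component,
    and three over F_3. *)
Lemma long_count_trefoil (R : finComNzRingType) :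
  long_count R trefoil_body = #|[pred b : R | b *+ 3 == 0]|.
Proof.
rewrite /long_count /eops /= pact_in -sum1_card [RHS]big_mkcond; apply: eq_bigr => b _.
rewrite 2!expgS expg1 !bactM !bact_sigma // /ends_eq /rm /lact /ins /=.
have E : (((b *+ 2 - 0) *+ 2 - b) *+ 2 - (b *+ 2 - 0) == b) = (b *+ 3 == 0).
  by rewrite -subr_eq0; congr (_ == _); ring.
have E' : (0 == (b *+ 2 - 0) *+ 2 - b) = (b *+ 3 == 0).
  by rewrite eq_sym; congr (_ == _); ring.
by rewrite E E' inE; case: eqP.
Qed.

Lemma trefoil_is_body : is_body trefoil_body.
Proof.
apply/is_bodyE; split; first exact: trefoil_typed.
rewrite long_count_trefoil; transitivity #|pred1 (0 : F2)|; last exact: card1.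
by apply: eq_card => b; rewrite !inE mulrSr F2_double add0r.
Qed.

Lemma long_count3_trefoil : long_count F3 trefoil_body = 3%N.
Proof.
rewrite long_count_trefoil; transitivity #|F3|; last by rewrite (@card_Fp 3).
apply: eq_card => b; rewrite !inE.
by apply/eqP/val_inj; case: b => [[|[|[|]]]].
Qed.

Fixpoint trefoils (n : nat) : Khat :=
  if n is n'.+1 then sharp (trefoils n') (cls (nk trefoil_body)) else unknot.

Lemma tricol_trefoils n : tricol (trefoils n) = (3 ^ n)%N.
Proof.
elim: n => [|n IH] /=.
  rewrite /unknot tricol_nk; last exact: body_nil.
  by rewrite /long_count /eops /= /ends_eq eqxx.
rewrite tricol_sharp IH tricol_nk; last exact: trefoil_is_body.
by rewrite long_count3_trefoil expnSr.
Qed.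

(** The unknown summand [t] has a positive count, which cancels and leaves powers of 3. *)
Lemma frac_trefoils_inj : injective (fun n => frac (trefoils n, unknot)).
Proof.
move=> m n /frac_eqP [t /= E].
have := congr1 tricol E; rewrite !sharpK1 !tricol_sharp !tricol_trefoils => /eqP.
by rewrite eqn_pmul2r ?tricol_gt0 // => /eqP /expnI; apply.
Qed.

Lemma GKhat_infinite : infinite_set [set: GKhat].
Proof.
move=> fin; apply: infinite_nat.
have := finite_preimage (f := fun n => frac (trefoils n, unknot)) (B := [set: GKhat]).
rewrite preimage_setT; apply=> //.
by move=> m n _ _; exact: frac_trefoils_inj.
Qed.

End Infinite.

(** * Sigma-compact relations *)

Definition clopen_compact (X : topologicalType) (K : set X) : Prop :=
  [/\ compact K, closed K & open K].

Definition locally_profinite (X : topologicalType) : Prop :=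
  forall (x : X) U, nbhs x U -> exists K, [/\ clopen_compact K, K x & K `<=` U].

Definition sigma_compact (X : topologicalType) (A : set X) : Prop :=
  exists2 K : nat -> set X, forall n, compact (K n) & A = \bigcup_n K n.

Section SigmaCompact.
Implicit Types X Y : topologicalType.

Lemma sigma_compact_compact X (A : set X) : compact A -> sigma_compact A.
Proof.
by move=> cA; exists (fun=> A) => //; rewrite predeqE => x; split=> [?|[]//]; exists 0%N.
Qed.

Lemma sigma_compact_bigcup (I : countType) X (A : I -> set X) :
  (forall i, sigma_compact (A i)) -> sigma_compact (\bigcup_i A i).
Proof.
move=> HA; have /choice [K HK] : forall i, exists K : nat -> set X,
    (forall n, compact (K n)) /\ A i = \bigcup_n K n.
  by move=> i; have [K cK AK] := HA i; exists K.
exists (fun n => oapp (fun p => K p.1 p.2) set0 (@choice.unpickle (I * nat)%type n)) => [n|].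
  by case: choice.unpickle => [p|] /=; [have [] := HK p.1|exact: compact0].
rewrite predeqE => x; split.
  move=> [i _]; have [_ ->] := HK i => -[m _ Kx].
  by exists (choice.pickle (i, m)) => //; rewrite choice.pickleK.
move=> [n _]; case: choice.unpickle => [[i m] /= Kx|//]; exists i => //.
by have [_ ->] := HK i; exists m.
Qed.

Lemma sigma_compactU X (A B : set X) :
  sigma_compact A -> sigma_compact B -> sigma_compact (A `|` B).
Proof.
move=> sA sB; rewrite (_ : A `|` B = \bigcup_(b : bool) if b then A else B).
  by apply: sigma_compact_bigcup => -[].
by rewrite predeqE => x; split=> [[]|[[] _]]; [exists true|exists false|left|right].
Qed.

Lemma sigma_compact_image X Y (f : X -> Y) (A : set X) :
  continuous f -> sigma_compact A -> sigma_compact (f @` A).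
Proof.
move=> cf [K cK ->]; exists (fun n => f @` K n) => [n|].
  by apply: continuous_compact => //; apply: continuous_subspaceT.
by rewrite image_bigcup.
Qed.

Lemma sigma_compactX X Y (A : set X) (B : set Y) :
  sigma_compact A -> sigma_compact B -> sigma_compact (A `*` B).
Proof.
move=> [K cK ->] [L cL ->].
rewrite (_ : _ `*` _ = \bigcup_(p : nat * nat) (K p.1 `*` L p.2)).
  by apply: sigma_compact_bigcup => p; apply/sigma_compact_compact/compact_setX.
rewrite predeqE => -[x y]; split=> [[[m _ Kx] [n _ Ly]]|[[m n] _ [/= Kx Ly]]].
  by exists (m, n).
by split; [exists m | exists n].
Qed.

Lemma sigma_compact_closedI X (A B : set X) :
  sigma_compact A -> closed B -> sigma_compact (A `&` B).
Proof.
move=> [K cK ->] cB; exists (fun n => K n `&` B); last by rewrite setI_bigcupl.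
by move=> n; exact: compact_closedI.
Qed.

End SigmaCompact.

Section Separation.
Implicit Types X Y : topologicalType.

Lemma clopen_compact_nbhd X (A U : set X) : locally_profinite X ->
  compact A -> (forall x, A x -> nbhs x U) ->
  exists K, [/\ clopen_compact K, A `<=` K & K `<=` U].
Proof.
move=> lX /compact_near_coveringP cA AU.
pose D := [set K : set X | clopen_compact K /\ K `<=` U].
(* The filter of large clopen compact subsets of [U], directed by finite unions. Compactness of [A],
   in covering form, turns local containment into a single member that contains [A]. *)
pose F := filter_from D (fun K => [set K' | D K' /\ K `<=` K']).
have FF : Filter F.
  apply: filter_from_filter.
    by exists set0; split=> //; split; [exact: compact0|exact: closed0|exact: open0].
  move=> K K' [[cK clK oK] KU] [[cK' clK' oK'] K'U]; exists (K `|` K').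
    by split; [split; [exact: compactU|exact: closedU|exact: openU] | rewrite subUset].
  by move=> L [DL]; rewrite subUset => -[KL K'L].
have [x Ax|K DK HK] := cA _ F (fun K x => K x) FF.
  have [K [cK Kx KU]] := lX x U (AU x Ax).
  exists (K, [set K' | D K' /\ K `<=` K']); last by move=> [x' K'] [/= Kx' [_]]; apply.
  split; last by exists K.
  by apply: open_nbhs_nbhs; have [] := cK.
by have [cK KU] := DK; exists K; split=> //; exact: (HK K (conj DK (@subset_refl _ K))).
Qed.

Lemma tube X Y (A : set X) (B : set Y) (W : set (X * Y)) : locally_profinite X ->
  compact A -> compact B -> open W -> A `*` B `<=` W ->
  exists K, [/\ clopen_compact K, A `<=` K & K `*` B `<=` W].
Proof.
move=> lX cA cB oW ABW.
have [|K [cK AK KU]] := clopen_compact_nbhd (U := [set x | forall y, B y -> W (x, y)]) lX cA.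
  move=> x Ax; move/compact_near_coveringP: cB => /(_ X (nbhs x) (fun x y => W (x, y)) _).
  apply=> y By; have : nbhs (x, y) W by move: oW; rewrite openE => /(_ _ (ABW (x, y) (conj Ax By))).
  by move=> [[P Q] [/= Px Qy] PQ]; exists (Q, P) => // -[y' x'] [/= Qy' Px']; apply: (PQ (x', y')).
by exists K; split=> // -[x y] [/KU]; apply.
Qed.

Lemma tube2 X Y (A : set X) (B : set Y) (W : set (X * Y)) :
  locally_profinite X -> locally_profinite Y ->
  compact A -> compact B -> open W -> A `*` B `<=` W ->
  exists K L, [/\ clopen_compact K, clopen_compact L, A `<=` K, B `<=` L & K `*` L `<=` W].
Proof.
move=> lX lY cA cB oW ABW; have [K [cK AK KW]] := tube lX cA cB oW ABW.
have oW' : open [set p : Y * X | W (p.2, p.1)].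
  move: oW; rewrite !openE => oW [y x] /oW [[P Q] [/= Px Qy] PQ].
  by exists (Q, P) => // -[y' x'] [/= Qy' Px']; apply: (PQ (x', y')).
have [cK' _ _] := cK.
have [|L [cL BL LW]] := tube lY cB cK' oW'.
  by move=> -[y x] [/= By Kx]; apply: KW.
by exists K, L; split=> // -[x y] [Kx Ly]; apply: (LW (y, x)).
Qed.

Definition closed_under (X : Type) (S : set (X * X)) (A : set X) : Prop :=
  forall x y, S (x, y) -> A x -> A y.

Lemma image_compact_rel X (K : set (X * X)) (A : set X) : compact K -> closed A ->
  compact (snd @` (K `&` fst @^-1` A)).
Proof.
move=> cK cA; apply: continuous_compact.
  by apply: continuous_subspaceT => x; exact: cvg_snd.
apply: compact_closedI => //.
by apply: preimage_closed => // x _; exact: cvg_fst.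
Qed.

(** [A'] adds to [A] its images under the first [n + 1] pieces of the relation. The last clause
    keeps [A'] inside every invariant set that contains [A], such as a slice of an invariant [W]. *)
Lemma saturation_step X (K : nat -> set (X * X)) (A : set X) n :
  (forall i, compact (K i)) -> compact A -> closed A ->
  exists A', [/\ compact A', A `<=` A' &
    forall x y i, (i <= n)%N -> K i (x, y) -> A x -> A' y] /\
  forall S : set X, A `<=` S -> closed_under (\bigcup_i K i) S -> A' `<=` S.
Proof.
move=> cK cA clA; pose F i := snd @` (K i `&` fst @^-1` A).
exists (A `|` \bigcup_(i in `I_n.+1) F i); split; first split.
- apply: compactU => //; rewrite bigcup_mkord.
  by apply: bigsetU_compact => i _; exact: image_compact_rel.
- by move=> x; left.
- move=> x y i im Kxy Ax; right; exists i => //.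
  by exists (x, y).
- move=> S AS cS y [/AS //|[i _ [[x z] [/= Kxz Ax] <-]]].
  by apply: (cS x) (AS _ Ax); exists i.
Qed.

(* The box is the union of an increasing sequence of compact open boxes included
   in W: the images of a compact open set under finitely many compact pieces of
   S form a compact set, which the tube lemma makes open again. *)
Lemma separation X Y (S : set (X * X)) (R : set (Y * Y)) (W : set (X * Y)) x0 y0 :
  locally_profinite X -> locally_profinite Y ->
  sigma_compact S -> sigma_compact R -> open W ->
  (forall x x' y, S (x, x') -> W (x, y) -> W (x', y)) ->
  (forall x y y', R (y, y') -> W (x, y) -> W (x, y')) -> W (x0, y0) ->
  exists A B, [/\ open A, open B, A x0, B y0 & A `*` B `<=` W] /\
    closed_under S A /\ closed_under R B.
Proof.
move=> lX lY [K cK ->] [L cL ->] oW WS WR W0.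
pose ok (P : set X * set Y) :=
  [/\ clopen_compact P.1, clopen_compact P.2 & P.1 `*` P.2 `<=` W].
have step (n : nat) (P : {P | ok P}) : exists Q : {P | ok P},
    [/\ (sval P).1 `<=` (sval Q).1, (sval P).2 `<=` (sval Q).2,
       forall x y i, (i <= n)%N -> K i (x, y) -> (sval P).1 x -> (sval Q).1 y &
       forall x y i, (i <= n)%N -> L i (x, y) -> (sval P).2 x -> (sval Q).2 y].
  case: P => -[A B] [/= [cA clA oA] [cB clB oB] ABW].
  have [A' [[cA' AA' HA] SA]] := saturation_step n cK cA clA.
  have [B' [[cB' BB' HB] SB]] := saturation_step n cL cB clB.
  (* The points whose whole fibre over [B] lies in [W] form a set that contains [A] and is closed
     under the relation, hence contains [A']. *)
  have A'W : A' `*` B `<=` W.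
    move=> [x y] [/= A'x By]; apply: (SA [set x | forall y, B y -> W (x, y)]) A'x _ By.
      by move=> x' Ax' y' By'; apply: ABW.
    by move=> x' x'' Kx Wx y' By'; apply: WS Kx (Wx _ By').
  have A'B'W : A' `*` B' `<=` W.
    move=> [x y] [/= A'x B'y]; apply: (SB [set y | W (x, y)]) B'y.
      by move=> y' By'; apply: A'W.
    by move=> y' y'' Ly Wy; apply: WR Ly Wy.
  have [A'' [B'' [cA'' cB'' A'A'' B'B'' W'']]] := tube2 lX lY cA' cB' oW A'B'W.
  have okQ : ok (A'', B'') by [].
  exists (exist _ _ okQ); split=> /=.
  - exact: subset_trans A'A''.
  - exact: subset_trans B'B''.
  - by move=> x y i i_n Kxy Ax; apply/A'A''/(HA x y i).
  - by move=> x y i i_n Lxy Bx; apply/B'B''/(HB x y i).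
have [A0 [B0 [cA0 cB0 A0x B0y W00]]] : exists A0 B0,
    [/\ clopen_compact A0, clopen_compact B0, [set x0] `<=` A0, [set y0] `<=` B0 &
        A0 `*` B0 `<=` W].
  apply: tube2 => //; [exact: compact_set1|exact: compact_set1|].
  by move=> [x y] [/= -> ->].
have ok0 : ok (A0, B0) by [].
have [next nextP] := choice (fun p : nat * {P | ok P} => step p.1 p.2).
pose P := fix P n := if n is n'.+1 then next (n', P n') else exist _ _ ok0.
have PP n := nextP (n, P n).
have mono m n : (m <= n)%N -> (sval (P m)).1 `<=` (sval (P n)).1 /\
    (sval (P m)).2 `<=` (sval (P n)).2.
  elim: n => [|n IH]; first by rewrite leqn0 => /eqP ->; split.
  rewrite leq_eqVlt => /orP [/eqP ->|/IH [IA IB]]; first by split.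
  by have [HA HB _ _] := PP n; split; [apply: subset_trans IA HA|apply: subset_trans IB HB].
exists (\bigcup_n (sval (P n)).1), (\bigcup_n (sval (P n)).2); split; last split.
- split.
  + by apply: bigcup_open => n _; have [[]] := svalP (P n).
  + by apply: bigcup_open => n _; have [_ []] := svalP (P n).
  + by exists 0%N => //; exact: A0x.
  + by exists 0%N => //; exact: B0y.
  + move=> [x y] [/= [m _ Ax] [n _ By]]; have [_ _] := svalP (P (maxn m n)); apply.
    by split=> /=; [have [+ _] := mono _ _ (leq_maxl m n)|have [_ +] := mono _ _ (leq_maxr m n)]; apply.
(* The piece [K i] is applied at every stage from [i] on, so stage [maxn i n] contains [x] and
   applies that piece to it. *)
- move=> x y [i _ Kxy] [n _ Ax]; exists (maxn i n).+1 => //.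
  have [_ _ H _] := PP (maxn i n); apply: (H x y i) => //; first exact: leq_maxl.
  by have [+ _] := mono _ _ (leq_maxr i n); apply.
- move=> x y [i _ Lxy] [n _ Bx]; exists (maxn i n).+1 => //.
  have [_ _ _ H] := PP (maxn i n); apply: (H x y i) => //; first exact: leq_maxl.
  by have [_ +] := mono _ _ (leq_maxr i n); apply.
Qed.

Lemma openX X Y (A : set X) (B : set Y) : open A -> open B -> open (A `*` B).
Proof.
rewrite !openE => oA oB [x y] [/= /oA Ax /oB By].
by exists (A, B).
Qed.

Lemma closedX X Y (A : set X) (B : set Y) : closed A -> closed B -> closed (A `*` B).
Proof.
move=> cA cB [x y] Hxy; split=> /=.
  apply: cA => U Ux; have [|[x' y'] [[Ax' _] [Ux' _]]] := Hxy (U `*` setT).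
    by exists (U, setT) => //; split=> //; exact: filterT.
  by exists x'.
apply: cB => U Uy; have [|[x' y'] [[_ By'] [_ Uy']]] := Hxy (setT `*` U).
  by exists (setT, U) => //; split=> //; exact: filterT.
by exists y'.
Qed.

Lemma locally_profiniteX X Y : locally_profinite X -> locally_profinite Y ->
  locally_profinite (X * Y)%type.
Proof.
move=> lX lY [x y] U [[P Q] [/= Px Qy] PQ].
have [K [[cK clK oK] Kx KP]] := lX x P Px; have [L [[cL clL oL] Ly LQ]] := lY y Q Qy.
exists (K `*` L); split=> //; last by move=> [x' y'] [/= /KP ? /LQ ?]; apply: PQ.
by split; [exact: compact_setX|exact: closedX|exact: openX].
Qed.

End Separation.

(** * The topology of sequences *)

Lemma pro_ball_closed (G : groupType) (x : pro G) N : closed (pro_ball x N).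
Proof.
rewrite -openC openE => y yN; apply/pro_nbhsP; exists N => z zN.
by apply: contra_not yN; rewrite /pro_ball /= => <-; rewrite zN.
Qed.

Lemma pro_ball_compact (G : groupType) (x : pro G) N : compact (pro_ball x N).
Proof. exact: subclosed_compact (@pro_ball_closed _ x N) (@pro_compact G) _. Qed.

Lemma pro_near_nbhs (G : groupType) (x : pro G) (P : G -> Prop) (U : set (pro G)) :
  pro_near x P -> (forall y, pro_near y P -> U y) -> nbhs x U.
Proof.
move=> xP PU; apply: (filterS PU); apply: open_nbhs_nbhs.
by split=> //; exact: pro_near_open.
Qed.

(* The domain of f may be replaced by a finite quotient, for all x at once. *)
Lemma pro_ext_ball (G H : groupType) (f : G -> H) : ucont f -> forall N, exists M,
  forall x y, pro_ball x M y -> pro_ball (pro_ext f x) N (pro_ext f y).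
Proof.
move=> uf N; have [M HM] := uf N; exists M => x y xy.
have near z : exists g, sval z M g /\ sval (pro_ext f z) N (f g).
  by apply: pro_near_ex; apply: pro_nearI; [exact: pro_near_mem|exact: pro_extP].
have [g [xg /pro_coset Eg]] := near x; have [h [yh /pro_coset Eh]] := near y.
rewrite /pro_ball /= Eg Eh; apply/esym/HM.
by rewrite -(pro_coset2 _ xg) -xy.
Qed.

Lemma Braid_inj n (b b' : pro (braid n)) eps eps' :
  Braid b eps = Braid b' eps' -> b = b'.
Proof. by case=> H _; apply: (inj_pair2_eq_dec _ PeanoNat.Nat.eq_dec _ _ _ _ H). Qed.

Section FseqTopology.
Implicit Types (S T : fseq) (g h : fund) (N : forall n, fin_normal (braid n)).
Implicit Types V : forall n, pro (braid n) -> set (pro (braid n)).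

Lemma fund_nearP V g h : fund_near V g h <->
  match g with
  | Braid n b eps => exists2 b', V n b b' & h = Braid b' eps
  | _ => h = g
  end.
Proof.
split=> [[u o v|n b b' eps Vbb'|u o v] //|]; first by exists b'.
by case: g => [u o v ->|n b eps [b' Vb' ->]|u o v ->]; constructor.
Qed.

Definition box V : fseq -> set fseq := List.Forall2 (fund_near V).

Lemma box_nil V T : box V [::] T <-> T = [::].
Proof. by split=> [H|->]; [inversion H | constructor]. Qed.

Lemma box_cons V g S T : box V (g :: S) T <->
  exists h T', [/\ fund_near V g h, box V S T' & T = h :: T'].
Proof.
split=> [H|[h [T' [gh ST' ->]]]]; last by constructor.
by inversion H as [|? h ? T' gh ST']; subst; exists h, T'.
Qed.

Lemma box_cat V S S' T T' : box V S T -> box V S' T' -> box V (S ++ S') (T ++ T').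
Proof. by move=> ST S'T'; elim: ST => //= *; constructor. Qed.

Lemma box_rev V S T : box V S T -> box V (rev S) (rev T).
Proof.
elim=> [|g h S' T' gh _ IH]; first by constructor.
by rewrite !rev_cons -!cats1; apply: box_cat => //; constructor=> //; constructor.
Qed.

Lemma box_refl V T : (forall n b, V n b b) -> box V T T.
Proof.
by move=> rV; elim: T => [|[u o v|n b eps|u o v] T IH]; constructor=> //; constructor.
Qed.

Lemma box_sym V S T : (forall n b b', V n b b' -> V n b' b) -> box V S T -> box V T S.
Proof.
move=> sV; elim=> [|g h S' T' gh _ IH]; constructor=> //.
by case: gh => [u o v|n b b' eps /sV|u o v]; constructor.
Qed.

Lemma box_trans V R S T : (forall n b b' b'', V n b b' -> V n b' b'' -> V n b b'') ->
  box V R S -> box V S T -> box V R T.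
Proof.
move=> tV RS; elim: RS T => [//|g h R' S' gh _ IH] T.
move=> /box_cons [k [T' [hk /IH RT' ->]]]; constructor=> //; move: hk.
case: gh => [u o v|n b b' eps bb'|u o v] /fund_nearP; try by move=> ->; constructor.
by move=> [b'' b'b'' ->]; constructor; apply: tV bb' b'b''.
Qed.

Definition fnear N : fseq -> set fseq := box (fun n b => pro_ball b (N n)).

Lemma fnear_refl N T : fnear N T T. Proof. exact: box_refl. Qed.

Lemma fnear_sym N S T : fnear N S T -> fnear N T S.
Proof. by apply: box_sym => n b b'; rewrite /pro_ball /= => ->. Qed.

Lemma fnear_trans N R S T : fnear N R S -> fnear N S T -> fnear N R T.
Proof. by apply: box_trans => n b b' b''; rewrite /pro_ball /= => <-. Qed.

Lemma fnear_open N T : open (fnear N T).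
Proof.
move=> S NTS; exists (fun n b => pro_ball b (N n)); split=> [n b|S'].
  by apply/pro_nbhsP; exists (N n).
exact: fnear_trans.
Qed.

(** For a fixed [N], nearness is an equivalence relation with open classes, so the complement of a
    class is open too. *)
Lemma fnear_closed N T : closed (fnear N T).
Proof.
rewrite -openC openE => S NTS; rewrite /interior nbhsE; exists (fnear N S).
  by split; [exact: fnear_open | exact: fnear_refl].
by move=> S' SS' NTS'; apply: NTS; apply: fnear_trans NTS' _; exact: fnear_sym.
Qed.

Lemma fin_normal_sub n (M N : fin_normal (braid n)) : exists L, forall b,
  pro_ball b L `<=` pro_ball b M `&` pro_ball b N.
Proof.
have [L HL] := fin_normalI M N; exists L => b b' bb'.
by split; apply: pro_ball_sub bb' => g h /HL [].
Qed.

(** A sequence contains finitely many braids, so for each width one subgroup can refine the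
    neighbourhoods of all of them, although [V] varies with the braid. *)
Lemma box_fnear V T : (forall n b, nbhs b (V n b)) -> exists N, fnear N T `<=` box V T.
Proof.
move=> nV.
suff H n : exists M : fin_normal (braid n), forall b eps, List.In (Braid b eps) T ->
    pro_ball b M `<=` V n b.
  have [N HN] : exists N, forall n (b : pro (braid n)) eps,
      List.In (Braid b eps) T -> pro_ball b (N n) `<=` V n b.
    by exists (fun n => sval (cid (H n))) => n; case: cid.
  exists N => S; move: S HN; clear; elim: T => [|g T IH] S HN /=.
    by move/box_nil => ->; constructor.
  move=> /box_cons [h [T' [gh TT' ->]]]; constructor.
    case: gh HN => [u o v|m b b' eps bb'|u o v] HN; constructor.
    by apply: (HN _ _ eps) bb'; left.
  by apply: IH TT' => m b eps bT; apply: (HN _ _ eps); right.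
elim: T => [|g T [M HM]].
  by have [M _] := fin_normalT (braid n); exists M.
have [[b [eps E]]|nE] := pselect (exists (b : pro (braid n)) eps, g = Braid b eps).
  have /pro_nbhsP [M' HM'] := nV n b.
  have [L HL] := fin_normal_sub M M'; exists L => b' eps' [|/HM MV].
    by rewrite E => /Braid_inj <-; apply: subset_trans HM' => ? /HL [].
  by apply: subset_trans MV => ? /HL [].
exists M => b eps [E|/HM //].
by case: nE; exists b, eps.
Qed.

Lemma fseq_nbhsP T U : nbhs T U <-> exists N, fnear N T `<=` U.
Proof.
split=> [|[N NU]].
  rewrite nbhsE => -[O [oO OT] OU]; have [V [nV VO]] := oO T OT.
  have [N HN] := box_fnear T nV; exists N.
  by apply: subset_trans OU; apply: subset_trans HN _ => S; exact: VO.
rewrite nbhsE; exists (fnear N T) => //.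
by split; [exact: fnear_open|exact: fnear_refl].
Qed.

Lemma box_nbhs V T : (forall n b, nbhs b (V n b)) -> nbhs T (box V T).
Proof. by move=> nV; apply/fseq_nbhsP/box_fnear. Qed.

End FseqTopology.

Section FseqMaps.
Implicit Types (S T : fseq) (X : topologicalType).

Lemma continuous_pair X (Y Z : topologicalType) (f : X -> Y) (g : X -> Z) :
  continuous f -> continuous g -> continuous (fun x => (f x, g x)).
Proof. by move=> cf cg x; apply: cvg_pair; [exact: cf | exact: cg]. Qed.

Lemma fnear_continuous (f : fseq -> fseq) :
  (forall T N, exists M, forall S, fnear M T S -> fnear N (f T) (f S)) -> continuous f.
Proof.
move=> Hf T U /fseq_nbhsP [N NU]; have [M HM] := Hf T N.
by apply/fseq_nbhsP; exists M => S /HM; exact: NU.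
Qed.

Lemma box_continuous (f : fseq -> fseq) :
  (forall V S T, (forall n b, V n b b) -> box V S T -> box V (f S) (f T)) -> continuous f.
Proof. by move=> Hf; apply: fnear_continuous => T N; exists N => S; exact: Hf. Qed.

Lemma continuous_cat X (f g : X -> fseq) : continuous f -> continuous g ->
  continuous (fun x => f x ++ g x : fseq).
Proof.
move=> cf cg x U /fseq_nbhsP [N NU].
have Hf : nbhs x (f @^-1` fnear N (f x)) by apply: cf; apply/fseq_nbhsP; exists N.
have Hg : nbhs x (g @^-1` fnear N (g x)) by apply: cg; apply/fseq_nbhsP; exists N.
by apply: filterS (filterI Hf Hg) => y [fy gy]; apply: NU; exact: box_cat.
Qed.

Lemma continuous_Braid X n (f : X -> pro (braid n)) eps : continuous f ->
  continuous (fun x => [:: Braid (f x) eps] : fseq).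
Proof.
move=> cf x U /fseq_nbhsP [N NU].
have Hf : nbhs x (f @^-1` pro_ball (f x) (N n)) by apply: cf; apply/pro_nbhsP; exists (N n).
apply: filterS Hf => y fy; apply: NU; constructor; last by constructor.
by constructor.
Qed.

Lemma continuous_pad u v : continuous (fun T : fseq => pad u T v).
Proof.
apply: fnear_continuous => T N.
have [M HM] : exists M : forall n, fin_normal (braid n), forall n b b', pro_ball b (M n) b' ->
    pro_ball (pro_ext (@braid_shift (size u) n (size v)) b) (N _)
             (pro_ext (@braid_shift (size u) n (size v)) b').
  have H n := pro_ext_ball (@ucont_shift (size u) n (size v)) (N _).
  by exists (fun n => sval (cid (H n))) => n; case: cid.
exists M => S; elim=> [|g h S' T' gh _ IH]; constructor=> //.
by case: gh => [u' o v'|n b b' eps /HM|u' o v'] /=; constructor.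
Qed.

Lemma continuous_ext X (G H : groupType) (f : G -> H) (k : X -> pro G) :
  ucont f -> continuous k -> continuous (fun x => pro_ext f (k x)).
Proof. by move=> uf ck x; apply: continuous_comp; [exact: ck|exact: pro_ext_continuous]. Qed.

Definition cons_braid n (eps : n.-tuple bool) (p : pro (braid n) * fseq) : fseq :=
  Braid p.1 eps :: p.2.

Lemma cons_braid_continuous n eps : continuous (@cons_braid n eps).
Proof.
apply: (@continuous_cat _ (fun p => [:: Braid p.1 eps] : fseq) snd) => [|p]; last exact: cvg_snd.
by apply: continuous_Braid => p; exact: cvg_fst.
Qed.

Definition cons_fund (g : fund) (T : fseq) : fseq := g :: T.

Lemma cons_fund_continuous (g : fund) : continuous (cons_fund g).
Proof.
by apply: (@continuous_cat _ (fun=> [:: g] : fseq) id) => [|T]; [exact: cst_continuous|exact: cvg_id].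
Qed.

(** With the shape fixed, such a set is a finite product of balls in profinite groups. *)
Lemma fnear_compact N T : compact (fnear N T).
Proof.
elim: T => [|g T IH].
  rewrite (_ : fnear N [::] = [set [::]]); first exact: compact_set1.
  by rewrite predeqE => S; exact: box_nil.
have cg : (forall V h, fund_near V g h <-> h = g) -> compact (fnear N (g :: T)).
  move=> Hg; rewrite (_ : fnear N (g :: T) = cons_fund g @` fnear N T).
    by apply: continuous_compact => //; apply: continuous_subspaceT; exact: cons_fund_continuous.
  rewrite predeqE => S; split=> [/box_cons [h [T' [/Hg -> TT' ->]]]|[T' TT' <-]].
    by exists T'.
  by apply/box_cons; exists g, T'; split=> //; apply/Hg.
case: g cg => [u o v|n b eps|u o v] cg.
- by apply: cg => V h; exact: fund_nearP.
- rewrite (_ : fnear N _ = cons_braid eps @` (pro_ball b (N n) `*` fnear N T)).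
    apply: continuous_compact; first exact/continuous_subspaceT/cons_braid_continuous.
    by apply: compact_setX => //; exact: pro_ball_compact.
  rewrite predeqE => S; split=> [/box_cons [h [T' [/fund_nearP [b' bb' ->] TT' ->]]]|].
    by exists (b', T').
  move=> [[b' T'] [bb' TT'] <-]; apply/box_cons; exists (Braid b' eps), T'; split=> //.
  by constructor.
- by apply: cg => V h; exact: fund_nearP.
Qed.

Lemma fseq_locally_profinite : locally_profinite fseq.
Proof.
move=> T U /fseq_nbhsP [N NU]; exists (fnear N T); split=> //; last exact: fnear_refl.
by split; [exact: fnear_compact|exact: fnear_closed|exact: fnear_open].
Qed.

(** There are countably many shapes, and for each of them the braids range over a compact
    product. *)
Lemma fseq_sigma_compact : sigma_compact [set: fseq].
Proof.
have -> : [set: fseq] = \bigcup_k [set T : fseq | size T = k].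
  by rewrite predeqE => T; split=> // _; exists (size T).
apply: sigma_compact_bigcup; elim=> [|k IH].
  apply: sigma_compact_compact; rewrite (_ : mkset _ = [set [::]]); first exact: compact_set1.
  by rewrite predeqE => -[|g T]; split.
rewrite (_ : mkset _ =
    \bigcup_(p : seq bool * bool * seq bool)
       (cons_fund (Cap p.1.1 p.1.2 p.2) @` [set T : fseq | size T = k]) `|`
    \bigcup_(p : seq bool * bool * seq bool)
       (cons_fund (Cup p.1.1 p.1.2 p.2) @` [set T : fseq | size T = k]) `|`
    \bigcup_(p : {n & n.-tuple bool})
       (cons_braid (tagged p) @` ([set: pro (braid (tag p))] `*` [set T : fseq | size T = k]))).
  apply: sigma_compactU; first apply: sigma_compactU.
  - by apply: sigma_compact_bigcup => p; apply: sigma_compact_image => //; exact: cons_fund_continuous.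
  - by apply: sigma_compact_bigcup => p; apply: sigma_compact_image => //; exact: cons_fund_continuous.
  - apply: sigma_compact_bigcup => p; apply: sigma_compact_image; first exact: cons_braid_continuous.
    by apply: sigma_compactX => //; apply: sigma_compact_compact; exact: pro_compact.
rewrite predeqE => T; split.
  case: T => [//|[u o v|n b eps|u o v] T] [Tk].
  - by left; left; exists (u, o, v) => //; exists T.
  - by right; exists (Tagged (fun n => n.-tuple bool) eps) => //; exists (b, T).
  - by left; right; exists (u, o, v) => //; exists T.
by move=> [[|]|] [p _ [T' /= H <-]] /=; [rewrite H|rewrite H|case: H => _ /= ->].
Qed.

End FseqMaps.

Section SameShape.
Implicit Types (S T : fseq).

(** All the discrete data, namely orientation words, composability and being a knot, depend only on
    the shape, the strand permutations and the actions over F_2. The last two are locally constant,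
    so these data are too. *)
Definition same : fseq -> set fseq := box (fun n (b b' : pro (braid n)) =>
  pro_perm b' = pro_perm b /\ pact (R := F2) b' = pact (R := F2) b).

Lemma same_sym S T : same S T -> same T S.
Proof. by apply: box_sym => n b b' [-> ->]. Qed.

Lemma pro_perm_near n (b : pro (braid n)) : \forall b' \near b, pro_perm b' = pro_perm b.
Proof.
apply: pro_near_nbhs (pro_permP b) _ => b'.
exact: pro_near_uniq (pro_permP b').
Qed.

Lemma pact_near_F2 n (b : pro (braid n)) : \forall b' \near b, pact (R := F2) b' = pact (R := F2) b.
Proof. by apply: pro_near_nbhs (pactP F2 b) _ => b'; exact: pact_uniq. Qed.

Lemma same_near T : \forall T' \near T, same T T'.
Proof.
apply: box_nbhs => n b.
exact: filterI (pro_perm_near b) (pact_near_F2 b).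
Qed.

Lemma same_invariants S T : same S T ->
  [/\ source T = source S, target T = target S, is_tangle T = is_tangle S &
      is_knot S -> is_knot T].
Proof.
pose V n (b b' : pro (braid n)) := pro_perm b' = pro_perm b /\ pact (R := F2) b' = pact (R := F2) b.
have fE g h : fund_near V g h ->
    [/\ fsource h = fsource g, ftarget h = ftarget g & eop (R := F2) h = eop (R := F2) g].
  case=> [u o v|n b b' eps [Eb Eb']|u o v] //; split=> //=; last by rewrite /eop Eb'.
  by rewrite Eb.
move=> ST; have tE w w' : typed w T w' = typed w S w'.
  elim: ST w => [//|g h S' T' /fE [Es Et _] _ IH] w /=.
  by rewrite Es Et IH.
have nE : nilp T = nilp S by case: ST.
have sE : source T = source S by case: ST => [|g h S' T' /fE []].
have eE : target T = target S.
  case: ST => [//|g h S' T' /fE [_ Et _] S'T'] /=.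
  elim: S'T' g h Et => [//|g' h' S'' T'' /fE [_ Et' _] _ IH] g h Et /=.
  exact: IH.
have oE : eops (R := F2) T = eops (R := F2) S.
  apply/funext => f; rewrite /eops; elim: {sE eE nE tE} ST => [//|g h S' T' /fE [_ _ gh] _ IH] /=.
  by rewrite gh IH.
split=> //; first by rewrite !is_tangleE nE tE sE eE.
by move=> /is_knotE [n0 tS cS]; apply/is_knotE; rewrite nE tE /count_col oE.
Qed.

Lemma closed_locally (X : topologicalType) (D : set X) :
  (forall x, \forall y \near x, D y -> D x) -> closed D.
Proof.
move=> H; rewrite -openC openE => x nDx; rewrite /interior.
by apply: filterS (H x) => y Dyx /Dyx.
Qed.

Lemma near_fst (X Y : topologicalType) (p : X * Y) (P : X -> Prop) :
  (\forall x \near p.1, P x) -> \forall q \near p, P q.1.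
Proof. exact: (@cvg_fst X Y (nbhs p.1) (nbhs p.2)). Qed.

Lemma near_snd (X Y : topologicalType) (p : X * Y) (P : Y -> Prop) :
  (\forall x \near p.2, P x) -> \forall q \near p, P q.2.
Proof. exact: (@cvg_snd X Y (nbhs p.1) (nbhs p.2)). Qed.

Lemma knot_open : open [set T : fseq | is_knot T].
Proof.
rewrite openE => T kT; rewrite /interior; apply: filterS (same_near T) => T' /same_invariants [_ _ _].
exact.
Qed.

End SameShape.

(** * Moves and isotopy steps as sigma-compact relations *)

Section SigmaCompactMoves.
Implicit Types X Y P Q : topologicalType.

Lemma sigma_compact_exists (I : countType) X (A : I -> set X) :
  (forall i, sigma_compact (A i)) -> sigma_compact [set x | exists i, A i x].
Proof.
move=> /sigma_compact_bigcup; congr sigma_compact.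
by rewrite predeqE => x; split=> [[i _ Ax]|[i Ax]]; exists i.
Qed.

Lemma sigma_compact_rangeI P X (E D : set P) (f : P -> X) : sigma_compact E -> closed D ->
  continuous f -> sigma_compact [set p | exists2 x, E x /\ D x & p = f x].
Proof.
move=> sE cD cf; have := sigma_compact_image cf (sigma_compact_closedI sE cD).
congr sigma_compact; rewrite predeqE => y; split=> [[x [Ex Dx] <-]|[x [Ex Dx] ->]]; by exists x.
Qed.

Lemma sigma_compact_range P X (D : set P) (f : P -> X) : sigma_compact [set: P] -> closed D ->
  continuous f -> sigma_compact [set p | exists2 x, D x & p = f x].
Proof.
move=> sP cD cf; have := sigma_compact_rangeI sP cD cf; congr sigma_compact.
by rewrite predeqE => y; split=> [[x [_ Dx] ->]|[x Dx ->]]; exists x.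
Qed.

Lemma sigma_compact_point X (x : X) (D : Prop) : sigma_compact [set p | D /\ p = x].
Proof.
apply: sigma_compact_compact; have [d|nd] := pselect D.
  rewrite (_ : mkset _ = [set x]); first exact: compact_set1.
  by rewrite predeqE => p; split=> [[]|].
rewrite (_ : mkset _ = set0); first exact: compact0.
by rewrite predeqE => p; split=> [[]|].
Qed.

Lemma sigma_compactXT P Q : sigma_compact [set: P] -> sigma_compact [set: Q] ->
  sigma_compact [set: P * Q].
Proof. by move=> sP sQ; rewrite -setXTT; exact: sigma_compactX. Qed.

Lemma pro_sigma_compact (G : groupType) : sigma_compact [set: pro G].
Proof. exact/sigma_compact_compact/pro_compact. Qed.

Lemma continuous_fst X Y : continuous (@fst X Y).
Proof. by move=> p; exact: cvg_fst. Qed.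

Lemma continuous_snd X Y : continuous (@snd X Y).
Proof. by move=> p; exact: cvg_snd. Qed.

Lemma continuous_mul X (G : groupType) (f g : X -> pro G) : continuous f ->
  continuous g -> continuous (fun x => pro_mul (f x) (g x)).
Proof.
move=> cf cg x; apply: (@continuous_comp _ _ _ (fun x => (f x, g x)) (fun p => pro_mul p.1 p.2)).
  by apply: continuous_pair.
exact: pro_mul_continuous.
Qed.

Lemma pro_pow_continuous (G : groupType) (x : G) : continuous (pro_pow x).
Proof. exact: pro_ext_continuous (ucont_expgz x). Qed.

Lemma pro_pow_perm_near n (x : braid n) (c : Zhat) :
  \forall c' \near c, pro_perm (pro_pow x c') = pro_perm (pro_pow x c).
Proof. exact: (@pro_pow_continuous _ x c _ (pro_perm_near (pro_pow x c))). Qed.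

Local Notation rel := (set (fseq * fseq)).

(** The word [w] is quantified first, as a countable discrete index. For each [w] the move is the
    continuous image of a closed set of sequences, since the conditions left on [T] are locally
    constant. The other moves are described in the same way. *)
Definition moveT1top : rel := [set p | exists w, exists2 T,
  is_tangle T /\ target T = w & p = (T ++ [:: triv w], T)].

Lemma moveT1top_sigma : sigma_compact moveT1top.
Proof.
apply: sigma_compact_exists => w; apply: sigma_compact_range; first exact: fseq_sigma_compact.
  apply: closed_locally => T; apply: filterS (same_near T) => T' /same_invariants [_ -> -> _] //.
apply: continuous_pair => [|T]; last exact: cvg_id.
by apply: continuous_cat => T; [exact: cvg_id|exact: cst_continuous].
Qed.

Definition moveT1bot : rel := [set p | exists w, exists2 T,
  is_tangle T /\ source T = w & p = (triv w :: T, T)].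

Lemma moveT1bot_sigma : sigma_compact moveT1bot.
Proof.
apply: sigma_compact_exists => w; apply: sigma_compact_range; first exact: fseq_sigma_compact.
  apply: closed_locally => T; apply: filterS (same_near T) => T' /same_invariants [-> _ -> _] //.
apply: continuous_pair => [|T]; last exact: cvg_id.
exact: cons_fund_continuous.
Qed.

Definition moveT2 : rel := [set p | exists n (e e' : n.-tuple bool),
  exists2 b : pro (braid n) * pro (braid n), ftarget (Braid b.1 e) = e' &
  p = ([:: Braid b.1 e; Braid b.2 e'], [:: Braid (pro_mul b.2 b.1) e])].

Lemma moveT2_sigma : sigma_compact moveT2.
Proof.
do 3![apply: sigma_compact_exists => ?]; apply: sigma_compact_range.
- by apply: sigma_compactXT; exact: pro_sigma_compact.
- apply: closed_locally => b.
  by apply: filterS (near_fst (pro_perm_near b.1)) => b' /= ->.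
apply: continuous_pair.
  apply: (@continuous_cat _ (fun b => [:: Braid b.1 _] : fseq) (fun b => [:: Braid b.2 _] : fseq)).
    by apply: continuous_Braid; exact: continuous_fst.
  by apply: continuous_Braid; exact: continuous_snd.
apply: continuous_Braid; apply: continuous_mul; [exact: continuous_snd|exact: continuous_fst].
Qed.

Definition moveT3 : rel := [set p | exists s t s' t', exists2 q : fseq * fseq,
  [/\ is_tangle q.1, is_tangle q.2, source q.1 = s & target q.1 = t] /\
  source q.2 = s' /\ target q.2 = t' &
  p = (pad [::] q.1 s' ++ pad t q.2 [::], pad s q.2 [::] ++ pad [::] q.1 t')].

Lemma moveT3_sigma : sigma_compact moveT3.
Proof.
do 4![apply: sigma_compact_exists => ?]; apply: sigma_compact_range.
- by apply: sigma_compactXT; exact: fseq_sigma_compact.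
- apply: closed_locally => q; have nq1 := near_fst (same_near q.1).
  apply: filterS (filterI nq1 (near_snd (same_near q.2))) => q'.
  by move=> [/same_invariants [-> -> -> _] /same_invariants [-> -> -> _]].
by apply: continuous_pair; apply: continuous_cat => q; apply: continuous_comp;
  [exact: continuous_fst|exact: continuous_pad|exact: continuous_snd|exact: continuous_pad|
   exact: continuous_snd|exact: continuous_pad|exact: continuous_fst|exact: continuous_pad].
Qed.

Definition moveT4 : rel := [set p | exists s t u o v u' v',
  exists2 q : fseq * pro (braid (size u + (1 + size v))),
  [/\ is_tangle q.1, source q.1 = s & target q.1 = t] /\
  (exists i j : 'I_(size u + (1 + size v)),
    [/\ i = size u :> nat, j = size u' :> nat, pro_perm q.2 j = i &
      ftarget (Braid q.2 (word3 u [:: o] v)) = u' ++ [:: o] ++ v']) &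
  p = (pad u q.1 v ++ [:: Braid (pro_ext (@cable (size u) (size t) (size v)) q.2) (word3 u t v)],
       Braid (pro_ext (@cable (size u) (size s) (size v)) q.2) (word3 u s v) :: pad u' q.1 v')].

Lemma moveT4_sigma : sigma_compact moveT4.
Proof.
do 7![apply: sigma_compact_exists => ?]; apply: sigma_compact_range.
- by apply: sigma_compactXT; [exact: fseq_sigma_compact|exact: pro_sigma_compact].
- apply: closed_locally => q; have nq1 := near_fst (same_near q.1).
  apply: filterS (filterI nq1 (near_snd (pro_perm_near q.2))) => q' [].
  by move=> /same_invariants [-> -> -> _] /= ->.
have cp u v (n : nat) : continuous (fun q : fseq * pro (braid n) => pad u q.1 v).
  by move=> q; apply: continuous_comp; [exact: continuous_fst|exact: continuous_pad].
have cb s u v w : continuous (fun q : fseq * pro (braid (size u + (1 + size v))) =>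
    [:: Braid (pro_ext (@cable (size u) s (size v)) q.2) w] : fseq).
  by apply: continuous_Braid; apply: continuous_ext; [exact: ucont_cable|exact: continuous_snd].
apply: continuous_pair; first by apply: continuous_cat; [exact: cp|exact: cb].
apply: (@continuous_cat _ (fun q => [:: Braid (pro_ext (@cable _ _ _) q.2) _] : fseq)
  (fun q => pad _ q.1 _)); [exact: cb|exact: cp].
Qed.

Definition moveT5 : rel := [set p | exists u o v u' o' v',
  [/\ size u' = (size u).+1 \/ size u = (size u').+1 &
    ftarget (Cup u o v) = fsource (Cap u' o' v')] /\
  p = ([:: Cup u o v; Cap u' o' v'], [:: triv (u ++ v)])].

Lemma moveT5_sigma : sigma_compact moveT5.
Proof. by do 6![apply: sigma_compact_exists => ?]; exact: sigma_compact_point. Qed.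

Definition moveT6cup : rel := [set p | exists u o v o', exists2 c : Zhat,
  ftarget (Braid (pro_pow (sigma _ (size u)) c) (word3 u [:: o; ~~ o] v)) =
    ftarget (Cup u o' v) &
  p = ([:: Cup u o v; Braid (pro_pow (sigma _ (size u)) c) (word3 u [:: o; ~~ o] v)],
       [:: Cup u o' v])].

Lemma moveT6cup_sigma : sigma_compact moveT6cup.
Proof.
apply: sigma_compact_exists => u; apply: sigma_compact_exists => o; apply: sigma_compact_exists => v; apply: sigma_compact_exists => o'.
apply: sigma_compact_range; first exact: pro_sigma_compact.
  by apply: closed_locally => c; apply: filterS (pro_pow_perm_near (sigma (size u + (2 + size v)) (size u)) c) => c' /= ->.
apply: continuous_pair => [|c]; last exact: cst_continuous.
apply: (@continuous_cat _ (fun=> [:: Cup u o v] : fseq)) => [c|]; first exact: cst_continuous.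
by apply: continuous_Braid; exact: pro_pow_continuous.
Qed.

Definition moveT6cap : rel := [set p | exists u o v o', exists2 c : Zhat,
  ftarget (Braid (pro_pow (sigma _ (size u)) c) (word3 u [:: o'; ~~ o'] v)) =
    fsource (Cap u o v) &
  p = ([:: Braid (pro_pow (sigma _ (size u)) c) (word3 u [:: o'; ~~ o'] v); Cap u o v],
       [:: Cap u o' v])].

Lemma moveT6cap_sigma : sigma_compact moveT6cap.
Proof.
apply: sigma_compact_exists => u; apply: sigma_compact_exists => o; apply: sigma_compact_exists => v; apply: sigma_compact_exists => o'.
apply: sigma_compact_range; first exact: pro_sigma_compact.
  by apply: closed_locally => c; apply: filterS (pro_pow_perm_near (sigma (size u + (2 + size v)) (size u)) c) => c' /= ->.
apply: continuous_pair => [|c]; last exact: cst_continuous.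
apply: (@continuous_cat _ (fun c => [:: Braid (pro_pow (sigma _ (size u)) c) _] : fseq)
  (fun=> [:: Cap u o v] : fseq)) => [|c].
  by apply: continuous_Braid; exact: pro_pow_continuous.
exact: cst_continuous.
Qed.

Lemma turaev_sigma_compact : sigma_compact [set p | turaev p.1 p.2].
Proof.
rewrite (_ : mkset _ = moveT1top `|` moveT1bot `|` moveT2 `|` moveT3 `|` moveT4 `|`
    moveT5 `|` moveT6cup `|` moveT6cap).
  do 7?[apply: sigma_compactU; last first; [first [exact: moveT6cap_sigma | exact: moveT6cup_sigma|
    exact: moveT5_sigma | exact: moveT4_sigma | exact: moveT3_sigma|
    exact: moveT2_sigma | exact: moveT1bot_sigma]|]].
  exact: moveT1top_sigma.
rewrite predeqE => -[L R]; split=> /=.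
- case=> [T tT|T tT|n b1 b2 e1 e2 E|S T tS tT|T u o v u' v' b i j tT iu ju ij E|
          u o v u' o' v' Hu E|u o v o' c /= E|u o v o' c /= E].
  + by do 7!left; exists (target T), T.
  + by do 6!left; right; exists (source T), T.
  + by do 5!left; right; exists n, e1, e2, (b1, b2).
  + by do 4!left; right; exists (source S), (target S), (source T), (target T), (S, T).
  + do 3!left; right; exists (source T), (target T), u, o, v, u', v', (T, b) => //.
    by split=> //; exists i, j.
  + by do 2!left; right; exists u, o, v, u', o', v'.
  + by left; right; exists u, o, v, o', c.
  + by right; exists u, o, v, o', c.
- move=> [[[[[[[|]|]|]|]|]|]|].
  + by move=> [w [T [tT <-] [-> ->]]]; exact: T1top.
  + by move=> [w [T [tT <-] [-> ->]]]; exact: T1bottom.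
  + by move=> [n [e [e' [b E [-> ->]]]]]; exact: T2.
  + by move=> [s [t [s' [t' [q [[t1 t2 <- <-] [<- <-]] [-> ->]]]]]]; exact: T3.
  + move=> [s [t [u [o [v [u' [v' [q [[tT <- <-] [i [j [iu ju ij E]]]] [-> ->]]]]]]]]].
    exact: (T4 tT iu ju ij E).
  + by move=> [u [o [v [u' [o' [v' [[Hu E] [-> ->]]]]]]]]; exact: T5.
  + by move=> [u [o [v [o' [c E [-> ->]]]]]]; exact: T6cup.
  + by move=> [u [o [v [o' [c E [-> ->]]]]]]; exact: T6cap.
Qed.

Lemma step_sigma_compact : sigma_compact [set p | tangle_step p.1 p.2].
Proof.
have cE (f : fseq * fseq * (fseq * fseq) -> fseq) : continuous f ->
    continuous (fun x : fseq * fseq * (fseq * fseq) => x.1.1 ++ f x ++ x.1.2 : fseq).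
  move=> cf; apply: continuous_cat.
    by move=> x; apply: continuous_comp; exact: continuous_fst.
  apply: continuous_cat => // x.
  by apply: continuous_comp; [exact: continuous_fst|exact: continuous_snd].
have /cE c1 : continuous (fun x : fseq * fseq * (fseq * fseq) => x.2.1).
  by move=> x; apply: continuous_comp; [exact: continuous_snd|exact: continuous_fst].
have /cE c2 : continuous (fun x : fseq * fseq * (fseq * fseq) => x.2.2).
  by move=> x; apply: continuous_comp; exact: continuous_snd.
have := @sigma_compact_rangeI _ _ ([set: fseq * fseq] `*` [set p | turaev p.1 p.2])
  [set x | is_tangle (x.1.1 ++ x.2.1 ++ x.1.2) /\ is_tangle (x.1.1 ++ x.2.2 ++ x.1.2)] _
  _ _ (continuous_pair c1 c2).
set S1 := [set p | exists2 _, _ & _].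
rewrite (_ : S1 = [set p | tangle_step p.1 p.2]); last first.
  rewrite predeqE => -[L R]; split=> /=.
    by move=> [[[A B] [L' R']] [[_ LR] [tL tR]] [-> ->]]; exact: TangleStep.
  by move=> H; inversion H as [A B L' R' LR tL tR]; exists ((A, B), (L', R')).
apply.
  apply: sigma_compactX; last exact: turaev_sigma_compact.
  by apply: sigma_compactXT; exact: fseq_sigma_compact.
apply: closed_locally => x.
have n1 : \forall y \near x, same (x.1.1 ++ x.2.1 ++ x.1.2) (y.1.1 ++ y.2.1 ++ y.1.2).
  by apply: c1; exact: same_near.
have n2 : \forall y \near x, same (x.1.1 ++ x.2.2 ++ x.1.2) (y.1.1 ++ y.2.2 ++ y.1.2).
  by apply: c2; exact: same_near.
apply: filterS (filterI n1 n2) => y /=.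
by move=> [/same_invariants [_ _ -> _] /same_invariants [_ _ -> _]].
Qed.

End SigmaCompactMoves.

(** * The topological group *)

Section GroupTopology.
Implicit Types (r s t : fseq) (p q : fseq * fseq) (k l : Khat).

(** The construction only inspects caps, cups and their orientations; a braid is kept as it is or
    dropped. *)
Lemma body_continuous : continuous body.
Proof.
apply: box_continuous => V S T rV ST; apply/box_rev.
have cut_b S' T' : box V S' T' -> box V (cut_bottom S') (cut_bottom T').
  elim=> [|g h X Y gh XY IH]; first by constructor.
  case: gh => [u o v|n b b' eps _|u o v] //=; case: o => //.
  by constructor=> //; constructor.
have cut_t S' T' : box V S' T' -> box V (cut_top_rev S') (cut_top_rev T').
  elim=> [|g h X Y gh XY IH]; first by constructor.
  case: gh => [u o v|n b b' eps _|u o v] //=; case: o => //.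
  by constructor=> //; constructor.
by apply/cut_t/box_rev/cut_b.
Qed.

(* A continuous lift of the connected sum to sequences. *)
Definition csum r s : fseq := nk (body s ++ body r).

Lemma continuous_csum (X : topologicalType) (f g : X -> fseq) :
  continuous f -> continuous g -> continuous (fun x => csum (f x) (g x)).
Proof.
move=> cf cg.
have cb (h : X -> fseq) : continuous h -> continuous (fun x => body (h x)).
  by move=> ch x; apply: continuous_comp; [exact: ch | exact: body_continuous].
have cX := continuous_cat (cb _ cg) (cb _ cf).
rewrite /csum /nk; apply: (@continuous_cat _ (fun=> [:: Cup [::] false [::]] : fseq)).
  by move=> x; exact: cst_continuous.
rewrite (_ : (fun x => _) = (fun x => (body (g x) ++ body (f x)) ++ [:: Cap [::] false [::]])).
  by apply: continuous_cat => // x; exact: cst_continuous.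
by apply/funext => x; rewrite cats1.
Qed.

Lemma csum_knot r s : is_knot r -> is_knot s -> is_knot (csum r s).
Proof.
move=> /body_isotopic [_ br] /body_isotopic [_ bs].
by apply/body_knot/body_cat.
Qed.

Lemma cls_csum r s : is_knot r -> is_knot s -> cls (csum r s) = sharp (cls r) (cls s).
Proof.
move=> kr ks; have [Ir br] := body_isotopic kr; have [Is bs] := body_isotopic ks.
rewrite /csum -sharp_nk //; congr sharp; apply/esym/cls_eq => //; exact: body_knot.
Qed.

Lemma cls_ex k : exists2 r, is_knot r & k = cls r.
Proof. by have [A bA ->] := cls_surj k; exists (nk A) => //; exact: body_knot. Qed.

(** Only the generators of isotopy, in both directions: a set closed under them is closed under
    isotopy, so sigma-compactness of the transitive closure never has to be shown. *)
Definition isorel : set (fseq * fseq) :=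
  [set p | tangle_step p.1 p.2] `|` [set p | tangle_step p.2 p.1].

Lemma continuous_swap (X Y : topologicalType) : continuous (fun x : X * Y => (x.2, x.1)).
Proof. by apply: continuous_pair; [exact: continuous_snd|exact: continuous_fst]. Qed.

Lemma sigma_compact_swap (X Y : topologicalType) (S : set (X * Y)) :
  sigma_compact S -> sigma_compact [set p | S (p.2, p.1)].
Proof.
move=> /(sigma_compact_image (@continuous_swap X Y)); congr sigma_compact.
by rewrite predeqE => -[x y]; split=> [[[y' x'] Sx [<- <-]] //|Sx]; exists (y, x).
Qed.

Lemma isorel_sigma_compact : sigma_compact isorel.
Proof.
apply: sigma_compactU; first exact: step_sigma_compact.
exact: sigma_compact_swap step_sigma_compact.
Qed.

Lemma isotopic_isorel r s : isorel (r, s) -> isotopic r s.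
Proof. by move=> [|] /= H; [apply: rst_step|apply/rst_sym/rst_step]. Qed.

Lemma closed_under_isotopic (A : set fseq) r s :
  closed_under isorel A -> isotopic r s -> A r -> A s.
Proof.
move=> cA rs; suff: A r <-> A s by case.
elim: rs => [x y xy|//|x y _ [H H']|x y z _ [H1 H2] _ [H3 H4]]; split; auto.
- by apply: cA; left.
- by apply: cA; right.
Qed.

Definition knots2 : set (fseq * fseq) := [set p | is_knot p.1 /\ is_knot p.2].

Definition fr p : GKhat := frac (cls p.1, cls p.2).

Lemma fr_surj (x : GKhat) : exists2 p, knots2 p & x = fr p.
Proof.
elim/GKhat_ind: x => -[k l]; have [r kr ->] := cls_ex k; have [s ks ->] := cls_ex l.
by exists (r, s).
Qed.

(** Expansion of a fraction by a common summand, parametrized by three sequences. Read backwards, it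
    performs the cancellation that [frac_eq] entrusts to an unknown knot. *)
Definition expand : set ((fseq * fseq) * (fseq * fseq)) :=
  [set P | exists2 x : fseq * fseq * fseq,
    [/\ is_knot x.1.1, is_knot x.1.2 & is_knot x.2] &
    P = (x.1, (csum x.1.1 x.2, csum x.1.2 x.2))].

Lemma expand_sigma_compact : sigma_compact expand.
Proof.
apply: sigma_compact_range.
- by do 2?[apply: sigma_compactXT]; exact: fseq_sigma_compact.
- apply: closed_locally => x.
  have n1 := near_fst (near_fst (same_near x.1.1)).
  have n2 := near_fst (near_snd (same_near x.1.2)).
  have n3 := near_snd (same_near x.2).
  apply: filterS (filterI n1 (filterI n2 n3)) => y.
  move=> [/same_sym/same_invariants [_ _ _ H1]].
  move=> [/same_sym/same_invariants [_ _ _ H2] /same_sym/same_invariants [_ _ _ H3]].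
  by move=> [/H1 ? /H2 ? /H3 ?].
have c1 (X Y Z : topologicalType) : continuous (fun x : X * Y * Z => x.1.1).
  by move=> x; apply: continuous_comp; exact: continuous_fst.
have c2 (X Y Z : topologicalType) : continuous (fun x : X * Y * Z => x.1.2).
  by move=> x; apply: continuous_comp; [exact: continuous_fst|exact: continuous_snd].
apply: continuous_pair; first exact: continuous_fst.
apply: continuous_pair; apply: continuous_csum; try exact: continuous_snd.
  exact: c1.
exact: c2.
Qed.

(* Generates, on pairs of knots, the relation of having the same class in GKhat. *)
Definition fracrel : set ((fseq * fseq) * (fseq * fseq)) :=
  [set P | isorel (P.1.1, P.2.1) /\ P.1.2 = P.2.2] `|`
  [set P | P.1.1 = P.2.1 /\ isorel (P.1.2, P.2.2)] `|`
  expand `|` [set P | expand (P.2, P.1)].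

Lemma fracrel_sigma_compact : sigma_compact fracrel.
Proof.
apply: sigma_compactU; last exact: sigma_compact_swap expand_sigma_compact.
apply: sigma_compactU; last exact: expand_sigma_compact.
have c11 (X Y Z : topologicalType) : continuous (fun x : X * Y * Z => x.1.1).
  by move=> x; apply: continuous_comp; exact: continuous_fst.
have c12 (X Y Z : topologicalType) : continuous (fun x : X * Y * Z => x.1.2).
  by move=> x; apply: continuous_comp; [exact: continuous_fst|exact: continuous_snd].
have c2 (X Y : topologicalType) : continuous (@snd X Y) := @continuous_snd X Y.
have sP := sigma_compactX isorel_sigma_compact fseq_sigma_compact.
apply: sigma_compactU.
  have c : continuous (fun x : fseq * fseq * fseq => ((x.1.1, x.2), (x.1.2, x.2))).
    by apply: continuous_pair; apply: continuous_pair; try exact: c2; [exact: c11|exact: c12].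
  have := sigma_compact_image c sP; congr sigma_compact.
  rewrite predeqE => -[[r s] [r' s']]; split=> [[[[a b] d] [/= ab _] [<- <- <- <-]] //|[/= rr' <-]].
  by exists ((r, r'), s).
have c : continuous (fun x : fseq * fseq * fseq => ((x.2, x.1.1), (x.2, x.1.2))).
  by apply: continuous_pair; apply: continuous_pair; try exact: c2; [exact: c11|exact: c12].
have := sigma_compact_image c sP; congr sigma_compact.
rewrite predeqE => -[[r s] [r' s']]; split=> [[[[a b] d] [/= ab _] [<- <- <- <-]] //|[/= <- ss']].
by exists ((s, s'), r).
Qed.

Lemma expand_sound p q : expand (p, q) -> [/\ knots2 p, knots2 q & fr p = fr q].
Proof.
move=> [[[r s] t] /= [kr ks kt] [-> ->]].
split; first by []; first by split; exact: csum_knot.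
apply/frac_eqP; exists unknot; rewrite /= !cls_csum //.
by rewrite !sharpK1 -sharpA (sharpC (cls t)).
Qed.

Lemma fracrel_sound p q : fracrel (p, q) -> knots2 p -> knots2 q /\ fr p = fr q.
Proof.
move=> [[[[/isotopic_isorel I E]|[E /isotopic_isorel I]]|/expand_sound []]|/expand_sound []] //.
- case: p q I E => [r s] [r' s'] /= I <- [kr ks]; have kr' := proj1 (isotopic_knot I) kr.
  by split=> //; rewrite /fr /= (proj2 (cls_eq kr kr') I).
- case: p q I E => [r s] [r' s'] /= I <- [kr ks]; have ks' := proj1 (isotopic_knot I) ks.
  by split=> //; rewrite /fr /= (proj2 (cls_eq ks ks') I).
Qed.

(** Expanding [r/s] by the sum of [s'] and [t] gives, up to isotopy of numerator and denominator,
    the expansion of [r'/s'] by the sum of [s] and [t], which is then reduced. *)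
Lemma closed_under_fr (A : set (fseq * fseq)) p q : closed_under fracrel A ->
  knots2 p -> knots2 q -> fr p = fr q -> A p -> A q.
Proof.
case: p q => [r s] [r' s'] cA [/= kr ks] [/= kr' ks'] /frac_eqP [u /= E] Ars.
have [t kt ut] := cls_ex u; rewrite {u}ut in E.
have k1 := csum_knot ks' kt; have k2 := csum_knot ks kt.
have A1 : A (csum r (csum s' t), csum s (csum s' t)).
  by apply: cA Ars; left; right; exists ((r, s), csum s' t).
have iso1 : isotopic (csum r (csum s' t)) (csum r' (csum s t)).
  by apply/cls_eq; rewrite ?cls_csum //; try exact: csum_knot; rewrite !sharpA.
have iso2 : isotopic (csum s (csum s' t)) (csum s' (csum s t)).
  apply/cls_eq; rewrite ?cls_csum //; try exact: csum_knot.
  by rewrite !sharpA (sharpC (cls s)).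
apply: (cA (csum r' (csum s t), csum s' (csum s t))).
  by right; exists ((r', s'), csum s t).
have A2 : A (csum r' (csum s t), csum s (csum s' t)).
  apply: (@closed_under_isotopic (fun a => A (a, _)) _ _ _ iso1 A1) => a b ab.
  by apply: cA; do 3!left.
apply: (@closed_under_isotopic (fun a => A (_, a)) _ _ _ iso2 A2) => a b ab.
by apply: cA; do 2!left; right.
Qed.

Lemma cls_preimage_open (U : set Khat) : open U -> open [set r | is_knot r /\ U (cls r)].
Proof.
move=> oU; have [V oV VU] : open (\pi_Khat @^-1` U : set knot) := oU.
rewrite (_ : mkset _ = [set r | is_knot r] `&` V); first exact: openI knot_open oV.
have VE (K : knot) : V (knot_seq K) <-> U (knot_class K).
  by have := congr1 (@^~ K) VU => /= E; rewrite -[U _]E.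
rewrite predeqE => r; split=> -[kr].
  by rewrite (cls_mk kr) => /VE.
by move=> Vr; split=> //; rewrite (cls_mk kr); apply/VE.
Qed.

Lemma cls_image_open (A : set fseq) : open A -> closed_under isorel A ->
  open [set k | exists2 r, is_knot r /\ A r & k = cls r].
Proof.
move=> oA cA; rewrite /open /= /quotient_open.
exists A => //; rewrite predeqE => K; split=> /= [AK|[r [kr Ar] E]].
  by exists (knot_seq K); [split=> //; exact: knot_seqP|rewrite clsE].
apply: closed_under_isotopic cA _ Ar.
by apply/(cls_eq kr (knot_seqP K)); rewrite clsE.
Qed.

Lemma fr_preimage_open (O : set GKhat) : open O -> open [set p | knots2 p /\ O (fr p)].
Proof.
move=> oO; have oO' : open [set kl : Khat * Khat | O (frac kl)].
  exact: oO.
rewrite openE => -[r s] [[/= kr ks] Ors].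
move: oO'; rewrite openE => /(_ (cls r, cls s) Ors) [[U V] [/= Ur Vs] UV].
move: Ur Vs; rewrite !nbhsE => -[U' [oU' U'r] U'U] [V' [oV' V's] V'V].
exists ([set r | is_knot r /\ U' (cls r)], [set s | is_knot s /\ V' (cls s)]) => /=.
  by split; apply: open_nbhs_nbhs; split=> //; exact: cls_preimage_open.
move=> [r' s'] [/= [kr' Ur'] [ks' Vs']]; split=> //.
by apply: UV; split; [exact: U'U | exact: V'V].
Qed.

(** Openness in [GKhat] is tested in a product of two quotients, hence by boxes of classes;
    [separation] provides boxes of sequences saturated for isotopy around any representative. *)
Lemma fr_image_open (A : set (fseq * fseq)) : open A -> closed_under fracrel A ->
  open [set x | exists2 p, knots2 p /\ A p & x = fr p].
Proof.
move=> oA cA; rewrite /open /= /quotient_open openE => -[k l].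
have [r kr ->] := cls_ex k; have [s ks ->] := cls_ex l => -[p [kp Ap] /esym E].
have Ars : A (r, s) := closed_under_fr cA kp (conj kr ks : knots2 (r, s)) E Ap.
have [|x y z xy|U [V [[oU oV Ur Vs UV] [cU cV]]]] := separation fseq_locally_profinite
  fseq_locally_profinite isorel_sigma_compact isorel_sigma_compact oA _ _ Ars.
- by move=> x x' y xx'; apply: cA; do 3!left.
- by apply: cA; do 2!left; right.
exists ([set k | exists2 r, is_knot r /\ U r & k = cls r],
        [set k | exists2 r, is_knot r /\ V r & k = cls r]) => /=.
  split; apply: open_nbhs_nbhs; split; try exact: cls_image_open.
    by exists r.
  by exists s.
move=> [_ _] [/= [r' [kr' Ur'] ->] [s' [ks' Vs'] ->]].
by exists (r', s') => //; split=> //; exact: UV.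
Qed.

Lemma gmul_fr p q : knots2 p -> knots2 q ->
  gmul (fr p) (fr q) = fr (csum p.1 q.1, csum p.2 q.2).
Proof. by move=> [k1 k2] [k3 k4]; rewrite gmulE /fr /= !cls_csum. Qed.

(** Here [separation] is applied to two pairs of sequences and the relation [fracrel]: the saturated
    box around representatives of [x] and [y] descends to a box of open sets in [GKhat]. *)
Lemma gmul_continuous : continuous (fun p : GKhat * GKhat => gmul p.1 p.2).
Proof.
move=> [x y] O; rewrite nbhsE => -[O' [oO O'xy] O'O].
have [p kp xp] := fr_surj x; have [q kq yq] := fr_surj y; subst x y.
pose f (P : (fseq * fseq) * (fseq * fseq)) := (csum P.1.1 P.2.1, csum P.1.2 P.2.2).
have cf : continuous f.
  apply: continuous_pair; apply: continuous_csum => P; apply: continuous_comp;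
    by [exact: continuous_fst|exact: continuous_snd].
(* On knots [csum] lifts the sum, so [W] depends only on classes in [GKhat] and is saturated in each
   variable; restricting to knots keeps it open by [knot_open]. *)
pose W := (knots2 `*` knots2) `&` f @^-1` [set p | knots2 p /\ O' (fr p)].
have oW : open W.
  apply: openI.
    by rewrite /knots2; apply: openX; apply: (openX knot_open knot_open).
  by apply: (proj1 (continuousP _) cf); exact: fr_preimage_open.
have WE P : W P <-> [/\ knots2 P.1, knots2 P.2 & O' (gmul (fr P.1) (fr P.2))].
  split=> [[[k1 k2] [_ H]]|[k1 k2 H]]; first by rewrite gmul_fr.
  split=> //; split; last by rewrite -gmul_fr.
  by case: k1 k2 => ? ? [? ?]; split; exact: csum_knot.
have lZ := locally_profiniteX fseq_locally_profinite fseq_locally_profinite.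
have [P P' Q PP'|P Q Q' QQ'|//|A [B [[oA oB Ap Bq AB] [cA cB]]]] :=
  @separation _ _ fracrel fracrel W p q lZ lZ fracrel_sigma_compact fracrel_sigma_compact oW.
- move=> /WE [/= kP kQ H]; apply/WE => /=.
  by have [kP' E] := fracrel_sound PP' kP; rewrite -E.
- move=> /WE [/= kP kQ H]; apply/WE => /=.
  by have [kQ' E] := fracrel_sound QQ' kQ; rewrite -E.
- by apply/WE.
exists ([set x | exists2 p, knots2 p /\ A p & x = fr p],
        [set x | exists2 p, knots2 p /\ B p & x = fr p]) => /=.
  split; apply: open_nbhs_nbhs; split; try exact: fr_image_open.
    by exists p.
  by exists q.
move=> [_ _] [/= [p' [kp' Ap'] ->] [q' [kq' Bq'] ->]]; apply: O'O.
by have /WE [] := AB (p', q') (conj Ap' Bq').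
Qed.

Lemma ginv_continuous : continuous ginv.
Proof.
apply/quotient_continuous.
rewrite (_ : _ \o _ = fun kl => frac (kl.2, kl.1)).
  move=> kl; apply: (@continuous_comp _ _ _ (fun kl => (kl.2, kl.1)) frac).
    exact: continuous_swap.
  exact: pi_continuous.
by apply/funext => kl /=; rewrite -[\pi_ _ kl]/(frac kl) ginvE.
Qed.

End GroupTopology.

Theorem theorem2p34 :
  ((forall p q : Khat * Khat, frac p = frac q <-> frac_eq p q) /\
   (forall p p' q q' : Khat * Khat, frac_eq p p' -> frac_eq q q' ->
      frac_eq (sharp2 p q) (sharp2 p' q')) /\
   exists mul : GKhat -> GKhat -> GKhat,
     (forall p q : Khat * Khat, mul (frac p) (frac q) = frac (sharp2 p q)) /\
     topological_commutative_group mul) /\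
  ((exists x y : GKhat, x <> y) /\ infinite_set [set: GKhat]).
Proof.
split; last split; last exact: GKhat_infinite.
- split; first exact: frac_eqP.
  split; first exact: frac_eq_sharp2.
  exists gmul; split; first exact: gmulE.
  split; [exact: gmulA|exact: gmulC|exact: gmul_continuous|].
  by exists gone, ginv; split; [exact: gmul1|exact: gmulV|exact: ginv_continuous].
- exists (frac (trefoils 0, unknot)), (frac (trefoils 1, unknot)).
  by move=> /frac_trefoils_inj.
Qed.
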